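(* Let $q\in(2,3]$. There is a constant $K>0$ depending only on $q$ such that the following holds. Let $Y_1,\dots,Y_n$ be independent random variables in a separable Hilbert space $\mathcal H$ with $\mathbb EY_i=0$ and $\mathbb E\|Y_i\|^q<\infty$, let $T$ be a real-valued random variable, $S=n^{-1}\|\sum_{i=1}^nY_i\|^2$, $\Psi=n^{-1}\sum_{i=1}^n\mathbb EY_i\otimes Y_i$, and $$A=\|\Psi\|_1,\qquad B=\sqrt2\,\|\Psi\|_2,\qquad C=2\|\Psi\|_3 .$$ Let $G\sim\mathcal N(0,1)$. Then, for all $u>0$, $$\mathbf U\Big(\frac{T-A}{B},G\Big)\le K\Big[n^{-q/8}\Big(\frac{A^3}{B^3}\sum_{i=1}^n\frac{\mathbb E\|Y_i\|^q}{A^{q/2}}\Big)^{1/4}+\Big(\frac CB\Big)^3+\mathbb P(|T-S|>u)+\frac uB\Big].$$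
   Context: $T$ and $Y_1,\dots,Y_n$ are defined on a common probability space (no independence between $T$ and the $Y_i$ is assumed). $(u\otimes v)x=\langle v,x\rangle u$; $\|\cdot\|_q$ applied to operators is the Schatten $q$-norm; $\Psi\neq0$. $\mathbf U(X,Y)=\sup_{x\in\mathbb R}|\mathbb P(X\le x)-\mathbb P(Y\le x)|$ for real random variables $X,Y$. *)

(* Defs.v *)
From mathcomp Require Export all_boot all_order all_algebra sesquilinear.
From mathcomp Require Export all_classical all_reals all_analysis.
Export Order.TTheory GRing.Theory Num.Theory.
Export numFieldNormedType.Exports.

Set Implicit Arguments.
Unset Strict Implicit.
Unset Printing Implicit Defensive.

#[global] Open Scope classical_set_scope.
#[global] Open Scope ring_scope.

Definition separable_space (H : topologicalType) : Prop :=
  exists2 D : set H, countable D & dense D.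

Notation borel H := (g_sigma_algebraType (@open H)).

(* A real Hilbert space is a complete normed module [H] with a dot product that
   induces its norm. *)
Definition hilbert_dot (R : realType) (H : completeNormedModType R)
    (dot : {dot H for idfun}) : Prop :=
  forall x : H, dot x x = `|x| ^+ 2.

Section operators.
Context {R : realType} {H : completeNormedModType R} (dot : {dot H for idfun}).

Definition tensor (u v : H) : H -> H := fun x => dot v x *: u.

Definition orthonormal_family (m : nat) (e : 'I_m -> H) : Prop :=
  forall i j, dot (e i) (e j) = (i == j)%:R.

Definition hilbert_dim (V : set H) : \bar R :=
  ereal_sup [set m%:R%:E | m in
    [set m : nat | exists2 e : 'I_m -> H,
       orthonormal_family e & forall i, V (e i)]].

Definition compact_operator (L : H -> H) : Prop :=
  precompact (L @` [set x | `|x| <= 1]).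

(* [<L e, L x> = s^2 <e, x>] for all [x] means [L^* L e = s^2 e]; hence, for
   [s > 0], this is the eigenspace of [|L| = (L^* L)^(1/2)] for [s], and its
   dimension is the multiplicity of the singular value [s]. *)
Definition singular_space (L : H -> H) (s : R) : set H :=
  [set e | forall x, dot (L e) (L x) = s ^+ 2 * dot e x].

(* [(sum_k s_k(L)^p)^(1/p)], the positive singular values of the (linear)
   operator [L] being repeated according to multiplicity: a real [s] that is not
   a singular value contributes 0. Non-compact operators are in no Schatten
   class. *)
Definition schatten (p : R) (L : H -> H) : \bar R :=
  if `[< compact_operator L >] then
    ((\esum_(s in [set s : R | (0 < s)%R])
       hilbert_dim (singular_space L s) * (s `^ p)%:E) `^ p^-1)%E
  else +oo%E.

End operators.

Section probability.
Context {d : measure_display} {Omega : measurableType d} {R : realType}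
  (P : probability Omega R).

Definition mutually_independent (d' : measure_display) (E : measurableType d')
    (I : finType) (X : I -> {RV P >-> E}) : Prop :=
  forall (J : {set I}) (A : I -> set E), (forall i, measurable (A i)) ->
  P (\bigcap_(i in [set` J]) (X i @^-1` A i)) =
  (\prod_(i in J) P (X i @^-1` A i))%E.

Context {H : completeNormedModType R} (dot : {dot H for idfun}).

(* [m] is the expectation of the [H]-valued [X]; the right-hand side being
   finite, this entails that every [<X, v>] is integrable. *)
Definition is_expectation (X : Omega -> H) (m : H) : Prop :=
  forall v : H, ('E_P[fun w => dot (X w) v] = (dot m v)%:E)%E.

(* [0] when [X] has no expectation. *)
Definition hexpectation (X : Omega -> H) : H :=
  xget 0 [set m | is_expectation X m].

(* The expectation of a random operator, taken pointwise: [(E L) x = E (L x)] *)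
Definition op_expectation (L : Omega -> H -> H) : H -> H :=
  fun x => hexpectation (fun w => L w x).

Definition norm_moment (q : R) (X : Omega -> H) : \bar R :=
  ('E_P[fun w => (`|X w| `^ q)%R])%E.

Definition avg_covariance (n : nat) (Y : 'I_n -> Omega -> H) : H -> H :=
  fun x => n%:R^-1 *:
    \sum_(i < n) op_expectation (fun w => tensor dot (Y i w) (Y i w)) x.

End probability.

Definition std_normal (d : measure_display) (Omega : measurableType d)
    (R : realType) (P : probability Omega R) (G : {RV P >-> R}) : Prop :=
  forall A : set R, measurable A -> distribution P G A = normal_prob 0 1 A.

(* The two variables may live on different probability spaces. *)
Definition kolmogorov_dist (R : realType)
    (d1 : measure_display) (O1 : measurableType d1) (P1 : probability O1 R)
    (X1 : O1 -> R)
    (d2 : measure_display) (O2 : measurableType d2) (P2 : probability O2 R)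
    (X2 : O2 -> R) : R :=
  sup [set `|fine (P1 [set w | X1 w <= x]) - fine (P2 [set w | X2 w <= x])|
      | x in [set: R]].

(* Main.v *)
Require Import Defs.
From HB Require Import structures.
From mathcomp Require Import measurable_realfun ring lra.

(** Let [Z = n^(-1/2) sum_i Y_i], so that [S = |Z|^2] and [Psi] is the covariance
   of [Z]. Project [Z] on finitely many eigenvectors of [Psi], with eigenvalues
   [lam_j]. For a smooth approximation [h] of the indicator of [(-oo, t]] at scale
   [eps], with [t <= A / B], the derivatives of [z |-> h ((|z|^2 - A) / B)] vanish
   outside [|z| <= 4 sqrt A]. This function is compared on [Z] and on a Gaussian
   vector [N] with the same covariance along the path [cos t Z + sin t N]: Gaussian
   integration by parts is exact for [N], approximate for the [Y_i], and the error
   is controlled by the moments of order [q] because [min (y^2, y^3) <= y^q]. The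
   variable [(|N|^2 - A) / B] is the weighted chi-square variable
   [sum_j (lam_j / B) (g_j^2 - 1)], which is compared with the normal law through
   Stein's equation, the error being of order [sum_j (lam_j / B)^3]. Optimizing
   [eps] gives the finite-dimensional bound. The eigenvalues of [Psi] are exhausted
   in trace since a positive operator of finite trace is compact and the norm of
   the part of [Psi] orthogonal to the chosen eigenvectors tends to [0]. *)

(** The exponents come from one balance. On the ball carrying the derivatives of the test function,
    the second and third differentials have size [k ^ 2] and [k ^ 3] with [k = sqrt A / (B eps)], so
    the error along the path is of order [k ^ q] times the moments, at most a constant times
    [L / eps ^ 3], where [L] is the bracket raised to the power 1/4 in the theorem, up to
    normalization; smoothing costs [eps], hence [eps = L ^ (1/4)]. The obstacle is the chi-square
    step: the second derivative of Stein's solution contains [h'], of size [1 / eps], and a crude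
    bound would give [rho / eps], with [rho] the sum of the cubes of the [lam_j / B]. The remedy is
    to add [rho] to [eps] and to integrate by parts once more. The localization [|z| <= 4 sqrt A] is
    restricted to levels [t <= A / B]; beyond, both distribution functions are close to 1, because
    [1 - Phi (A / B)] is of order [B / A], itself at most of order [rho]. In Hilbert space, the
    Schatten norms, which are sums over all positive reals weighted by multiplicities, have to be
    approximated by finitely many eigenvectors that serve for the exponents 1, 2 and 3 at once. *)

Set Implicit Arguments.
Unset Strict Implicit.
Unset Printing Implicit Defensive.

(** * Real expectations *)

Section expectation.
Context {d : measure_display} {T : measurableType d} {R : realType}.

Definition intg (P : probability T R) (f : T -> R) : Prop :=
  P.-integrable [set: T] (EFin \o f).

Definition Ex (P : probability T R) (f : T -> R) : R := \int[P]_x f x.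

Variable P : probability T R.
Implicit Types f g : T -> R.

Lemma intg_measurable f : intg P f -> measurable_fun [set: T] f.
Proof. by move=> /measurable_int /measurable_EFinP. Qed.

Lemma Ex_EFin f : intg P f -> (\int[P]_x (f x)%:E = (Ex P f)%:E)%E.
Proof. by move=> fi; rewrite /Ex /Rintegral fineK//; exact: integrable_fin_num. Qed.

Lemma eq_intg f g : f =1 g -> intg P f -> intg P g.
Proof. by move=> /funext ->. Qed.

Lemma eq_Ex f g : f =1 g -> Ex P f = Ex P g.
Proof. by move=> /funext ->. Qed.

Lemma intgD f g : intg P f -> intg P g -> intg P (fun x => f x + g x).
Proof.
move=> fi gi; have := integrableD measurableT fi gi.
by apply: eq_integrable => // x _ /=; rewrite EFinD.
Qed.

Lemma intgZ k f : intg P f -> intg P (fun x => k * f x).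
Proof.
move=> fi; have := integrableZl measurableT k fi.
by apply: eq_integrable => // x _ /=; rewrite EFinM.
Qed.

Lemma intgN f : intg P f -> intg P (fun x => - f x).
Proof. by move=> /(intgZ (-1)); apply: eq_intg => x; rewrite mulN1r. Qed.

Lemma intgB f g : intg P f -> intg P g -> intg P (fun x => f x - g x).
Proof. by move=> fi /intgN; exact: intgD. Qed.

Lemma intg_cst k : intg P (fun=> k).
Proof. exact: finite_measure_integrable_cst. Qed.

Lemma intg_sum I (s : seq I) (Q : pred I) (F : I -> T -> R) :
  (forall i, Q i -> intg P (F i)) -> intg P (fun x => \sum_(i <- s | Q i) F i x).
Proof.
move=> Fi; elim: s => [|a s IH].
  by apply: (eq_intg _ (intg_cst 0)) => x; rewrite big_nil.
have [Qa|Qa] := boolP (Q a).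
  by apply: (eq_intg _ (intgD (Fi a Qa) IH)) => x; rewrite big_cons Qa.
by apply: (eq_intg _ IH) => x; rewrite big_cons (negbTE Qa).
Qed.

Lemma le_intg f g : measurable_fun [set: T] f ->
  (forall x, `|f x| <= `|g x|) -> intg P g -> intg P f.
Proof.
move=> mf fg; apply: le_integrable => //; first exact/measurable_EFinP.
by move=> x _ /=; rewrite lee_fin.
Qed.

Lemma dom_intg f g : measurable_fun [set: T] f ->
  (forall x, `|f x| <= g x) -> intg P g -> intg P f.
Proof.
move=> mf fg; apply: le_intg => // x; apply: (le_trans (fg x)).
by rewrite ler_norm.
Qed.

Lemma bounded_intg f C : measurable_fun [set: T] f ->
  (forall x, `|f x| <= C) -> intg P f.
Proof. by move=> mf fC; apply: (dom_intg mf fC); exact: intg_cst. Qed.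

Lemma intg_norm f : intg P f -> intg P (fun x => `|f x|).
Proof.
move=> fi; apply: (@le_intg _ f) => //; last by move=> x; rewrite normr_id.
by apply: measurableT_comp => //; exact: intg_measurable.
Qed.

Lemma intg_mulbr f g C : intg P f -> measurable_fun [set: T] g ->
  (forall x, `|g x| <= C) -> intg P (fun x => f x * g x).
Proof.
move=> fi mg gC; apply: (@dom_intg _ (fun x => C * `|f x|)).
- by apply: measurable_funM => //; exact: intg_measurable.
- by move=> x; rewrite normrM mulrC ler_wpM2r.
- exact/intgZ/intg_norm.
Qed.

Lemma ExD f g : intg P f -> intg P g -> Ex P (fun x => f x + g x) = Ex P f + Ex P g.
Proof. by move=> fi gi; rewrite /Ex RintegralD. Qed.

Lemma ExZ k f : intg P f -> Ex P (fun x => k * f x) = k * Ex P f.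
Proof. by move=> fi; rewrite /Ex RintegralZl. Qed.

Lemma ExN f : intg P f -> Ex P (fun x => - f x) = - Ex P f.
Proof.
by move=> fi; rewrite -[RHS]mulN1r -ExZ//; apply: eq_Ex => x; rewrite mulN1r.
Qed.

Lemma ExB f g : intg P f -> intg P g -> Ex P (fun x => f x - g x) = Ex P f - Ex P g.
Proof. by move=> fi gi; rewrite ExD ?ExN//; exact: intgN. Qed.

Lemma Ex_cst k : Ex P (fun=> k) = k.
Proof. by rewrite /Ex Rintegral_cst//= [X in fine X]probability_setT mulr1. Qed.

Lemma Ex_sum I (s : seq I) (Q : pred I) (F : I -> T -> R) :
  (forall i, Q i -> intg P (F i)) ->
  Ex P (fun x => \sum_(i <- s | Q i) F i x) = \sum_(i <- s | Q i) Ex P (F i).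
Proof.
move=> Fi; elim: s => [|a s IH].
  by under eq_Ex do rewrite big_nil; rewrite Ex_cst big_nil.
rewrite big_cons; have [Qa|Qa] := boolP (Q a).
  under eq_Ex do rewrite big_cons Qa.
  by rewrite ExD ?IH//; [exact: Fi|exact: intg_sum].
by under eq_Ex do rewrite big_cons (negbTE Qa).
Qed.

Lemma le_Ex f g : intg P f -> intg P g -> (forall x, f x <= g x) -> Ex P f <= Ex P g.
Proof. by move=> fi gi fg; apply: le_Rintegral. Qed.

Lemma Ex_ge0 f : (forall x, 0 <= f x) -> 0 <= Ex P f.
Proof. by move=> f0; apply: Rintegral_ge0. Qed.

Lemma norm_Ex f : intg P f -> `|Ex P f| <= Ex P (fun x => `|f x|).
Proof. by move=> fi; apply: le_normr_Rintegral. Qed.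

Lemma norm_Ex_le f g : intg P f -> intg P g -> (forall x, `|f x| <= g x) ->
  `|Ex P f| <= Ex P g.
Proof.
by move=> fi gi fg; apply: (le_trans (norm_Ex fi)); apply: le_Ex => //; exact: intg_norm.
Qed.

Lemma norm_Ex_cst f k : intg P f -> (forall x, `|f x| <= k) -> `|Ex P f| <= k.
Proof.
by move=> fi fk; rewrite -[leRHS]Ex_cst; apply: norm_Ex_le => //; exact: intg_cst.
Qed.

Lemma prob_Ex (A : set T) : measurable A -> fine (P A) = Ex P \1_A.
Proof. by move=> mA; rewrite /Ex /Rintegral integral_indic// setIT. Qed.

Lemma intg_indic (A : set T) : measurable A -> intg P \1_A.
Proof.
move=> mA; apply: (@bounded_intg _ 1); first exact: measurable_indic.
by move=> x; rewrite indicE; case: (x \in A); rewrite ?normr1 ?normr0.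
Qed.

End expectation.

(** * Fubini's theorem for real expectations on a product of probability spaces *)

Section fubini.
Context {d1 d2 : measure_display} {T1 : measurableType d1} {T2 : measurableType d2}
  {R : realType} (P : probability T1 R) (Q : probability T2 R).

(** Integrability is asked of every section, not of almost every one: then the inner extended
    integral is finite at each point and coincides pointwise with the real number [Ex]. *)
Lemma Ex_fubini1 (F : T1 * T2 -> R) : intg (P \x Q)%E F ->
  (forall x, intg Q (fun y => F (x, y))) ->
  intg P (fun x => Ex Q (fun y => F (x, y))) /\
  Ex (P \x Q)%E F = Ex P (fun x => Ex Q (fun y => F (x, y))).
Proof.
move=> Fi Fx.
have E : fubini_F Q (EFin \o F) = EFin \o (fun x => Ex Q (fun y => F (x, y))).
  by apply/funext => x; rewrite /fubini_F/= Ex_EFin.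
split; first by rewrite /intg -E; exact: integrable_fubini_F.
by rewrite {1}/Ex /Rintegral -integral12_prod_meas1// E.
Qed.

Lemma Ex_fubini2 (F : T1 * T2 -> R) : intg (P \x Q)%E F ->
  (forall y, intg P (fun x => F (x, y))) ->
  intg Q (fun y => Ex P (fun x => F (x, y))) /\
  Ex (P \x Q)%E F = Ex Q (fun y => Ex P (fun x => F (x, y))).
Proof.
move=> Fi Fx.
have E : fubini_G P (EFin \o F) = EFin \o (fun y => Ex P (fun x => F (x, y))).
  by apply/funext => x; rewrite /fubini_G/= Ex_EFin.
have mF : measurable_fun setT (EFin \o F) by exact: measurable_int Fi.
split.
  rewrite /intg -E; apply/integrableP; split; first by exact: (measurable_fubini_G Fi).
  apply: le_lt_trans ((integrable21ltyP P Q mF).1 Fi).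
  apply: ge0_le_integral => //.
  - by apply: measurableT_comp => //; exact: (measurable_fubini_G Fi).
  - apply: (measurable_fun_fubini_tonelli_G (abse \o (EFin \o F))).
      exact: measurableT_comp.
    by move=> x; exact: abse_ge0.
  - move=> y _; apply: le_abse_integral => //; exact: measurableT_comp.
by rewrite {1}/Ex /Rintegral -integral21_prod_meas1// E.
Qed.

Lemma intg_fst (f : T1 -> R) : intg P f -> intg (P \x Q)%E (fun z => f z.1).
Proof.
move=> fi; apply/integrable12ltyP.
  apply/measurable_EFinP; apply: (@measurableT_comp _ _ _ _ _ _ f) => //.
  exact: (intg_measurable fi).
under eq_integral do rewrite /= integral_cst// [X in (_ * X)%E]probability_setT mule1.
by have /integrableP[] := fi.
Qed.

Lemma intg_snd (f : T2 -> R) : intg Q f -> intg (P \x Q)%E (fun z => f z.2).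
Proof.
move=> fi; apply/integrable21ltyP.
  apply/measurable_EFinP; apply: (@measurableT_comp _ _ _ _ _ _ f) => //.
  exact: (intg_measurable fi).
under eq_integral do rewrite /= integral_cst// [X in (_ * X)%E]probability_setT mule1.
by have /integrableP[] := fi.
Qed.

Lemma Ex_fst (f : T1 -> R) : intg P f -> Ex (P \x Q)%E (fun z => f z.1) = Ex P f.
Proof.
move=> fi; have [|_ ->] := Ex_fubini1 (intg_fst fi); first by move=> x; exact: (@intg_cst _ _ _ _ (f x)).
by apply: eq_Ex => x /=; rewrite Ex_cst.
Qed.

Lemma Ex_snd (f : T2 -> R) : intg Q f -> Ex (P \x Q)%E (fun z => f z.2) = Ex Q f.
Proof.
move=> fi; have [|_ ->] := Ex_fubini2 (intg_snd fi); first by move=> x; exact: (@intg_cst _ _ _ _ (f x)).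
by apply: eq_Ex => x /=; rewrite Ex_cst.
Qed.

Lemma intg_prodM (f : T1 -> R) (g : T2 -> R) : intg P f -> intg Q g ->
  intg (P \x Q)%E (fun z => f z.1 * g z.2).
Proof.
move=> fi gi; apply/integrable12ltyP.
  apply/measurable_EFinP; apply: measurable_funM.
    by apply: (@measurableT_comp _ _ _ _ _ _ f) => //; exact: (intg_measurable fi).
  by apply: (@measurableT_comp _ _ _ _ _ _ g) => //; exact: (intg_measurable gi).
have -> : (fun x => \int[Q]_y `|((f x) * (g y))%:E|)%E =
    EFin \o (fun x => `|f x| * Ex Q (fun y => `|g y|)).
  apply/funext => x /=; under eq_integral do rewrite normrM.
  rewrite -ExZ; last exact: intg_norm.
  by rewrite -Ex_EFin//; apply/intgZ/intg_norm.
have h : intg P (fun x => `|f x| * Ex Q (fun y => `|g y|)).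
  apply: (eq_intg _ (intgZ (Ex Q (fun y => `|g y|)) (intg_norm fi))) => x; exact: mulrC.
by rewrite Ex_EFin// ltry.
Qed.

End fubini.

(** * Integrals over half-lines and over the line of a function with a known primitive *)

Section primitives.
Context {R : realType}.
Local Notation mu := (@lebesgue_measure R).
Variables (G g : R -> R).
Hypothesis dG : forall x : R, is_derive x 1 G (g x).
Hypothesis cg : continuous g.
Hypothesis ig : mu.-integrable [set: R] (EFin \o g).
Hypothesis GNy : G x @[x --> -oo] --> (0 : R).

Let mg : measurable_fun [set: R] g. Proof. exact: continuous_measurable_fun. Qed.

Let FTC a b : a < b -> \int[mu]_(x in `[a, b]) g x = G b - G a.
Proof.
move=> ab; rewrite /Rintegral (@continuous_FTC2 _ g G a b ab) ?EFinB//.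
- exact/continuous_subspaceT/cg.
- have Gc x : {for x, continuous G}.
    by apply/differentiable_continuous/derivable1_diffP; case: (dG x).
  split; first by move=> x _; case: (dG x).
  + exact: cvg_at_right_filter (Gc a).
  + exact: cvg_at_left_filter (Gc b).
- by move=> x _; rewrite derive1E (@derive_val _ _ _ _ _ _ _ (dG x)).
Qed.

(** The fundamental theorem of calculus on [[- n, w]], then [n] to infinity: the integrals converge
    by domination by [|g|], and the boundary term [G (- n)] vanishes. *)
Lemma integral_Ny_derive w : \int[mu]_(x in `]-oo, w]) g x = G w.
Proof.
have gw : mu.-integrable `]-oo, w] (EFin \o g).
  by apply: integrableS ig.
have H : (\int[mu]_(x in `]-oo, w]) ((g \_ `[- n%:R, w]) x)%:E)%E @[n --> \oo] -->
    (\int[mu]_(x in `]-oo, w]) (g x)%:E)%E.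
  have /= [] := @dominated_convergence _ _ _ mu `]-oo, w] _
    (fun n x => ((g \_ `[- n%:R, w]) x)%:E) (EFin \o g) (abse \o (EFin \o g)).
  - by [].
  - move=> n; apply/measurable_EFinP/measurable_funTS.
    apply/(measurable_restrictT _ _).1 => //.
    exact: measurable_funTS.
  - exact/measurable_EFinP/measurable_funTS.
  - apply: aeW => x /= xw; apply: cvg_near_cst; near=> n.
    rewrite patchE mem_set//= in_itv/=; apply/andP; split; last by rewrite in_itv in xw.
    rewrite lerNl; near: n; exact: nbhs_infty_ger.
  - exact: integrable_abse.
  - apply: aeW => x n _ /=; rewrite lee_fin patchE; case: ifP => // _.
    by rewrite normr0.
  - by [].
have H2 : G w - G (- n%:R) @[n --> \oo] --> \int[mu]_(x in `]-oo, w]) g x.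
  have : (G w - G (- n%:R))%:E @[n --> \oo] --> (\int[mu]_(x in `]-oo, w]) g x)%:E.
    rewrite /Rintegral fineK; last exact: integrable_fin_num.
    apply: cvg_trans H; apply: near_eq_cvg; near=> n.
    have nw : - n%:R < w by rewrite ltrNl; near: n; exact: nbhs_infty_gtr.
    rewrite -(FTC nw) /Rintegral fineK; last first.
      apply: integrable_fin_num => //; exact: integrableS ig.
    rewrite [RHS](_ : _ = \int[mu]_(x in `[(- n%:R)%R, w]) (g x)%:E)%E//.
    rewrite [LHS]integral_mkcond [RHS]integral_mkcond; apply: eq_integral => x _.
    rewrite !patchE !mem_setE !in_itv/=.
    by case: (x <= w); rewrite ?andbT ?andbF//; case: ifP.
  by move/fine_cvgP => -[].
have H3 : G w - G (- n%:R) @[n --> \oo] --> G w - 0.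
  apply: cvgB; first exact: cvg_cst.
  apply: (cvg_comp _ _ _ GNy).
  have /cvgNrNy := @cvgr_idn R; exact.
by have := cvg_unique _ H2 H3; rewrite subr0; apply.
Unshelve. all: by end_near. Qed.

(** Applied to [G = k * gpdf], this becomes Gaussian integration by parts. *)
Lemma integral_derive_eq0 : G x @[x --> +oo] --> (0 : R) -> \int[mu]_x g x = 0.
Proof.
move=> Gy.
have H : (\int[mu]_x ((g \_ `]-oo, n%:R]) x)%:E)%E @[n --> \oo] -->
    (\int[mu]_x (g x)%:E)%E.
  have /= [] := @dominated_convergence _ _ _ mu setT _
    (fun n x => ((g \_ `]-oo, n%:R]) x)%:E) (EFin \o g) (abse \o (EFin \o g)).
  - by [].
  - move=> n; apply/measurable_EFinP.
    apply/(measurable_restrictT _ _).1 => //.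
    exact: measurable_funTS.
  - exact/measurable_EFinP.
  - apply: aeW => x /= _; apply: cvg_near_cst; near=> n.
    rewrite patchE mem_set//= in_itv/=; near: n; exact: nbhs_infty_ger.
  - exact: integrable_abse.
  - apply: aeW => x n _ /=; rewrite lee_fin patchE; case: ifP => // _.
    by rewrite normr0.
  - by [].
have H2 : G n%:R @[n --> \oo] --> \int[mu]_x g x.
  have : (G n%:R)%:E @[n --> \oo] --> (\int[mu]_x g x)%:E.
    rewrite /Rintegral fineK; last exact: integrable_fin_num.
    apply: cvg_trans H; apply: near_eq_cvg; near=> n.
    rewrite -integral_Ny_derive /Rintegral fineK; last first.
      apply: integrable_fin_num => //; exact: integrableS ig.
    rewrite [RHS]integral_mkcond; apply: eq_integral => x _.
    by rewrite !patchE; case: ifP.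
  by move/fine_cvgP => -[].
have H3 : G n%:R @[n --> \oo] --> (0 : R).
  by apply: (cvg_comp _ _ _ Gy); exact: cvgr_idn.
by apply: (cvg_unique _ H2 H3).
Unshelve. all: by end_near. Qed.

End primitives.

(** * Derivatives *)

Section derivatives.
Context {R : realType}.
Implicit Types (f g : R -> R) (x a b k : R).

Definition der f x a : Prop := is_derive x 1 f a.

Lemma der_eq f x a b : der f x a -> a = b -> der f x b.
Proof. by move=> + <-. Qed.

Lemma eq_der f g x a : f =1 g -> der f x a -> der g x a.
Proof. by move=> /funext ->. Qed.

Lemma der_cst k x : der (fun=> k) x 0.
Proof. exact: is_derive_cst. Qed.

Lemma der_id x : der (fun y => y) x 1.
Proof. exact: is_derive_id. Qed.

Lemma derD f g x a b : der f x a -> der g x b -> der (fun y => f y + g y) x (a + b).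
Proof. by move=> fa gb; exact: is_deriveD. Qed.

Lemma derN f x a : der f x a -> der (fun y => - f y) x (- a).
Proof. by move=> fa; exact: is_deriveN. Qed.

Lemma derB f g x a b : der f x a -> der g x b -> der (fun y => f y - g y) x (a - b).
Proof. by move=> fa gb; exact: is_deriveB. Qed.

Lemma derM f g x a b : der f x a -> der g x b ->
  der (fun y => f y * g y) x (f x * b + a * g x).
Proof.
move=> fa gb; have := is_deriveM fa gb.
by move=> /der_eq; apply; rewrite /GRing.scale/= [g x * a]mulrC.
Qed.

Lemma derX f n x a : der f x a -> der (fun y => f y ^+ n) x (n%:R * f x ^+ n.-1 * a).
Proof.
move=> fa; case: n => [|n].
  by apply: der_eq (der_cst 1 x) _; rewrite !mul0r.
have := is_deriveX n.+1 fa; rewrite -exprfctE; exact.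
Qed.

Lemma der_comp f g x a b : der f x a -> der g (f x) b -> der (fun y => g (f y)) x (b * a).
Proof. by move=> fa gb; exact: is_derive1_comp. Qed.

Lemma der_sum (I : Type) (r : seq I) (P : pred I) (F : I -> R -> R) (D : I -> R) x :
  (forall i, P i -> der (F i) x (D i)) ->
  der (fun y => \sum_(i <- r | P i) F i y) x (\sum_(i <- r | P i) D i).
Proof.
move=> FD; elim: r => [|i r IH].
  by rewrite big_nil; apply: eq_der (der_cst 0 x) => y; rewrite big_nil.
have [Pi|Pi] := boolP (P i); rewrite big_cons ?Pi ?(negbTE Pi).
  by apply: eq_der (derD (FD i Pi) IH) => y; rewrite big_cons Pi.
by apply: eq_der IH => y; rewrite big_cons (negbTE Pi).
Qed.

Lemma der_continuous f f' : (forall x, der f x (f' x)) -> continuous f.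
Proof.
by move=> df x; apply/differentiable_continuous/derivable1_diffP; case: (df x).
Qed.

Lemma der_mvt f f' a b : (forall x, der f x (f' x)) ->
  exists2 c, a <= c <= b \/ b <= c <= a & f b - f a = f' c * (b - a).
Proof.
move=> df.
wlog ab : a b / a <= b => [H|].
  have [/H//|/ltW/H [c cab E]] := leP a b.
  by exists c; [case: cab; [right|left]|rewrite -opprB E -mulrN opprB].
have [|c cab E] := @MVT_segment R f f' a b ab _ (continuous_subspaceT (der_continuous df)).
  by move=> x _; exact: df.
by exists c => //; left; rewrite in_itv in cab.
Qed.

Lemma der_bound f f' a b M : (forall x, der f x (f' x)) ->
  (forall c, a <= c <= b \/ b <= c <= a -> `|f' c| <= M) -> `|f b - f a| <= M * `|b - a|.
Proof.
move=> df fM; have [c cab ->] := der_mvt a b df.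
by rewrite normrM ler_wpM2r// fM.
Qed.

End derivatives.

(** * The standard normal distribution *)

Section gaussian.
Context {R : realType}.
Local Notation mu := (@lebesgue_measure R).

Definition gam : probability (measurableTypeR R) R := normal_prob (0 : R) 1.

Definition gpdf (x : R) : R := normal_pdf 0 1 x.

Lemma gpdfE x : gpdf x = normal_peak 1 * expR (- (x ^+ 2 / 2)).
Proof.
rewrite /gpdf normal_pdfE ?oner_eq0// /normal_fun subr0 expr1n; congr (_ * expR _).
by rewrite mulNr.
Qed.

Lemma gpdf_gt0 x : 0 < gpdf x.
Proof. by rewrite gpdfE mulr_gt0 ?expR_gt0// normal_peak_gt0// oner_eq0. Qed.

Lemma continuous_gpdf : continuous gpdf.
Proof. by apply: continuous_normal_pdf; rewrite oner_eq0. Qed.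

Lemma measurable_gpdf : measurable_fun [set: R] gpdf.
Proof. exact: measurable_normal_pdf. Qed.

Lemma gpdf_ub x : gpdf x <= normal_peak 1.
Proof. by apply: normal_pdf_ub; rewrite oner_eq0. Qed.

Lemma der_gpdf (x : R) : der gpdf x (- (x * gpdf x)).
Proof.
have E y : normal_peak 1 * expR (- (y ^+ 2 / 2)) = gpdf y by rewrite gpdfE.
apply: (eq_der E); apply: der_eq.
  apply: derM; first exact: der_cst.
  apply: (@der_comp _ _ expR); last exact: is_derive_expR.
  by apply: derN; apply: derM; [apply: derX; exact: der_id|exact: der_cst].
by rewrite -E/=; field.
Qed.

(** The change of variables goes through the Radon-Nikodym derivative of [gam], which agrees almost
    everywhere with [gpdf] since both have the same integral on every measurable set. *)
Lemma ge0_integral_gam (f : R -> \bar R) : (forall x, 0 <= f x)%E ->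
  measurable_fun [set: R] f ->
  (\int[gam]_x f x = \int[mu]_x (f x * (gpdf x)%:E))%E.
Proof.
move=> f0 mf.
have dom : gam `<< mu by exact: normal_prob_dominates.
rewrite -(Radon_Nikodym_SigmaFinite.change_of_variables dom f0 measurableT mf).
apply: ae_eq_integral => //.
- apply: emeasurable_funM => //.
  exact: measurable_int (Radon_Nikodym_SigmaFinite.f_integrable dom).
- by apply: emeasurable_funM => //; apply/measurable_EFinP; exact: measurable_gpdf.
- apply: ae_eqe_mul2l; apply: integral_ae_eq => //.
  + exact: (Radon_Nikodym_SigmaFinite.f_integrable dom).
  + by apply/measurable_EFinP; exact: measurable_gpdf.
  + by move=> E _ mE; rewrite -Radon_Nikodym_SigmaFinite.f_integral.
Qed.

Lemma intg_gam (f : R -> R) : measurable_fun [set: R] f ->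
  mu.-integrable [set: R] (fun x => (f x * gpdf x)%:E) -> intg gam f.
Proof.
move=> mf fi; apply/integrableP; split; first exact/measurable_EFinP.
rewrite ge0_integral_gam//; last exact/measurableT_comp/measurable_EFinP.
case/integrableP: fi => _; apply: le_lt_trans.
rewrite le_eqVlt; apply/orP; left; apply/eqP; apply: eq_integral => x _ /=.
by rewrite normrM (ger0_norm (ltW (gpdf_gt0 x))).
Qed.

Lemma Ex_gam (f : R -> R) : measurable_fun [set: R] f ->
  mu.-integrable [set: R] (fun x => (f x * gpdf x)%:E) ->
  Ex gam f = \int[mu]_x (f x * gpdf x).
Proof.
move=> mf fi.
have dom : gam `<< mu by exact: normal_prob_dominates.
have fg := intg_gam mf fi.
rewrite /Ex /Rintegral; congr fine.
rewrite -(Radon_Nikodym_change_of_variables dom measurableT fg).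
under [RHS]eq_integral do rewrite EFinM.
apply: ae_eq_integral => //.
- apply: emeasurable_funM; first exact/measurable_EFinP.
  by apply: (measurable_int mu); exact: Radon_Nikodym_integrable.
- by apply: emeasurable_funM; apply/measurable_EFinP => //; exact: measurable_gpdf.
- apply: ae_eqe_mul2l; apply: integral_ae_eq => //.
  + exact: Radon_Nikodym_integrable.
  + by apply/measurable_EFinP; exact: measurable_gpdf.
  + by move=> E _ mE; rewrite -Radon_Nikodym_integral.
Qed.

(** As [exp (- x ^ 2 / 2)] is the square of [exp (- x ^ 2 / 4)], one factor is kept and is, up to a
    constant, the density of variance 2; the other absorbs the polynomial by [y ^ m <= m! exp y] at
    [y = (1 + x ^ 2) / 4], which is where [4 ^ m], [m!] and [expR (1 / 4)] come from. *)
Lemma gpdf_poly m : exists2 C, 0 < C &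
  forall x, (1 + x ^+ 2) ^+ m * gpdf x <= C * normal_pdf 0 (Num.sqrt 2) x.
Proof.
have s2 : Num.sqrt 2 != 0 :> R by rewrite sqrtr_eq0 -ltNge.
pose p2 := normal_peak (Num.sqrt 2) : R.
have p20 : 0 < p2 by rewrite normal_peak_gt0.
pose p1 := normal_peak 1 : R.
have p10 : 0 < p1 by rewrite normal_peak_gt0// oner_eq0.
exists (4 ^+ m * m`!%:R * expR (1 / 4) * p1 / p2).
  by rewrite divr_gt0// mulr_gt0// mulr_gt0 ?expR_gt0// mulr_gt0 ?exprn_gt0 ?ltr0n ?fact_gt0.
move=> x; rewrite gpdfE normal_pdfE// /normal_fun subr0 sqr_sqrtr//.
have -> : - x ^+ 2 / (2 *+ 2) = - (x ^+ 2 / 4) :> R by field.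
have h : (1 + x ^+ 2) ^+ m <= 4 ^+ m * m`!%:R * (expR (1 / 4) * expR (x ^+ 2 / 4)).
  rewrite -expRD -mulrDl.
  set y := (1 + x ^+ 2) / 4; have y0 : 0 <= y by rewrite divr_ge0// addr_ge0// sqr_ge0.
  have -> : 1 + x ^+ 2 = 4 * y by rewrite /y; field.
  rewrite exprMn -mulrA ler_pM2l ?exprn_gt0//.
  case: m => [|m]; first by rewrite mul1r expr0 -expR0 ler_expR.
  rewrite mulrC -ler_pdivrMr ?ltr0n ?fact_gt0//.
  by apply: le_trans (expR_ge1Dxn m y0); rewrite lerDr.
have E : expR (- (x ^+ 2 / 2)) = expR (- (x ^+ 2 / 4)) * expR (- (x ^+ 2 / 4)) :> R.
  by rewrite -expRD; congr expR; field.
have E2 : expR (x ^+ 2 / 4) * expR (- (x ^+ 2 / 4)) = 1 :> R by rewrite expRxMexpNx_1.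
rewrite E -/p1 -/p2.
set e := expR (- (x ^+ 2 / 4)) in E2 *; have e0 : 0 < e by exact: expR_gt0.
have -> : 4 ^+ m * m`!%:R * expR (1 / 4) * p1 / p2 * (p2 * e) =
   4 ^+ m * m`!%:R * (expR (1 / 4) * expR (x ^+ 2 / 4)) * (p1 * (e * e)).
  have -> : 4 ^+ m * m`!%:R * (expR (1 / 4) * expR (x ^+ 2 / 4)) * (p1 * (e * e)) =
    4 ^+ m * m`!%:R * expR (1 / 4) * p1 * e * (expR (x ^+ 2 / 4) * e) by ring.
  by rewrite E2; field; rewrite gt_eqF.
by rewrite ler_wpM2r// !mulr_ge0// ltW.
Qed.

Definition pbd (f : R -> R) (C : R) (m : nat) := forall x, `|f x| <= C * (1 + x ^+ 2) ^+ m.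

Lemma integrable_pbd f C m : measurable_fun [set: R] f -> pbd f C m ->
  mu.-integrable [set: R] (fun x => (f x * gpdf x)%:E).
Proof.
move=> mf fb; have [D D0 HD] := gpdf_poly m.
apply: (@le_integrable _ _ _ mu setT measurableT _
   (fun x => (`|C| * D)%:E * (normal_pdf 0 (Num.sqrt 2) x)%:E)%E).
- apply/measurable_EFinP/measurable_funM => //; exact: measurable_gpdf.
- move=> x _ /=; rewrite lee_fin normrM (ger0_norm (ltW (gpdf_gt0 x))).
  rewrite [leRHS]ger0_norm; last first.
    by rewrite mulr_ge0 ?normal_pdf_ge0// mulr_ge0// ltW.
  rewrite -mulrA; apply: le_trans (ler_wpM2l (normr_ge0 C) (HD x)).
  rewrite mulrA ler_wpM2r ?(ltW (gpdf_gt0 x))//.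
  apply: (le_trans (fb x)); rewrite ler_wpM2r ?ler_norm//.
  by rewrite exprn_ge0// addr_ge0// sqr_ge0.
- by apply: integrableZl => //; exact: integrable_normal_pdf.
Qed.

Lemma intg_pbd f C m : measurable_fun [set: R] f -> pbd f C m -> intg gam f.
Proof. by move=> mf fb; apply: intg_gam => //; exact: integrable_pbd fb. Qed.

Lemma pbd_cvg0 f C m : pbd f C m ->
  f x * gpdf x @[x --> +oo] --> (0 : R) /\ f x * gpdf x @[x --> -oo] --> (0 : R).
Proof.
(* One power more than the growth of [f]: the spare factor [1 + x ^ 2] makes the product decay. *)
move=> fb; have [D D0 HD] := gpdf_poly m.+1.
have s2 : Num.sqrt 2 != 0 :> R by rewrite sqrtr_eq0 -ltNge.
pose K := `|C| * (D * normal_peak (Num.sqrt 2)).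
have K0 : 0 <= K by rewrite !mulr_ge0 ?(ltW D0)// normal_peak_ge0.
have H x : `|f x * gpdf x| <= K / (1 + x ^+ 2).
  have x1 : 0 < 1 + x ^+ 2 by rewrite ltr_pwDl// sqr_ge0.
  rewrite ler_pdivlMr// normrM (ger0_norm (ltW (gpdf_gt0 x))).
  apply: (@le_trans _ _ (`|C| * (D * normal_pdf 0 (Num.sqrt 2) x))); last first.
    rewrite ler_wpM2l// ler_wpM2l ?(ltW D0)//; exact: normal_pdf_ub.
  apply: le_trans (ler_wpM2l (normr_ge0 C) (HD x)).
  have -> : `|f x| * gpdf x * (1 + x ^+ 2) = `|f x| * ((1 + x ^+ 2) * gpdf x) by ring.
  rewrite (exprSr (1 + x ^+ 2) m) -(mulrA (_ ^+ m)) [leRHS]mulrA.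
  rewrite ler_wpM2r ?mulr_ge0 ?(ltW x1) ?(ltW (gpdf_gt0 x))//; apply: (le_trans (fb x)).
  by rewrite ler_wpM2r ?ler_norm// exprn_ge0// ltW.
have Hx e x : 0 < e -> K / e <= `|x| -> 1 <= `|x| -> `|f x * gpdf x| <= e.
  move=> e0 xe x1; apply: (le_trans (H x)).
  have x1' : 0 < 1 + x ^+ 2 by rewrite ltr_pwDl// sqr_ge0.
  rewrite ler_pdivrMr// mulrC -ler_pdivrMr//; apply: (le_trans xe).
  by rewrite -(real_normK (num_real x)); nra.
split; apply/cvgr0Pnorm_le => e e0; near=> x; apply: Hx => //.
- by rewrite (le_trans _ (ler_norm _))//; near: x; apply: nbhs_pinfty_ge; exact: num_real.
- by rewrite (le_trans _ (ler_norm _))//; near: x; apply: nbhs_pinfty_ge; exact: num_real.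
- rewrite -normrN (le_trans _ (ler_norm _))// lerNr; near: x; apply: nbhs_ninfty_le; exact: num_real.
- rewrite -normrN (le_trans _ (ler_norm _))// lerNr; near: x; apply: nbhs_ninfty_le; exact: num_real.
Unshelve. all: by end_near. Qed.

Lemma pbd_X f C m : pbd f C m -> pbd (fun x => x * f x) `|C| m.+1.
Proof.
move=> fb x; rewrite normrM exprS mulrCA ler_pM//.
  by rewrite -(real_normK (num_real x)); have := normr_ge0 x; nra.
apply: (le_trans (fb x)); rewrite ler_wpM2r ?ler_norm//.
by rewrite exprn_ge0// addr_ge0// sqr_ge0.
Qed.

(** The derivative of [k * gpdf] is [(k' - x k) gpdf], and its integral over the line vanishes since
    [k] grows polynomially. *)
Lemma gam_ibp (k k' : R -> R) C D m n : (forall x, der k x (k' x)) -> continuous k' ->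
  pbd k C m -> pbd k' D n -> Ex gam (fun x => x * k x) = Ex gam k'.
Proof.
move=> dk ck' kb kb'.
have ck : continuous k by exact: der_continuous dk.
have mk : measurable_fun [set: R] k by exact: continuous_measurable_fun.
have mk' : measurable_fun [set: R] k' by exact: continuous_measurable_fun.
have mxk : measurable_fun [set: R] (fun x => x * k x) by exact: measurable_funM.
rewrite !Ex_gam//; [|exact: integrable_pbd kb'|exact: integrable_pbd (pbd_X kb)].
apply/esym/eqP; rewrite -subr_eq0; apply/eqP.
rewrite -RintegralB//; [|exact: integrable_pbd kb'|exact: integrable_pbd (pbd_X kb)].
have [ky kNy] := pbd_cvg0 kb.
apply: (@integral_derive_eq0 _ (fun x => k x * gpdf x)) => //.
- move=> x; apply: der_eq; first by apply: derM; [exact: dk|exact: der_gpdf].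
  by ring.
- move=> x; apply: cvgB; apply: cvgM; [exact: ck'|exact: continuous_gpdf| |exact: continuous_gpdf].
  by apply: cvgM; [exact: cvg_id|exact: ck].
- have := integrableB measurableT (integrable_pbd mk' kb') (integrable_pbd mxk (pbd_X kb)).
  by apply: eq_integrable => // x _ /=; rewrite EFinB.
Qed.

End gaussian.

(** * Stein's equation *)

Section stein.
Context {R : realType}.
Local Notation mu := (@lebesgue_measure R).
Local Notation gam := (@gam R).

Definition below (w x : R) : R := indic [set` `]-oo, w]] x.

Lemma belowE w x : below w x = (x <= w)%R%:R.
Proof. by rewrite /below indicE mem_setE in_itv. Qed.

Lemma measurable_below w : measurable_fun [set: R] (below w).
Proof. exact: measurable_indic. Qed.

Lemma norm_below w x : `|below w x| <= 1.
Proof. by rewrite belowE; case: (x <= w); rewrite ?normr1 ?normr0. Qed.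

Lemma intg_below (k : R -> R) w : intg gam k -> intg gam (fun x => k x * below w x).
Proof. by move=> ik; apply: (intg_mulbr ik (measurable_below w) (norm_below w)). Qed.

Lemma pbd_below (k : R -> R) C m w : pbd k C m -> pbd (fun x => k x * below w x) C m.
Proof.
move=> kb x; apply: le_trans (kb x).
by rewrite normrM ler_piMr// norm_below.
Qed.

Lemma Ex_gam_below (k : R -> R) C m w : measurable_fun [set: R] k -> pbd k C m ->
  Ex gam (fun x => k x * below w x) = \int[mu]_(x in `]-oo, w]) (k x * gpdf x).
Proof.
move=> mk kb; have mkb : measurable_fun [set: R] (fun x => k x * below w x).
  by apply: measurable_funM => //; exact: measurable_below.
rewrite Ex_gam//; last exact: integrable_pbd mkb (pbd_below w kb).
rewrite [RHS]Rintegral_mkcond; apply: eq_Rintegral => x _.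
by rewrite patchE mem_setE in_itv/= belowE; case: ifP; rewrite ?mulr1// mulr0 mul0r.
Qed.

(** A truncated expectation is an integral over a half-line with a moving endpoint. Both [Phi] and
    the solution of Stein's equation are built from such integrals. *)
Lemma der_Ex_below (k : R -> R) C m : continuous k -> pbd k C m ->
  forall w, der (fun w => Ex gam (fun x => k x * below w x)) w (k w * gpdf w).
Proof.
move=> ck kb w; have mk : measurable_fun [set: R] k by exact: continuous_measurable_fun.
have E v : \int[mu]_(x in `]-oo, v]) (k x * gpdf x) = Ex gam (fun x => k x * below v x).
  by rewrite (Ex_gam_below _ mk kb).
apply: (eq_der E).
have ww : w < w + 1 by rewrite ltrDl.
have [|||dI I'] := @continuous_FTC1 R (fun x => k x * gpdf x) -oo%O w (w + 1) ww.
- apply: (@integrableS _ _ _ mu setT) => //; exact: integrable_pbd kb.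
- by rewrite ltNyr.
- by apply: cvgM; [exact: ck|exact: continuous_gpdf].
- by split; [exact: dI|rewrite -derive1E].
Qed.

Lemma pbd_cst (c : R) : pbd (fun=> c) `|c| 0.
Proof. by move=> x; rewrite expr0 mulr1. Qed.

Lemma pbd_bounded (f : R -> R) C : (forall x, `|f x| <= C) -> pbd f C 0.
Proof. by move=> fC x; rewrite expr0 mulr1. Qed.

Lemma pbd_id : pbd (fun x : R => x) 1 1.
Proof. by move=> x; have := pbd_X (pbd_cst 1) x; rewrite mulr1 normr1 normr1. Qed.

Lemma intg_gam_id : intg gam (fun x : R => x).
Proof. by apply: intg_pbd pbd_id. Qed.

Lemma Ex_gam_id : Ex gam (fun x : R => x) = 0.
Proof.
have -> : Ex gam (fun x : R => x) = Ex gam (fun x => x * 1).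
  by apply: eq_Ex => x; rewrite mulr1.
rewrite -[RHS](Ex_cst gam).
apply: (@gam_ibp _ (fun=> 1) (fun=> 0) 1 0 0 0).
- by move=> x; exact: der_cst.
- by move=> x; exact: cvg_cst.
- by apply: pbd_bounded => x; rewrite normr1.
- by apply: pbd_bounded => x; rewrite normr0.
Qed.

(** [- gpdf] is a primitive of [x gpdf] that vanishes at minus infinity. *)
Lemma Ex_gam_id_below w : Ex gam (fun x => x * below w x) = - gpdf w.
Proof.
have mid : measurable_fun [set: R] (fun x : R => x) by [].
rewrite (Ex_gam_below _ mid pbd_id).
have [_ Ny] := pbd_cvg0 (pbd_cst (-1)).
have -> : - gpdf w = -1 * gpdf w by rewrite mulN1r.
apply: (@integral_Ny_derive R (fun x => -1 * gpdf x) (fun x => x * gpdf x)).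
- move=> x; apply: der_eq; first by apply: derM; [exact: der_cst|exact: der_gpdf].
  by move=> /=; ring.
- by move=> x; apply: cvgM; [exact: cvg_id|exact: continuous_gpdf].
- exact: integrable_pbd pbd_id.
- exact: Ny.
Qed.

Definition Phi (w : R) : R := Ex gam (below w).

Lemma PhiE w : Phi w = fine (gam [set` `]-oo, w]]).
Proof. by rewrite prob_Ex. Qed.

Lemma intg_below1 w : intg gam (below w).
Proof. exact: intg_indic. Qed.

Lemma Phi_ge0 w : 0 <= Phi w.
Proof. by apply: Ex_ge0 => x; rewrite belowE. Qed.

Lemma Phi_le1 w : Phi w <= 1.
Proof.
rewrite -[leRHS](Ex_cst gam); apply: le_Ex; [exact: intg_below1|exact: intg_cst|].
by move=> x; apply: le_trans (ler_norm _) (norm_below w x).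
Qed.

Lemma Phi_le w v : w <= v -> Phi w <= Phi v.
Proof.
move=> wv; apply: le_Ex; [exact: intg_below1|exact: intg_below1|].
by move=> x; rewrite !belowE; case: (lerP x w) => // xw; rewrite (le_trans xw wv).
Qed.

Lemma der_Phi w : der Phi w (gpdf w).
Proof.
have cc : continuous (fun _ : R => 1 : R) by move=> x; exact: cvg_cst.
have H := der_Ex_below cc (pbd_cst 1) w.
rewrite mul1r in H; by apply: (eq_der _ H) => v; apply: eq_Ex => x; rewrite mul1r.
Qed.

Lemma Phi_lipschitz w v : `|Phi v - Phi w| <= normal_peak 1 * `|v - w|.
Proof.
apply: (der_bound der_Phi) => c _.
by rewrite ger0_norm ?(ltW (gpdf_gt0 _))// gpdf_ub.
Qed.

(** On the event [x <= w] one has [- w <= - x], and [- x] restricted to this event has expectation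
    [gpdf w]. *)
Lemma mills_left w : - w * Phi w <= gpdf w.
Proof.
rewrite -[leRHS]opprK -Ex_gam_id_below -ExN; last exact/intg_below/intg_gam_id.
rewrite -ExZ; last exact: intg_below1.
apply: le_Ex; [exact/intgZ/intg_below1|exact/intgN/intg_below/intg_gam_id|].
by move=> x; rewrite belowE; case: (lerP x w) => xw; rewrite ?mulr1 ?mulr0 ?oppr0// lerN2.
Qed.

Lemma intg_above w : intg gam (fun x => 1 - below w x).
Proof. by apply: intgB; [exact: intg_cst|exact: intg_below1]. Qed.

Lemma mills_right w : w * (1 - Phi w) <= gpdf w.
Proof.
have -> : 1 - Phi w = Ex gam (fun x => 1 - below w x).
  by rewrite ExB ?Ex_cst//; [exact: intg_cst|exact: intg_below1].
have -> : gpdf w = Ex gam (fun x => x - x * below w x).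
  rewrite ExB ?Ex_gam_id ?Ex_gam_id_below ?sub0r ?opprK//; first exact: intg_gam_id.
  exact/intg_below/intg_gam_id.
rewrite -ExZ; last exact: intg_above.
apply: le_Ex; [exact/intgZ/intg_above| |].
  by apply: intgB; [exact: intg_gam_id|exact/intg_below/intg_gam_id].
move=> x; rewrite belowE; case: (lerP x w) => xw; rewrite ?mulr1 ?subrr ?mulr0 ?subr0//.
by rewrite mulr1 ltW.
Qed.

Definition stein_cst : R := 1 + (gpdf 1)^-1.

Lemma stein_cst_ge1 : 1 <= stein_cst.
Proof. by rewrite lerDl invr_ge0 ltW// gpdf_gt0. Qed.

(** Two regimes explain [stein_cst]: for [|w| >= 1] the last hypothesis already gives [v <= gpdf w];
    for [|w| < 1], [gpdf w >= gpdf 1] and [v <= 1] are enough. *)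
Lemma mills_bound w v : 0 <= v -> v <= 1 -> `|w| * v <= gpdf w -> v <= stein_cst * gpdf w.
Proof.
move=> v0 v1 wv; have g0 := gpdf_gt0 w.
have [w1|w1] := lerP 1 `|w|.
  have : v <= gpdf w by nra.
  by have := stein_cst_ge1; nra.
have : gpdf 1 <= gpdf w.
  rewrite !gpdfE ler_pM2l ?normal_peak_gt0 ?oner_eq0// ler_expR lerN2.
  by rewrite ler_pM2r// expr1n -(real_normK (num_real w)); have := normr_ge0 w; nra.
move=> g1; apply: (le_trans v1); rewrite /stein_cst mulrDl mul1r.
have g10 := gpdf_gt0 (1 : R).
have : 1 <= (gpdf 1)^-1 * gpdf w by rewrite mulrC ler_pdivlMr// mul1r.
lra.
Qed.

(** The solution is [f = I / gpdf], with [I w] the expectation of [h - Ex gam h] truncated at [w].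
    As this function has mean zero, [|I|] is below both tails of the normal law, and Mills'
    inequalities bound [f] and [w f]. The bound on [f''], read off by differentiating the equation,
    still contains [|h'|], which is large for a steep [h]; it is averaged later instead of being
    estimated uniformly. *)
Lemma stein_solution (h h' : R -> R) : (forall x, der h x (h' x)) -> continuous h' ->
  (forall x, 0 <= h x <= 1) ->
  exists f, exists f', exists f'', [/\ forall x, der f x (f' x),
    forall x, der f' x (f'' x), continuous f'',
    forall x, f' x = x * f x + (h x - Ex gam h) &
    [/\ forall x, `|f x| <= stein_cst, forall x, `|f' x| <= 2 &
    forall x, `|f'' x| <= stein_cst + 2 * `|x| + `|h' x| ] ].
Proof.
move=> dh ch' h01.
have ch : continuous h by exact: der_continuous dh.
have mh : measurable_fun [set: R] h by exact: continuous_measurable_fun.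
have ih : intg gam h.
  apply: (@bounded_intg _ _ _ _ _ 1) => // x; have /andP[h0 h1] := h01 x.
  by rewrite ger0_norm.
have N0 : 0 <= Ex gam h by apply: Ex_ge0 => x; have /andP[] := h01 x.
have N1 : Ex gam h <= 1.
  rewrite -[leRHS](Ex_cst gam); apply: le_Ex => //; first exact: intg_cst.
  by move=> x; have /andP[] := h01 x.
pose p x := h x - Ex gam h.
have p1 x : `|p x| <= 1.
  by have /andP[h0 h1] := h01 x; rewrite /p ler_norml; apply/andP; split; lra.
have cp : continuous p by move=> x; apply: cvgB; [exact: ch|exact: cvg_cst].
have mp : measurable_fun [set: R] p by exact: continuous_measurable_fun.
have pb : pbd p 1 0 by exact: pbd_bounded.
have ip : intg gam p by exact: intg_pbd pb.
have Ep : Ex gam p = 0 by rewrite /p ExB ?Ex_cst ?subrr//; exact: intg_cst.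
pose I w := Ex gam (fun x => p x * below w x).
have dI w : der I w (p w * gpdf w) by exact: der_Ex_below pb w.
have I_left w : `|I w| <= Phi w.
  apply: norm_Ex_le; [exact: intg_below|exact: intg_below1|move=> x].
  by rewrite normrM belowE normr_nat ler_piMl.
(* Since [p] has mean zero, the truncation on the left is minus the truncation on the right. *)
have I_right w : `|I w| <= 1 - Phi w.
  have -> : I w = - Ex gam (fun x => p x * (1 - below w x)).
    have -> : Ex gam (fun x => p x * (1 - below w x)) = Ex gam (fun x => p x - p x * below w x).
      by apply: eq_Ex => x; ring.
    by rewrite ExB// ?Ep ?sub0r ?opprK//; exact: intg_below.
  rewrite normrN.
  have -> : 1 - Phi w = Ex gam (fun x => 1 - below w x).
    by rewrite ExB ?Ex_cst//; [exact: intg_cst|exact: intg_below1].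
  apply: norm_Ex_le; [|exact: intg_above|move=> x].
    by apply: (eq_intg _ (intgB ip (intg_below w ip))) => x; ring.
  have b01 : 0 <= 1 - below w x by rewrite belowE; case: (x <= w); rewrite ?subrr ?subr0.
  by rewrite normrM (ger0_norm b01) ler_piMl.
(* [psi] is [1 / gpdf], written as an exponential so that its derivative [w psi] is immediate. *)
pose psi w := (normal_peak 1)^-1 * expR (w ^+ 2 / 2) : R.
have gpsi w : gpdf w * psi w = 1.
  rewrite gpdfE /psi mulrACA divff ?mul1r ?gt_eqF ?normal_peak_gt0 ?oner_eq0//.
  by rewrite -expRD addNr expR0.
have psiE w : psi w = (gpdf w)^-1.
  by apply: (mulfI (lt0r_neq0 (gpdf_gt0 w))); rewrite gpsi divff// gt_eqF ?gpdf_gt0.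
have dpsi w : der psi w (w * psi w).
  apply: der_eq.
    apply: derM; first exact: der_cst.
    apply: (@der_comp _ _ expR); last exact: is_derive_expR.
    by apply: derM; [apply: derX; exact: der_id|exact: der_cst].
  by rewrite /psi/=; field; rewrite gt_eqF ?normal_peak_gt0 ?oner_eq0.
pose f w := I w * psi w.
have df w : der f w (w * f w + p w).
  apply: der_eq; first by apply: derM; [exact: dI|exact: dpsi].
  by rewrite /f -[in RHS](mulr1 (p w)) -(gpsi w); ring.
have bI w : `|w| * `|I w| <= gpdf w.
  have [w0|w0] := lerP w 0.
    apply: le_trans (mills_left w); rewrite ler0_norm// ler_wpM2l// oppr_ge0//.
  by apply: le_trans (mills_right w); rewrite gtr0_norm// ler_wpM2l// ltW.
have bf w : `|f w| <= stein_cst.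
  rewrite /f normrM psiE normfV (gtr0_norm (gpdf_gt0 w)) ler_pdivrMr ?gpdf_gt0//.
  apply: mills_bound => //; apply: (le_trans (I_left w)); exact: Phi_le1.
have bwf w : `|w * f w| <= 1.
  rewrite /f mulrA normrM normrM psiE normfV (gtr0_norm (gpdf_gt0 w)).
  by rewrite ler_pdivrMr ?gpdf_gt0// mul1r.
have bf' w : `|w * f w + p w| <= 2.
  by apply: le_trans (ler_normD _ _) _; rewrite -[leRHS]/(1 + 1) lerD.
pose f' w := w * f w + p w.
have df' w : der f' w (f w + w * f' w + h' w).
  apply: der_eq.
    apply: derD; first by apply: derM; [exact: der_id|exact: df].
    by apply: derB; [exact: dh|exact: der_cst].
  by rewrite /f'/=; ring.
exists f, f', (fun w => f w + w * f' w + h' w); split => //.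
- move=> w; apply: cvgD; last exact: ch'.
  apply: cvgD; first exact: (der_continuous df).
  by apply: cvgM; [exact: cvg_id|exact: (der_continuous df')].
- split => // w; apply: le_trans (ler_normD _ _) _; rewrite lerD2r.
  apply: le_trans (ler_normD _ _) _; rewrite lerD// normrM mulrC ler_wpM2r//; exact: bf'.
Qed.

End stein.

(** * Smooth step functions *)

Section smooth_step.
Context {R : realType}.
Implicit Types (f : R -> R) (x y a M : R).

(** A quadratic remainder spares a limit at each use: this serves for the piecewise polynomial
    [pos_part ^ 2], and to differentiate under an expectation. *)
Lemma der_quadratic f x a M :
  (forall y, `|y - x| <= 1 -> `|f y - f x - a * (y - x)| <= M * (y - x) ^+ 2) -> der f x a.
Proof.
move=> H.
have cv : h^-1 *: (f (h *: 1 + x) - f x) @[h --> 0^'] --> a.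
  apply/cvgrPdist_le => e e0.
  have M0 : 0 < 1 + `|M| by rewrite ltr_pwDl.
  near=> h.
  have h0 : h != 0 by near: h; exact: nbhs_dnbhs_neq.
  have hs : `|h| <= e / (1 + `|M|).
    by near: h; apply: dnbhs0_le; rewrite divr_gt0.
  have h1 : `|h| <= 1 by near: h; apply: dnbhs0_le.
  have := H (h *: 1 + x); rewrite addrK /GRing.scale/= mulr1 => /(_ h1) {}H.
  have -> : a - h^-1 * (f (h + x) - f x) = - (h^-1 * (f (h + x) - f x - a * h)).
    by field.
  rewrite normrN normrM normfV ler_pdivrMl ?normr_gt0//; apply: (le_trans H).
  rewrite -(real_normK (num_real h)) expr2 mulrA mulrC ler_wpM2l//.
  apply: (@le_trans _ _ ((1 + `|M|) * `|h|)).
    by rewrite ler_wpM2r// (le_trans (ler_norm M))// lerDr.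
  by rewrite mulrC -ler_pdivlMr.
have D : derivable f x 1 by apply/cvg_ex; exists a; exact: cv.
by split => //; exact: cvg_lim cv.
Unshelve. all: by end_near. Qed.

Definition pos_part x : R := Num.max x 0.

Lemma pos_partP x : (0 <= x /\ pos_part x = x) \/ (x <= 0 /\ pos_part x = 0).
Proof. by rewrite /pos_part; case: (lerP x 0) => x0; [right|left; rewrite ltW]. Qed.

Lemma der_pos2 x : der (fun y => pos_part y ^+ 2) x (2 * pos_part x).
Proof.
apply: (@der_quadratic _ _ _ 1) => y _; rewrite ler_norml.
have xx := sqr_ge0 x; have yy := sqr_ge0 y; have xy := sqr_ge0 (y - x).
case: (pos_partP x) => -[hx ->]; case: (pos_partP y) => -[hy ->].
- by apply/andP; split; lra.
- by have := mulr_ge0_le0 hx hy; move=> ?; apply/andP; split; lra.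
- by have := mulr_le0_ge0 hx hy; move=> ?; apply/andP; split; lra.
- by apply/andP; split; lra.
Qed.

(** [y * pos_part y ^ 2 = pos_part y ^ 3], so the product rule replaces another case analysis at the
    kink. *)
Lemma der_pos3 x : der (fun y => pos_part y ^+ 3) x (3 * pos_part x ^+ 2).
Proof.
have E y : y * pos_part y ^+ 2 = pos_part y ^+ 3.
  by case: (pos_partP y) => -[hy ->]; ring.
apply: (eq_der E); apply: der_eq; first by apply: derM; [exact: der_id|exact: der_pos2].
by case: (pos_partP x) => -[hy ->]; ring.
Qed.

Lemma der_pos4 x : der (fun y => pos_part y ^+ 4) x (4 * pos_part x ^+ 3).
Proof.
have E y : y * pos_part y ^+ 3 = pos_part y ^+ 4.
  by case: (pos_partP y) => -[hy ->]; ring.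
apply: (eq_der E); apply: der_eq; first by apply: derM; [exact: der_id|exact: der_pos3].
by case: (pos_partP x) => -[hy ->]; ring.
Qed.

Lemma continuous_pos_part : continuous pos_part.
Proof. by move=> x; apply: continuous_max; [exact: cvg_id|exact: cvg_cst]. Qed.

(* [alt4 4 x / 24] is the distribution function of a sum of four independent
   uniform variables on [0, 1]. *)
Definition alt4 k x : R := pos_part x ^+ k - 4 * pos_part (x - 1) ^+ k +
  6 * pos_part (x - 2) ^+ k - 4 * pos_part (x - 3) ^+ k + pos_part (x - 4) ^+ k.

Lemma der_alt4 k : (0 < k)%N ->
  (forall x, der (fun y => pos_part y ^+ k.+1) x (k.+1%:R * pos_part x ^+ k)) ->
  forall x, der (alt4 k.+1) x (k.+1%:R * alt4 k x).
Proof.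
move=> k0 dk x.
have S c : der (fun y => pos_part (y - c) ^+ k.+1) x (k.+1%:R * pos_part (x - c) ^+ k).
  apply: der_eq; last exact: mulr1.
  apply: (@der_comp _ (fun y => y - c) (fun y => pos_part y ^+ k.+1)); last exact: dk.
  by apply: der_eq; [apply: derB; [exact: der_id|exact: der_cst]|exact: subr0].
have S0 : der (fun y => pos_part y ^+ k.+1) x (k.+1%:R * pos_part x ^+ k) by exact: dk.
apply: der_eq.
  apply: derD; last exact: S.
  apply: derB; last by apply: derM; [exact: der_cst|exact: S].
  apply: derD; last by apply: derM; [exact: der_cst|exact: S].
  apply: derB; last by apply: derM; [exact: der_cst|exact: S].
  exact: S0.
by rewrite /alt4/=; ring.
Qed.

Lemma continuous_alt4 k : continuous (alt4 k).
Proof.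
have S c : continuous (fun y => pos_part (y - c) ^+ k).
  move=> y; apply: (@continuous_comp _ _ _ (fun y => pos_part (y - c)) (fun y => y ^+ k)).
    apply: (@continuous_comp _ _ _ (fun y => y - c) pos_part); last exact: continuous_pos_part.
    by apply: cvgB; [exact: cvg_id|exact: cvg_cst].
  exact: exprn_continuous.
have S0 : continuous (fun y => pos_part y ^+ k).
  by move=> y; have := S 0; under eq_fun do rewrite subr0; exact.
move=> x; apply: cvgD; last exact: S.
apply: cvgB; last by apply: cvgM; [exact: cvg_cst|exact: S].
apply: cvgD; last by apply: cvgM; [exact: cvg_cst|exact: S].
apply: cvgB; last by apply: cvgM; [exact: cvg_cst|exact: S].
exact: S0.
Qed.

Lemma pos_partN x : x <= 0 -> pos_part x = 0.
Proof. by move=> x0; rewrite /pos_part max_r. Qed.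

Lemma pos_partK x : 0 <= x -> pos_part x = x.
Proof. by move=> x0; rewrite /pos_part max_l. Qed.

Lemma alt4_le0 k x : (0 < k)%N -> x <= 0 -> alt4 k x = 0.
Proof.
by move=> k0 x0; rewrite /alt4 !pos_partN ?expr0n ?gtn_eqF//=; [ring|lra..].
Qed.

Lemma alt4_ge4 x : 4 <= x -> [/\ alt4 1 x = 0, alt4 2 x = 0, alt4 3 x = 0 & alt4 4 x = 24].
Proof. by move=> x4; rewrite /alt4 !pos_partK; [split; ring|lra..]. Qed.

(** Up to the factor 6 this is the cubic B-spline, a density. Its sign is read piece by piece; on
    the two middle pieces, a shift to the unit interval turns the polynomial into a sum of visibly
    nonnegative terms. *)
Lemma alt4_3_ge0 x : 0 <= alt4 3 x.
Proof.
have [x0|x0] := lerP x 0; first by rewrite alt4_le0.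
have [x1|x1] := lerP x 1.
  rewrite /alt4 (pos_partK (ltW x0)) (@pos_partN (x - 1)); last lra.
  do 3 (rewrite pos_partN; last lra).
  by rewrite !expr0n/= !mulr0 !subr0 !addr0 exprn_ge0// ltW.
have [x2|x2] := lerP x 2.
  rewrite /alt4 (pos_partK (ltW x0)) (@pos_partK (x - 1)); last lra.
  do 3 (rewrite pos_partN; last lra).
  rewrite !expr0n/=; pose s := x - 1; have -> : x = s + 1 by rewrite /s; ring.
  have s0 : 0 <= s by rewrite /s; lra.
  have s1 : 0 <= 1 - s by rewrite /s; lra.
  have -> : (s + 1) ^+ 3 - 4 * (s + 1 - 1) ^+ 3 + 6 * 0 - 4 * 0 + 0 =
    1 + 3 * s + 3 * (s * s * (1 - s)) by ring.
  by rewrite addr_ge0 ?addr_ge0 ?mulr_ge0.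
have [x3|x3] := lerP x 3.
  rewrite /alt4 (pos_partK (ltW x0)) (@pos_partK (x - 1)); last lra.
  rewrite (@pos_partK (x - 2)); last lra.
  do 2 (rewrite pos_partN; last lra).
  rewrite !expr0n/=; pose s := x - 2; have -> : x = s + 2 by rewrite /s; ring.
  have s0 : 0 <= s by rewrite /s; lra.
  have s1 : 0 <= 1 - s by rewrite /s; lra.
  have -> : (s + 2) ^+ 3 - 4 * (s + 2 - 1) ^+ 3 + 6 * (s + 2 - 2) ^+ 3 - 4 * 0 + 0 =
    1 + 3 * (1 - s) + 3 * ((1 - s) * (1 - s) * s) by ring.
  by rewrite addr_ge0 ?addr_ge0 ?mulr_ge0.
have [x4|x4] := lerP x 4.
  rewrite /alt4 (pos_partK (ltW x0)) (@pos_partK (x - 1)); last lra.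
  rewrite (@pos_partK (x - 2)); last lra.
  rewrite (@pos_partK (x - 3)); last lra.
  rewrite pos_partN; last lra.
  have -> : x ^+ 3 - 4 * (x - 1) ^+ 3 + 6 * (x - 2) ^+ 3 - 4 * (x - 3) ^+ 3 + 0 ^+ 3 = (4 - x) ^+ 3.
    by rewrite expr0n/=; ring.
  by rewrite exprn_ge0// subr_ge0.
by have [_ _ ->] := alt4_ge4 (ltW x4).
Qed.

(** 16 is the sum [1 + 4 + 6 + 4 + 1] of the absolute values of the coefficients of [alt4], and
    [4 ^ 3] bounds each power of degree at most 3 on [[0, 4]]. *)
Definition bump_cst : R := 16 * 4 ^+ 3.

Lemma bump_cst_ge0 : 0 <= bump_cst.
Proof. by rewrite mulr_ge0// exprn_ge0. Qed.

Lemma alt4_bound k x : (0 < k <= 3)%N -> `|alt4 k x| <= bump_cst.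
Proof.
move=> /andP[k0 k3]; have b0 := bump_cst_ge0.
have [x0|x0] := lerP x 0; first by rewrite (alt4_le0 k0 x0) normr0.
have [x4|x4] := lerP 4 x.
  have [e1 e2 e3 _] := alt4_ge4 x4.
  suff -> : alt4 k x = 0 by rewrite normr0.
  by clear b0; move: k k0 k3 => [|[|[|[|k]]]].
have [b Eb] : exists b : R, b = 4 ^+ 3 by exists (4 ^+ 3).
have S c : 0 <= c -> 0 <= pos_part (x - c) ^+ k <= b.
  rewrite Eb.
  move=> c0; have [p0 p4] : 0 <= pos_part (x - c) /\ pos_part (x - c) <= 4.
    by case: (pos_partP (x - c)) => -[hx ->]; split; lra.
  rewrite exprn_ge0//=; apply: (@le_trans _ _ (4 ^+ k)); first by rewrite lerXn2r ?nnegrE.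
  by rewrite ler_weXn2l// ler1n.
have := S 0 (lexx 0); rewrite subr0 => /andP[? ?].
have /andP[? ?] := S 1 ler01.
have /andP[? ?] := S 2 (ler0n _ 2).
have /andP[? ?] := S 3 (ler0n _ 3).
have /andP[? ?] := S 4 (ler0n _ 4).
rewrite /alt4 /bump_cst -Eb; clear b0 Eb S.
by rewrite ler_norml; apply/andP; split; lra.
Qed.

(** Four uniform variables give a distribution function with three continuous derivatives, the third
    being piecewise linear, and a step completed exactly at [t + 4 e]. The sign [h1 <= 0] matters as
    much as the smoothness: in the chi-square estimate it allows the average of [|h1|] to be
    computed by parts. *)
Lemma smooth_step (t e : R) : 0 < e -> exists h h1 h2 h3 : R -> R,
  [/\ forall x, der h x (h1 x), forall x, der h1 x (h2 x), forall x, der h2 x (h3 x),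
      [/\ continuous h1, continuous h2 & continuous h3] &
  [/\ forall x, 0 <= h x <= 1, forall x, x <= t -> h x = 1,
      forall x, t + 4 * e <= x -> [/\ h x = 0, h1 x = 0, h2 x = 0 & h3 x = 0],
      forall x, h1 x <= 0 &
  [/\ forall x, `|h1 x| <= bump_cst / e, forall x, `|h2 x| <= bump_cst / e ^+ 2
    & forall x, `|h3 x| <= bump_cst / e ^+ 3 ] ] ].
Proof.
move=> e0; have en : e != 0 by rewrite gt_eqF.
pose s x := (x - t) / e.
have ds x : der s x e^-1.
  apply: der_eq; first by apply: derM; [apply: derB; [exact: der_id|exact: der_cst]|exact: der_cst].
  by rewrite /=; ring.
have cs : continuous s by exact: der_continuous ds.
have d4 x : der (alt4 4) x (4%:R * alt4 3 x) by apply: der_alt4 => //; exact: der_pos4.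
have d3 x : der (alt4 3) x (3%:R * alt4 2 x) by apply: der_alt4 => //; exact: der_pos3.
have d2 x : der (alt4 2) x (2%:R * alt4 1 x) by apply: der_alt4 => //; exact: der_pos2.
pose h x := 1 - alt4 4 (s x) / 24.
pose h1 x := - (alt4 3 (s x) / 6 / e).
pose h2 x := - (alt4 2 (s x) / 2 / e ^+ 2).
pose h3 x := - (alt4 1 (s x) / e ^+ 3).
have dsk k x : (forall x, der (alt4 k.+1) x (k.+1%:R * alt4 k x)) ->
    der (fun y => alt4 k.+1 (s y)) x (k.+1%:R * alt4 k (s x) * e^-1).
  by move=> dk; apply: der_comp; [exact: ds|exact: dk].
have csk k : continuous (fun y => alt4 k (s y)).
  by move=> y; apply: continuous_comp; [exact: cs|exact: continuous_alt4].
have dh x : der h x (h1 x).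
  apply: der_eq; first by apply: derB; [exact: der_cst|apply: derM; [exact: dsk|exact: der_cst]].
  by rewrite /h1/=; field.
have h1le x : h1 x <= 0.
  by rewrite /h1 oppr_le0 !divr_ge0 ?alt4_3_ge0// ltW.
have le1 x : x <= t -> h x = 1.
  move=> xt; rewrite /h alt4_le0 ?mul0r ?subr0// /s pmulr_lle0 ?invr_gt0//; lra.
have ge4 x : t + 4 * e <= x -> 4 <= s x by move=> xt; rewrite /s ler_pdivlMr//; lra.
have hh x y : x <= y -> h y <= h x.
  move=> xy; rewrite -subr_le0; have [c _ ->] := der_mvt x y dh.
  by rewrite mulr_le0_ge0// subr_ge0.
have he x : t + 4 * e <= x -> h x = 0.
  by move=> /ge4 /alt4_ge4[_ _ _ E]; rewrite /h E; field.
exists h, h1, h2, h3; split; first exact: dh.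
- move=> x; apply: der_eq.
    by apply: derN; apply: derM; [apply: derM; [exact: dsk|exact: der_cst]|exact: der_cst].
  by rewrite /h2/=; field.
- move=> x; apply: der_eq.
    by apply: derN; apply: derM; [apply: derM; [exact: dsk|exact: der_cst]|exact: der_cst].
  by rewrite /h3/=; field.
- split => x; apply: cvgN; (apply: cvgM; last exact: cvg_cst).
  + by apply: cvgM; [exact: csk|exact: cvg_cst].
  + by apply: cvgM; [exact: csk|exact: cvg_cst].
  + exact: csk.
- split => //.
  + move=> x; apply/andP; split.
      have [xt|/ltW xt] := lerP (t + 4 * e) x; first by rewrite he.
      by rewrite -(he (t + 4 * e))// hh.
    have [xt|/ltW xt] := lerP x t; first by rewrite le1.
    by rewrite -(le1 t)// hh.
  + move=> x xt; have [e1 e2 e3 _] := alt4_ge4 (ge4 _ xt).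
    by rewrite he// /h1 /h2 /h3 e1 e2 e3 !mul0r oppr0.
  + split => x; rewrite normrN !normrM ?normfV.
    * rewrite (gtr0_norm e0) ler_wpM2r ?invr_ge0 ?(ltW e0)//.
      have := @alt4_bound 3 (s x) isT; have := normr_ge0 (alt4 3 (s x)).
      by rewrite (@ger0_norm _ 6)//; lra.
    * rewrite normrX (gtr0_norm e0) ler_wpM2r ?invr_ge0 ?exprn_ge0 ?(ltW e0)//.
      have := @alt4_bound 2 (s x) isT; have := normr_ge0 (alt4 2 (s x)).
      by rewrite (@ger0_norm _ 2)//; lra.
    * rewrite normrX (gtr0_norm e0) ler_wpM2r ?invr_ge0 ?exprn_ge0 ?(ltW e0)//.
      exact: alt4_bound.
Qed.

End smooth_step.

(** * Gaussian product spaces *)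

Definition push_measure {d1 d2 : measure_display} {X : measurableType d1}
    {Y : measurableType d2} {R : realType} (P : probability X R) (phi : X -> Y)
    (mphi : measurable_fun [set: X] phi) : {measure set Y -> \bar R} :=
  measure_function_pushforward__canonical__measure_function_Measure P mphi.

Section transport.
Context {d1 d2 : measure_display} {X : measurableType d1} {Y : measurableType d2}
  {R : realType} (P : probability X R) (Q : probability Y R) (phi : X -> Y).
Hypothesis mphi : measurable_fun [set: X] phi.
Hypothesis phiE : forall A, measurable A -> P (phi @^-1` A) = Q A.

Lemma ge0_integral_transport (f : Y -> \bar R) : measurable_fun [set: Y] f ->
  (forall y, 0 <= f y)%E -> (\int[P]_x f (phi x) = \int[Q]_y f y)%E.
Proof.
move=> mf f0.
have := @ge0_integral_pushforward _ _ _ _ R phi mphi P setT f measurableT.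
rewrite preimage_setT => <- //; last first.
apply: eq_measure_integral => A mA _; exact: phiE.
Qed.

Lemma intg_transport (f : Y -> R) : measurable_fun [set: Y] f ->
  intg Q f -> intg P (f \o phi).
Proof.
move=> mf /integrableP[_ fi]; apply/integrableP; split.
  apply/measurable_EFinP; exact: measurableT_comp.
by rewrite (ge0_integral_transport (f := fun y => `|(f y)%:E|%E))//;
  apply: measurableT_comp => //; exact/measurable_EFinP.
Qed.

Lemma transport_intg (f : Y -> R) : measurable_fun [set: Y] f ->
  intg P (f \o phi) -> intg Q f.
Proof.
move=> mf /integrableP[_ fi]; apply/integrableP; split; first exact/measurable_EFinP.
rewrite -(ge0_integral_transport (f := fun y => `|(f y)%:E|%E))//.
by apply: measurableT_comp => //; exact/measurable_EFinP.
Qed.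

Lemma Ex_transport (f : Y -> R) : measurable_fun [set: Y] f ->
  Ex P (f \o phi) = Ex Q f.
Proof.
move=> mf; rewrite /Ex /Rintegral; congr fine.
have mEf : measurable_fun [set: Y] (EFin \o f) by exact/measurable_EFinP.
rewrite [LHS]integralE [RHS]integralE; congr (_ - _)%E.
  rewrite -(@ge0_integral_transport ((EFin \o f)^\+)%E) //; first by apply: eq_integral => x _; rewrite !funeposE.
  exact: measurable_funepos.
rewrite -(@ge0_integral_transport ((EFin \o f)^\-)%E) //; first by apply: eq_integral => x _; rewrite !funenegE.
exact: measurable_funeneg.
Qed.

End transport.

(* [gs_resample i (x, w)] is [w] with its [i]-th coordinate replaced by [x]: as
   the law of the space is invariant under resampling a coordinate, integration
   by parts in one coordinate reduces to the one-dimensional case. *)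
Record gspace (R : realType) (I : finType) := GSpace {
  gs_disp : measure_display;
  gs_sort : measurableType gs_disp;
  gs_prob : probability gs_sort R;
  gs_coord : I -> gs_sort -> R;
  gs_resample : I -> measurableTypeR R * gs_sort -> gs_sort;
  measurable_gs_coord : forall i, measurable_fun [set: gs_sort] (gs_coord i);
  measurable_gs_resample : forall i, measurable_fun setT (gs_resample i);
  gs_coord_resample : forall i k x w,
    gs_coord k (gs_resample i (x, w)) = if k == i then x else gs_coord k w;
  gs_resampleE : forall i A, measurable A ->
    (gam \x gs_prob)%E (gs_resample i @^-1` A) = gs_prob A;
  gs_moments : forall N,
    intg gs_prob (fun w => (\prod_k (1 + gs_coord k w ^+ 2)) ^+ N) }.

Section existence.
Variable R : realType.
Local Notation gam := (@gam R).

Lemma intg_gam_poly N : intg gam (fun x : R => (1 + x ^+ 2) ^+ N).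
Proof.
apply: (@intg_pbd _ _ 1 N).
  apply: measurable_funX; apply: measurable_funD => //; exact: measurable_funX.
by move=> x; rewrite mul1r ger0_norm// exprn_ge0// addr_ge0// sqr_ge0.
Qed.

Lemma gspace0 : gspace R 'I_0.
Proof.
apply: (@GSpace R 'I_0 _ (measurableTypeR R) gam (fun _ _ => 0) (fun _ z => z.2)).
- by case.
- by case.
- by case.
- by case.
- move=> N; apply: (eq_intg _ (intg_cst gam 1)) => w.
  by rewrite big_ord0 expr1n.
Qed.

(** The new coordinate has index 0 and is the first factor of the product. Resampling it replaces
    this factor; resampling a lifted index acts on the second factor only. Invariance of the law is
    checked on rectangles, which determine a product measure. *)
Lemma gspaceS m : gspace R 'I_m -> gspace R 'I_m.+1.
Proof.
case=> d W Q g s mg ms gsE sE mo.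
pose g' (k : 'I_m.+1) (z : measurableTypeR R * W) : R :=
  if unlift ord0 k is Some j then g j z.2 else z.1.
pose s' (k : 'I_m.+1) (z : measurableTypeR R * (measurableTypeR R * W)) :
    measurableTypeR R * W :=
  if unlift ord0 k is Some j then (z.2.1, s j (z.1, z.2.2)) else (z.1, z.2.2).
have m22 : measurable_fun setT (fun z : measurableTypeR R * (measurableTypeR R * W) => (z.1, z.2.2)).
  exact: (measurable_fun_pair measurable_fst (measurableT_comp measurable_snd measurable_snd)).
have ms' i : measurable_fun setT (s' i).
  rewrite /s'; case: (unlift ord0 i) => [j|]; last exact: m22.
  apply: measurable_fun_pair; first exact: (measurableT_comp measurable_fst measurable_snd).
  exact: (measurableT_comp (ms j) m22).
apply: (@GSpace R 'I_m.+1 _ (measurableTypeR R * W)%type (gam \x Q)%E g' s').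
- move=> k; rewrite /g'; case: (unlift ord0 k) => [j|]; last exact: measurable_fst.
  exact: (@measurableT_comp _ _ _ _ _ _ (g j)).
- exact: ms'.
- move=> i k x [y w]; rewrite /g' /s' /=.
  case: (unliftP ord0 i) => [i' ->|->]; case: (unliftP ord0 k) => [k' ->|->] /=.
  + by rewrite gsE (inj_eq lift_inj).
  + by [].
  + by [].
  + by [].
- move=> i A mA.
  have prE (B : set (measurableTypeR R)) (C : set W) : measurable B -> measurable C ->
      @push_measure _ _ (measurableTypeR R * (measurableTypeR R * W))%type _ R
        (gam \x (gam \x Q))%E _ (ms' i) (B `*` C) = (gam B * Q C)%E.
    move=> mB mC.
    rewrite [LHS](_ : _ = (gam \x (gam \x Q))%E (s' i @^-1` (B `*` C)))//.
    (* For a lifted index, the section at a fixed new value [x] is a rectangle; what remains after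
       integrating over [x] is the invariance known for [s j]. *)
    case: (unliftP ord0 i) => [j ->|->].
      rewrite [X in (_ \x _)%E X](_ : _ = [set z | B z.2.1 /\ (s j @^-1` C) (z.1, z.2.2)]); last first.
        by rewrite /s' liftK.
      have -> : (gam \x (gam \x Q))%E [set z | B z.2.1 /\ (s j @^-1` C) (z.1, z.2.2)] =
          (\int[gam]_x (gam B * Q (xsection (s j @^-1` C) x)))%E.
        apply: eq_integral => x _ /=.
        rewrite -product_measure1E//; last first.
          apply: measurable_xsection; rewrite -[X in measurable X]setTI; exact: ms.
        congr ((gam \x Q)%E _); apply/seteqP; split => -[y w]; rewrite /xsection/= !inE//=.
      rewrite ge0_integralZl//.
        by rewrite -(sE j C mC).
      apply: measurable_fun_xsection; rewrite -[X in measurable X]setTI; exact: ms.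
    rewrite [X in (_ \x _)%E X](_ : _ = B `*` ([set: measurableTypeR R] `*` C)); last first.
      by rewrite /s' unlift_none; apply/seteqP; split => -[x [y w]] /= []// ? [].
    have E1 : (gam \x Q)%E ([set: measurableTypeR R] `*` C) = Q C.
      by rewrite product_measure1E// [X in (X * _)%E]probability_setT mul1e.
    have mTC : measurable ([set: measurableTypeR R] `*` C) by exact: measurableX.
    pose GQ : probability (measurableTypeR R * W)%type R := (gam \x Q)%E.
    have := @product_measure1E _ _ _ _ R gam GQ B _ mB mTC.
    by rewrite [X in _ = (_ * X)%E]E1.
  exact: (esym (product_measure_unique prE mA)).
- move=> N; have := intg_prodM (intg_gam_poly N) (mo N); apply: eq_intg => -[x w] /=.
  rewrite big_ord_recl -exprMn; congr ((_ * _) ^+ _).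
    by rewrite /g' unlift_none.
  by apply: eq_bigr => j _; rewrite /g' liftK.
Qed.

Lemma gspace_ord m : gspace R 'I_m.
Proof. by elim: m => [|m IH]; [exact: gspace0|exact: gspaceS]. Qed.

Lemma gspace_fin (I : finType) : gspace R I.
Proof.
have [d W Q g s mg ms gsE sE mo] := gspace_ord #|I|.
apply: (@GSpace R I d W Q (fun i => g (enum_rank i)) (fun i => s (enum_rank i))) => //.
- by move=> i k x w; rewrite gsE (inj_eq enum_rank_inj).
- by move=> i A; exact: sE.
- move=> N; apply: (eq_intg _ (mo N)) => w; congr (_ ^+ _).
  rewrite (reindex (@enum_rank I)) //.
  by exists (@enum_val I I) => i _; [exact: enum_rankK|exact: enum_valK].
Qed.

End existence.

Section tame.
Variables (R : realType) (I : finType) (G : gspace R I).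
Local Notation gam := (@gam R).
Local Notation W := (gs_sort G).
Local Notation Q := (gs_prob G).
Local Notation g := (@gs_coord R I G).
Local Notation s := (@gs_resample R I G).

Implicit Types (F H : W -> R) (C D : R).

(** A product rather than a sum, so that resampling one coordinate costs at most the factor
    [1 + x ^ 2], a polynomial in the new value alone: bounds by powers of [gs_size] become
    polynomial bounds in each coordinate, and all these powers are integrable. *)
Definition gs_size (w : W) : R := \prod_i (1 + g i w ^+ 2).

Lemma gs_size_ge1 w : 1 <= gs_size w.
Proof.
rewrite /gs_size; elim/big_ind: _ => // [x y x1 y1|i _].
  by rewrite (le_trans x1)// ler_peMr// (le_trans ler01 x1).
by rewrite lerDl sqr_ge0.
Qed.

Lemma gs_coord2_le i w : 1 + g i w ^+ 2 <= gs_size w.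
Proof.
rewrite /gs_size (bigD1 i)//= ler_peMr ?addr_ge0 ?sqr_ge0//.
elim/big_ind: _ => // [x y x1 y1|k _].
  by rewrite (le_trans x1)// ler_peMr// (le_trans ler01 x1).
by rewrite lerDl sqr_ge0.
Qed.

Lemma gs_size_resample i x w : gs_size (s i (x, w)) <= (1 + x ^+ 2) * gs_size w.
Proof.
rewrite {1}/gs_size (bigD1 i)//= gs_coord_resample eqxx ler_wpM2l ?addr_ge0 ?sqr_ge0//.
rewrite /gs_size [leRHS](bigD1 i)//=.
have -> : \prod_(k | k != i) (1 + g k (s i (x, w)) ^+ 2) = \prod_(k | k != i) (1 + g k w ^+ 2).
  by apply: eq_bigr => k /negbTE ki; rewrite gs_coord_resample ki.
rewrite ler_peMl//; last by rewrite lerDl sqr_ge0.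
by apply: prodr_ge0 => k _; rewrite addr_ge0 ?sqr_ge0.
Qed.

Definition tame (F : W -> R) : Prop :=
  measurable_fun [set: W] F /\ exists C N, 0 <= C /\ forall w, `|F w| <= C * gs_size w ^+ N.

Lemma tame_intg F : tame F -> intg Q F.
Proof.
move=> [mF [C [N [C0 FC]]]].
by apply: (dom_intg mF FC); apply: intgZ; exact: gs_moments.
Qed.

Lemma tame_cst c : tame (fun=> c).
Proof. by split => //; exists `|c|, 0; split => // w; rewrite expr0 mulr1. Qed.

Lemma tame_bounded F C : measurable_fun [set: W] F -> (forall w, `|F w| <= C) -> tame F.
Proof.
move=> mF FC; split => //; exists `|C|, 0; split => // w.
by rewrite expr0 mulr1 (le_trans (FC w))// ler_norm.
Qed.

Lemma tame_coord i : tame (g i).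
Proof.
split; first exact: measurable_gs_coord.
exists 1, 1; split => // w; rewrite mul1r expr1; apply: le_trans (gs_coord2_le i w).
by rewrite -(real_normK (num_real (g i w))); have := normr_ge0 (g i w); nra.
Qed.

Lemma size_exp_le w M N : (M <= N)%N -> gs_size w ^+ M <= gs_size w ^+ N.
Proof. by move=> MN; rewrite ler_weXn2l// gs_size_ge1. Qed.

Lemma tameD F H : tame F -> tame H -> tame (fun w => F w + H w).
Proof.
move=> [mF [C [N [C0 FC]]]] [mH [D [M [D0 HD]]]]; split; first exact: measurable_funD.
exists (C + D), (maxn N M); split; first exact: addr_ge0.
move=> w; apply: le_trans (ler_normD _ _) _; rewrite mulrDl lerD//.
- by apply: le_trans (FC w) _; rewrite ler_wpM2l// size_exp_le// leq_maxl.
- by apply: le_trans (HD w) _; rewrite ler_wpM2l// size_exp_le// leq_maxr.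
Qed.

Lemma tameM F H : tame F -> tame H -> tame (fun w => F w * H w).
Proof.
move=> [mF [C [N [C0 FC]]]] [mH [D [M [D0 HD]]]]; split; first exact: measurable_funM.
exists (C * D), (N + M)%N; split; first exact: mulr_ge0.
by move=> w; rewrite normrM exprD mulrACA ler_pM.
Qed.

Lemma tameN F : tame F -> tame (fun w => - F w).
Proof.
move=> [mF [C [N [C0 FC]]]]; split; first exact: measurableT_comp.
by exists C, N; split => // w; rewrite normrN.
Qed.

Lemma tameB F H : tame F -> tame H -> tame (fun w => F w - H w).
Proof. by move=> tF /tameN; exact: tameD. Qed.

Lemma tameX F k : tame F -> tame (fun w => F w ^+ k).
Proof.
move=> tF; elim: k => [|k IH]; first exact: (tame_cst 1).
have -> : (fun w => F w ^+ k.+1) = (fun w => F w * F w ^+ k) by apply/funext => w; rewrite exprS.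
exact: tameM.
Qed.

Lemma tame_sum J (r : seq J) (P : pred J) (F : J -> W -> R) :
  (forall j, tame (F j)) -> tame (fun w => \sum_(j <- r | P j) F j w).
Proof.
move=> tF; elim: r => [|j r IH].
  have -> : (fun w => \sum_(j <- [::] | P j) F j w) = (fun=> 0).
    by apply/funext => w; rewrite big_nil.
  exact: tame_cst.
have [Pj|Pj] := boolP (P j).
  have -> : (fun w => \sum_(j <- j :: r | P j) F j w) =
      (fun w => F j w + \sum_(j <- r | P j) F j w).
    by apply/funext => w; rewrite big_cons Pj.
  exact: tameD.
have -> : (fun w => \sum_(j <- j :: r | P j) F j w) = (fun w => \sum_(j <- r | P j) F j w).
  by apply/funext => w; rewrite big_cons (negbTE Pj).
exact: IH.
Qed.

Lemma tame_norm F : tame F -> tame (fun w => `|F w|).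
Proof.
move=> [mF [C [N [C0 FC]]]]; split; first exact: measurableT_comp.
by exists C, N; split => // w; rewrite normr_id.
Qed.

(** The law does not change when coordinate [i] is resampled, so both sides become iterated
    expectations over the new value [x] and over [w]; for fixed [w] the identity is the
    one-dimensional one. *)
Lemma gs_ibp i (F F' : W -> R) : tame F -> tame F' ->
  (forall w x, der (fun y => F (s i (y, w))) x (F' (s i (x, w)))) ->
  (forall w, continuous (fun x => F' (s i (x, w)))) ->
  Ex Q (fun w => g i w * F w) = Ex Q F'.
Proof.
move=> tF tF' dF cF'.
have tgF : tame (fun w => g i w * F w) by apply: tameM => //; exact: tame_coord.
have ms := measurable_gs_resample (g := G) i.
have sE := gs_resampleE (g := G) i.
have [mF [C [N [C0 FC]]]] := tF; have [mF' [D [M [D0 FD]]]] := tF'.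
have size_ge0 w : 0 <= gs_size w by rewrite (le_trans ler01)// gs_size_ge1.
have sz H w x c n : 0 <= c -> (forall w, `|H w| <= c * gs_size w ^+ n) ->
    `|H (s i (x, w))| <= c * gs_size w ^+ n * (1 + x ^+ 2) ^+ n.
  move=> c0 Hc; apply: (le_trans (Hc _)); rewrite -mulrA ler_wpM2l// mulrC -exprMn.
  rewrite lerXn2r ?nnegrE ?mulr_ge0 ?addr_ge0 ?sqr_ge0//; exact: gs_size_resample.
have cF w : continuous (fun x => F (s i (x, w))) by exact: der_continuous (dF w).
rewrite -(Ex_transport ms sE tgF.1) -(Ex_transport ms sE mF').
have [|_ ->] := Ex_fubini2 (intg_transport ms sE tgF.1 (tame_intg tgF)).
  move=> w; have ixF : intg gam (fun x : R => x * F (s i (x, w))).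
    apply: (@intg_pbd _ _ `|C * gs_size w ^+ N| N.+1).
      by apply: measurable_funM => //; exact: continuous_measurable_fun.
    by apply: (@pbd_X _ (fun x => F (s i (x, w)))) => y; exact: sz.
  apply: (eq_intg _ ixF).
  by move=> x /=; rewrite gs_coord_resample eqxx.
have [|_ ->] := Ex_fubini2 (intg_transport ms sE mF' (tame_intg tF')).
  move=> w /=; apply: (@intg_pbd _ _ (D * gs_size w ^+ M) M).
    exact: continuous_measurable_fun.
  by move=> x; exact: sz.
apply: eq_Ex => w /=.
under eq_Ex do rewrite gs_coord_resample eqxx.
by apply: (@gam_ibp _ _ _ (C * gs_size w ^+ N) (D * gs_size w ^+ M) N M (dF w) (cF' w)) => x;
  exact: sz.
Qed.

End tame.

(** * Normal approximation of weighted chi-square variables *)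

Section chi_square.
Variables (R : realType) (I : finType) (G : gspace R I).
Local Notation W := (gs_sort G).
Local Notation Q := (gs_prob G).
Local Notation g := (@gs_coord R I G).
Local Notation s := (@gs_resample R I G).
Implicit Types (F H : W -> R) (i k : I).

(** Partial differentiation along coordinate [i], expressed through resampling because the space has
    no linear structure. Tameness is included so that the products formed below are integrable. *)
Definition pder i F F' : Prop := [/\ tame F, tame F',
  forall w x, der (fun y => F (s i (y, w))) x (F' (s i (x, w))) &
  forall w, continuous (fun x => F' (s i (x, w)))].

Lemma pder_continuous i F F' : pder i F F' -> forall w, continuous (fun x => F (s i (x, w))).
Proof. by move=> [_ _ dF _] w; exact: der_continuous (dF w). Qed.

Lemma pder_eq i F F' H' : pder i F F' -> F' =1 H' -> pder i F H'.
Proof. by move=> + /funext <-. Qed.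

Lemma pder_cst i c : pder i (fun=> c) (fun=> 0).
Proof.
split; [exact: tame_cst|exact: tame_cst|by move=> w x; exact: der_cst|].
by move=> w x; exact: cvg_cst.
Qed.

Lemma pder_coord i k : pder i (g k) (fun=> (k == i)%:R).
Proof.
split; [exact: tame_coord|exact: tame_cst| |by move=> w x; exact: cvg_cst].
move=> w x; have [->|ki] := eqVneq k i.
  by apply: (eq_der _ (der_id x)) => y; rewrite gs_coord_resample eqxx.
by apply: (eq_der _ (der_cst (g k w) x)) => y; rewrite gs_coord_resample (negbTE ki).
Qed.

Lemma pderD i F F' H H' : pder i F F' -> pder i H H' ->
  pder i (fun w => F w + H w) (fun w => F' w + H' w).
Proof.
move=> [tF tF' dF cF] [tH tH' dH cH]; split; [exact: tameD|exact: tameD| |].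
- by move=> w x; exact: derD.
- by move=> w x; apply: cvgD; [exact: cF|exact: cH].
Qed.

Lemma pderM i F F' H H' : pder i F F' -> pder i H H' ->
  pder i (fun w => F w * H w) (fun w => F w * H' w + F' w * H w).
Proof.
move=> pF pH; have cF0 := pder_continuous pF; have cH0 := pder_continuous pH.
have [tF tF' dF cF] := pF; have [tH tH' dH cH] := pH.
split; [exact: tameM|by apply: tameD; exact: tameM| |].
- by move=> w x; exact: derM.
- move=> w x; apply: cvgD; apply: cvgM;
    [exact: cF0|exact: cH|exact: cF|exact: cH0].
Qed.

Lemma pder_sum i J (r : seq J) (F F' : J -> W -> R) :
  (forall j, pder i (F j) (F' j)) ->
  pder i (fun w => \sum_(j <- r) F j w) (fun w => \sum_(j <- r) F' j w).
Proof.
move=> pF; elim: r => [|j r IH].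
  have E (H : J -> W -> R) : (fun w => \sum_(j <- [::]) H j w) = (fun=> 0).
    by apply/funext => w; rewrite big_nil.
  by rewrite !E; exact: pder_cst.
have E (H : J -> W -> R) : (fun w => \sum_(j <- j :: r) H j w) =
    (fun w => H j w + \sum_(j <- r) H j w).
  by apply/funext => w; rewrite big_cons.
by rewrite !E; exact: pderD.
Qed.

Lemma pder_comp i F F' (k k' : R -> R) : pder i F F' ->
  tame (fun w => k (F w)) -> tame (fun w => k' (F w)) ->
  (forall x, der k x (k' x)) -> continuous k' ->
  pder i (fun w => k (F w)) (fun w => k' (F w) * F' w).
Proof.
move=> pF tk tk' dk ck'; have cF0 := pder_continuous pF.
have [tF tF' dF cF] := pF.
split; [by []|exact: tameM| |].
- by move=> w x; exact: der_comp.
- move=> w x; apply: cvgM; last exact: cF.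
  by apply: continuous_comp; [exact: cF0|exact: ck'].
Qed.

Lemma ibp1 i F F' : pder i F F' -> Ex Q (fun w => g i w * F w) = Ex Q F'.
Proof. by case=> tF tF' dF cF; exact: gs_ibp. Qed.

(** Integrating [g i * (g i * F)] by parts produces [F + g i * F'], and the [- 1] of the second
    Hermite polynomial cancels the first term. *)
Lemma ibp2 i F F' : pder i F F' ->
  Ex Q (fun w => (g i w ^+ 2 - 1) * F w) = Ex Q (fun w => g i w * F' w).
Proof.
move=> pF; have [tF tF' dF cF] := pF.
have H := ibp1 (pderM (pder_coord i i) pF); rewrite eqxx in H.
have tg := tame_coord G i.
have i1 : intg Q (fun w => g i w * (g i w * F w)) by apply/tame_intg/tameM => //; exact: tameM.
have i2 : intg Q (fun w => g i w * F' w) by apply/tame_intg/tameM.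
have iF : intg Q F by exact: tame_intg.
have -> : Ex Q (fun w => (g i w ^+ 2 - 1) * F w) =
    Ex Q (fun w => g i w * (g i w * F w) - F w) by apply: eq_Ex => w; ring.
rewrite ExB// H ExD//; last by apply: (eq_intg _ iF) => w; rewrite mul1r.
by under [X in _ + X - _]eq_Ex do rewrite mul1r; rewrite addrK.
Qed.

Definition quad (a : I -> R) (w : W) : R := \sum_k a k * (g k w ^+ 2 - 1).

Lemma tame_quad a : tame (quad a).
Proof.
apply: tame_sum => k; apply: tameM; first exact: tame_cst.
by apply: tameB; [apply: tameX; exact: tame_coord|exact: tame_cst].
Qed.

Lemma pder_sqr i k : pder i (fun w => g k w ^+ 2) (fun w => (k == i)%:R * (2 * g k w)).
Proof.
have := pderM (pder_coord i k) (pder_coord i k).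
have -> : (fun w => g k w * g k w) = (fun w => g k w ^+ 2) by apply/funext => w; rewrite expr2.
by move=> /pder_eq; apply => w; ring.
Qed.

Lemma pder_quad i a : pder i (quad a) (fun w => 2 * a i * g i w).
Proof.
have H k : pder i (fun w => a k * (g k w ^+ 2 - 1)) (fun w => (k == i)%:R * (2 * a k * g k w)).
  have := pderM (pder_cst i (a k)) (pderD (pder_sqr i k) (pder_cst i (-1))).
  by move=> /pder_eq; apply => w; ring.
apply: (pder_eq (pder_sum _ H)) => w.
rewrite (bigD1 i)//= eqxx mul1r big1 ?addr0// => k /negbTE ->; exact: mul0r.
Qed.

Lemma quad_ibp a F (F' : I -> W -> R) : (forall k, pder k F (F' k)) ->
  Ex Q (fun w => quad a w * F w) = \sum_k a k * Ex Q (fun w => g k w * F' k w).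
Proof.
move=> pF.
have t k : tame (fun w => (g k w ^+ 2 - 1) * F w).
  have [tF _ _ _] := pF k; apply: tameM => //; apply: tameB; last exact: tame_cst.
  by apply: tameX; exact: tame_coord.
have -> : Ex Q (fun w => quad a w * F w) =
    Ex Q (fun w => \sum_k a k * ((g k w ^+ 2 - 1) * F w)).
  by apply: eq_Ex => w; rewrite /quad mulr_suml; apply: eq_bigr => k _; rewrite mulrA.
rewrite Ex_sum => [|k _]; last by apply: intgZ; exact: tame_intg.
by apply: eq_bigr => k _; rewrite ExZ ?(ibp2 (pF k))//; exact: tame_intg.
Qed.

Lemma Ex_sqr i : Ex Q (fun w => g i w ^+ 2) = 1.
Proof.
have := ibp1 (pder_coord i i); rewrite eqxx Ex_cst => E.
by rewrite -[RHS]E; apply: eq_Ex => w; rewrite expr2.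
Qed.

Lemma Ex_pow4 i : Ex Q (fun w => g i w ^+ 4) = 3.
Proof.
have := ibp1 (pderM (pder_coord i i) (pder_sqr i i)); rewrite eqxx.
have -> : Ex Q (fun w => g i w * (g i w * g i w ^+ 2)) = Ex Q (fun w => g i w ^+ 4).
  by apply: eq_Ex => w; ring.
move=> ->; have -> : Ex Q (fun w => g i w * (1 * (2 * g i w)) + 1 * g i w ^+ 2) =
    Ex Q (fun w => 3 * g i w ^+ 2) by apply: eq_Ex => w; ring.
by rewrite ExZ ?Ex_sqr ?mulr1//; apply/tame_intg/tameX; exact: tame_coord.
Qed.

Variables (mu : I -> R).
Hypothesis mu_ge0 : forall i, 0 <= mu i.
Hypothesis mu2 : 2 * \sum_i mu i ^+ 2 = 1.

Local Notation V := (quad mu).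
(** Half the squared gradient of [V], whose partial derivatives are [2 mu_k g_k]. It has mean 1 and
    acts as a Stein kernel: the expectation of [V f(V)] is that of [chiR f'(V)], so the distance to
    normality is governed by [chiR - 1]. *)
Definition chiR (w : W) : R := 2 * \sum_i mu i ^+ 2 * g i w ^+ 2.

Let mu_le1 i : mu i <= 1.
Proof.
have : mu i ^+ 2 <= \sum_i mu i ^+ 2.
  by rewrite (bigD1 i)//= lerDl sumr_ge0// => k _; exact: sqr_ge0.
move: mu2; set S := \sum_i _ => S1 S2; have := mu_ge0 i.
move: S2; set m := mu i => S2 m0; nra.
Qed.

Let chiR1 w : chiR w - 1 = quad (fun i => 2 * mu i ^+ 2) w.
Proof.
rewrite /chiR /quad -[X in _ - X = _]mu2 -mulrBr -sumrB mulr_sumr; apply: eq_bigr => k _; ring.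
Qed.

Let tame_chiR : tame chiR.
Proof.
have -> : chiR = (fun w => quad (fun i => 2 * mu i ^+ 2) w + 1).
  by apply/funext => w; rewrite -chiR1 subrK.
by apply: tameD; [exact: tame_quad|exact: tame_cst].
Qed.

Let tg i : tame (g i). Proof. exact: tame_coord. Qed.
Let tg2 i : tame (fun w => g i w ^+ 2). Proof. exact: tameX. Qed.

Let ig4 i : intg Q (fun w => g i w ^+ 4).
Proof. by apply: tame_intg; exact: tameX. Qed.

Let Ex_V2 : Ex Q (fun w => V w ^+ 2) = 1.
Proof.
under eq_Ex do rewrite expr2.
rewrite (quad_ibp _ (fun k => pder_quad k mu)) -[RHS]mu2 mulr_sumr; apply: eq_bigr => k _.
have -> : Ex Q (fun w => g k w * (2 * mu k * g k w)) = Ex Q (fun w => 2 * mu k * g k w ^+ 2).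
  by apply: eq_Ex => w; ring.
by rewrite ExZ ?Ex_sqr//; [ring|exact: tame_intg].
Qed.

(** [a b <= (a ^ 2 + b ^ 2) / 2] with [a = g i ^ 2] and [b = |V|]; the constant is [(3 + 1) / 2]. *)
Let Ex_sqrV i : Ex Q (fun w => g i w ^+ 2 * `|V w|) <= 2.
Proof.
have tV := tame_quad mu.
have iV2 : intg Q (fun w => V w ^+ 2) by apply: tame_intg; exact: tameX.
have h : Ex Q (fun w => 2^-1 * g i w ^+ 4 + 2^-1 * V w ^+ 2) = 2.
  rewrite ExD; [|exact/intgZ/ig4|exact/intgZ/iV2].
  by rewrite !ExZ// Ex_pow4 Ex_V2; field.
rewrite -h; apply: le_Ex.
- by apply: tame_intg; apply: tameM => //; exact: tame_norm.
- by apply: intgD; apply: intgZ; apply: tame_intg; exact: tameX.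
- move=> w; rewrite -(real_normK (num_real (V w))) (_ : g i w ^+ 4 = (g i w ^+ 2) ^+ 2); last by ring.
  by have := sqr_ge0 (g i w ^+ 2 - `|V w|); lra.
Qed.

(** [chiR - 1] is itself a quadratic form, with weights [2 mu ^ 2], and is integrated by parts
    twice. The constant is [16 + 24]: differentiating [g i ^ 2] contributes [16 mu_i ^ 4], and
    differentiating the other factor contributes, for every [k], [8 mu_k ^ 4] times a mixed fourth
    moment that is at most 3. *)
Let Ex_sqr_chiR i : Ex Q (fun w => (chiR w - 1) ^+ 2 * g i w ^+ 2) <= 40 * \sum_k mu k ^+ 4.
Proof.
pose a k := 2 * mu k ^+ 2.
have p1 k : pder k (fun w => g i w ^+ 2) (fun w => (i == k)%:R * (2 * g i w)) by exact: pder_sqr.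
have e1 : Ex Q (fun w => quad a w * g i w ^+ 2) = 4 * mu i ^+ 2.
  rewrite (quad_ibp _ p1) (bigD1 i)//= big1 => [|k ki].
    rewrite eqxx addr0.
    have -> : Ex Q (fun w => g i w * (1 * (2 * g i w))) = Ex Q (fun w => 2 * g i w ^+ 2).
      by apply: eq_Ex => w; ring.
    by rewrite ExZ ?Ex_sqr /a; [ring|exact: tame_intg].
  have -> : Ex Q (fun w => g k w * ((i == k)%:R * (2 * g i w))) = Ex Q (fun=> 0).
    by apply: eq_Ex => w; rewrite eq_sym (negbTE ki) mul0r mulr0.
  by rewrite Ex_cst mulr0.
have p2 k : pder k (fun w => quad a w * g i w ^+ 2)
    (fun w => quad a w * ((i == k)%:R * (2 * g i w)) + 2 * a k * g k w * g i w ^+ 2).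
  exact: pderM (pder_quad k a) (p1 k).
have -> : Ex Q (fun w => (chiR w - 1) ^+ 2 * g i w ^+ 2) =
    Ex Q (fun w => quad a w * (quad a w * g i w ^+ 2)).
  by apply: eq_Ex => w; rewrite chiR1 expr2 mulrA.
rewrite (quad_ibp _ p2).
have tq : tame (quad a) by exact: tame_quad.
have i1 k : intg Q (fun w => (i == k)%:R * 2 * (quad a w * g i w ^+ 2)).
  by apply: intgZ; apply: tame_intg; exact: tameM.
have i2 k : intg Q (fun w => g k w ^+ 2 * g i w ^+ 2) by apply: tame_intg; exact: tameM.
have E k : Ex Q (fun w => g k w *
     (quad a w * ((i == k)%:R * (2 * g i w)) + 2 * a k * g k w * g i w ^+ 2)) =
   (i == k)%:R * (8 * mu i ^+ 2) + 2 * a k * Ex Q (fun w => g k w ^+ 2 * g i w ^+ 2).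
  have -> : Ex Q (fun w => g k w *
     (quad a w * ((i == k)%:R * (2 * g i w)) + 2 * a k * g k w * g i w ^+ 2)) =
     Ex Q (fun w => (i == k)%:R * 2 * (quad a w * g i w ^+ 2) +
        2 * a k * (g k w ^+ 2 * g i w ^+ 2)).
    by apply: eq_Ex => w; have [->|_] := eqVneq i k; rewrite /=; ring.
  rewrite ExD ?ExZ ?e1//; [ring|by apply: tame_intg; exact: tameM|exact: intgZ].
have gg k : Ex Q (fun w => g k w ^+ 2 * g i w ^+ 2) <= 3.
  have h : Ex Q (fun w => 2^-1 * g k w ^+ 4 + 2^-1 * g i w ^+ 4) = 3.
    rewrite ExD; [|exact/intgZ/ig4|exact/intgZ/ig4].
    by rewrite !ExZ// !Ex_pow4; field.
  rewrite -h; apply: le_Ex => //.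
    by apply: intgD; apply: intgZ; apply: tame_intg; exact: tameX.
  move=> w; have := sqr_ge0 (g k w ^+ 2 - g i w ^+ 2).
  have -> : g k w ^+ 4 = (g k w ^+ 2) ^+ 2 by ring.
  have -> : g i w ^+ 4 = (g i w ^+ 2) ^+ 2 by ring.
  lra.
under eq_bigr do rewrite E mulrDr.
rewrite big_split/= (bigD1 i)//= [X in _ + X + _]big1 ?addr0; last first.
  by move=> k ki; rewrite eq_sym (negbTE ki) mul0r mulr0.
have -> : 40 * \sum_k mu k ^+ 4 = 16 * (\sum_k mu k ^+ 4) + 24 * (\sum_k mu k ^+ 4) by ring.
rewrite eqxx /a; apply: lerD.
  rewrite mul1r (_ : 2 * mu i ^+ 2 * (8 * mu i ^+ 2) = 16 * mu i ^+ 4); last ring.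
  rewrite ler_pM2l// (bigD1 i)//= lerDl sumr_ge0// => k _.
  exact: exprn_ge0.
rewrite mulr_sumr; apply: ler_sum => k _.
have -> : 2 * mu k ^+ 2 * (2 * (2 * mu k ^+ 2) * Ex Q (fun w => g k w ^+ 2 * g i w ^+ 2)) =
  (8 * mu k ^+ 4) * Ex Q (fun w => g k w ^+ 2 * g i w ^+ 2) by ring.
have -> : 24 * mu k ^+ 4 = (8 * mu k ^+ 4) * 3 by ring.
by rewrite ler_wpM2l// mulr_ge0// exprn_ge0.
Qed.

Let tame_comp_bounded (k : R -> R) C : measurable_fun [set: R] k -> (forall x, `|k x| <= C) ->
  tame (fun w => k (V w)).
Proof.
move=> mk kC; apply: (@tame_bounded _ _ _ _ C) => //.
by apply: measurableT_comp => //; have [] := tame_quad mu.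
Qed.

(** By Stein's equation and the kernel [chiR], the difference is the expectation of
    [(1 - chiR) f'(V)]. Integrating [chiR - 1] by parts yields [4 mu_k ^ 3] times the expectation of
    [g_k ^ 2 f''(V)], and it remains to bound the latter independently of the scale [e]. *)
Lemma chi_square_stein (h h1 : R -> R) (K e : R) :
  (forall x, der h x (h1 x)) -> continuous h1 -> (forall x, 0 <= h x <= 1) ->
  (forall x, h1 x <= 0) -> 0 < e -> 0 <= K -> (forall x, `|h1 x| <= K / e) ->
  \sum_i mu i ^+ 3 <= e ->
  `|Ex Q (fun w => h (V w)) - Ex gam h| <=
    4 * (@stein_cst R + 12 + 40 * K) * \sum_i mu i ^+ 3.
Proof.
move=> dh ch1 h01 h1le e0 K0 h1K emu.
have [f [f' [f'' [df df' cf'' fE [fb f'b f''b]]]]] := stein_solution dh ch1 h01.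
have ch : continuous h by exact: der_continuous dh.
have cf : continuous f by exact: der_continuous df.
have cf' : continuous f' by exact: der_continuous df'.
have tV : tame V by exact: tame_quad.
have th : tame (fun w => h (V w)).
  apply: (@tame_comp_bounded _ 1); first exact: continuous_measurable_fun.
  by move=> x; have /andP[? ?] := h01 x; rewrite ger0_norm.
have th1 : tame (fun w => h1 (V w)).
  by apply: (@tame_comp_bounded _ (K / e)) => //; exact: continuous_measurable_fun.
have tf : tame (fun w => f (V w)).
  by apply: (@tame_comp_bounded _ stein_cst) => //; exact: continuous_measurable_fun.
have tf' : tame (fun w => f' (V w)).
  by apply: (@tame_comp_bounded _ 2) => //; exact: continuous_measurable_fun.
have bound_tame : tame (fun w => stein_cst + 2 * `|V w| + `|h1 (V w)|).
  apply: tameD; last exact: tame_norm.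
  apply: tameD; first exact: tame_cst.
  by apply: tameM; [exact: tame_cst|exact: tame_norm].
have tf'' : tame (fun w => f'' (V w)).
  split.
    by apply: measurableT_comp; [exact: continuous_measurable_fun|have [] := tV].
  have [_ [C [N [C0 CN]]]] := bound_tame; exists C, N; split => // w.
  by apply: (le_trans (f''b _)); apply: le_trans (CN w); exact: ler_norm.
have pV k : pder k V (fun w => 2 * mu k * g k w) by exact: pder_quad.
have pf k := pder_comp (pV k) tf tf' df cf'.
have pf' k := pder_comp (pV k) tf' tf'' df' cf''.
have ph k := pder_comp (pV k) th th1 dh ch1.
have E1 : Ex Q (fun w => V w * f (V w)) = Ex Q (fun w => chiR w * f' (V w)).
  rewrite (quad_ibp _ pf).
  transitivity (Ex Q (fun w => \sum_k mu k * (g k w * (f' (V w) * (2 * mu k * g k w))))).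
    rewrite Ex_sum => [|k _].
      by apply: eq_bigr => k _; rewrite ExZ//; apply: tame_intg; do 2 apply: tameM => //;
        apply: tameM => //; exact: tame_cst.
    apply: intgZ; apply: tame_intg; do 2 apply: tameM => //.
    by apply: tameM => //; exact: tame_cst.
  apply: eq_Ex => w; rewrite /chiR mulr_sumr mulr_suml; apply: eq_bigr => k _; ring.
have E2 : Ex Q (fun w => h (V w)) - Ex gam h =
    - (\sum_k 2 * mu k ^+ 2 * Ex Q (fun w => g k w * (f'' (V w) * (2 * mu k * g k w)))).
  rewrite -(quad_ibp _ pf').
  have -> : Ex Q (fun w => quad (fun k => 2 * mu k ^+ 2) w * f' (V w)) =
      Ex Q (fun w => chiR w * f' (V w) - f' (V w)).
    by apply: eq_Ex => w; rewrite -chiR1 mulrBl mul1r.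
  have ic : intg Q (fun w => chiR w * f' (V w)) by apply: tame_intg; exact: tameM.
  have iVf : intg Q (fun w => V w * f (V w)) by apply: tame_intg; exact: tameM.
  rewrite ExB//; last exact: tame_intg.
  rewrite -E1 opprB -ExB//; last exact: tame_intg.
  rewrite -[X in _ - X](Ex_cst Q) -ExB; [|exact: tame_intg|exact: intg_cst].
  by apply: eq_Ex => w; rewrite fE; ring.
have ig2f k : intg Q (fun w => g k w ^+ 2 * `|f'' (V w)|).
  by apply: tame_intg; apply: tameM => //; exact: tame_norm.
(* [1 <= 2 chiR + (chiR - 1)^2]; the first term is integrated by parts, which
   replaces [|h1|] by the bounded function [h], and the second one has small
   expectation, which compensates [|h1| <= K / e]. *)
have key k : Ex Q (fun w => g k w ^+ 2 * `|h1 (V w)|) <= 8 + 40 * K.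
  have tc2 : tame (fun w => (chiR w - 1) ^+ 2).
    by apply: tameX; apply: tameB => //; exact: tame_cst.
  have tn : tame (fun w => `|h1 (V w)|) by exact: tame_norm.
  have i1 : intg Q (fun w => chiR w * `|h1 (V w)| * g k w ^+ 2).
    by apply: tame_intg; apply: tameM => //; exact: tameM.
  have i2 : intg Q (fun w => (chiR w - 1) ^+ 2 * g k w ^+ 2).
    by apply: tame_intg; exact: tameM.
  have p3 j : pder j (fun w => h (V w) * g k w ^+ 2)
    (fun w => h (V w) * ((k == j)%:R * (2 * g k w)) + h1 (V w) * (2 * mu j * g j w) * g k w ^+ 2).
    exact: pderM (ph j) (pder_sqr j k).
  (* As [h1 <= 0], integrating [V] by parts against [h (V) g_k ^ 2] yields exactly
     [- chiR |h1| g_k ^ 2], besides a term in the bounded function [h]. *)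
  have E3 : Ex Q (fun w => V w * (h (V w) * g k w ^+ 2)) =
      2 * mu k * Ex Q (fun w => h (V w) * g k w ^+ 2) -
      Ex Q (fun w => chiR w * `|h1 (V w)| * g k w ^+ 2).
    have ih : intg Q (fun w => h (V w) * g k w ^+ 2) by apply: tame_intg; exact: tameM.
    rewrite (quad_ibp _ p3) -ExZ// -ExB//; last exact: intgZ.
    transitivity (Ex Q (fun w => \sum_j mu j * (g j w * (h (V w) * ((k == j)%:R * (2 * g k w)) +
        h1 (V w) * (2 * mu j * g j w) * g k w ^+ 2)))).
      have tt j : tame (fun w => g j w * (h (V w) * ((k == j)%:R * (2 * g k w)) +
          h1 (V w) * (2 * mu j * g j w) * g k w ^+ 2)).
        apply: tameM => //; have [_ + _ _] := p3 j; exact.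
      rewrite Ex_sum => [|j _]; last by apply: intgZ; exact: tame_intg.
      by apply: eq_bigr => j _; rewrite ExZ//; exact: tame_intg.
    apply: eq_Ex => w; rewrite ler0_norm//.
    under eq_bigr do rewrite mulrDr mulrDr.
    rewrite big_split/=; congr (_ + _).
      rewrite (bigD1 k)//= big1 ?addr0 => [|j jk]; first by rewrite eqxx /=; ring.
      by rewrite eq_sym (negbTE jk) mul0r !mulr0.
    rewrite /chiR mulr_sumr mulr_suml mulr_suml -sumrN; apply: eq_bigr => j _; ring.
  have E4 : Ex Q (fun w => chiR w * `|h1 (V w)| * g k w ^+ 2) <= 4.
    have ih : intg Q (fun w => h (V w) * g k w ^+ 2) by apply: tame_intg; exact: tameM.
    have A1 : Ex Q (fun w => h (V w) * g k w ^+ 2) <= 1.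
      rewrite -(Ex_sqr k); apply: le_Ex => //; first exact: tame_intg.
      by move=> w; rewrite ler_piMl ?sqr_ge0//; have /andP[] := h01 (V w).
    have A0 : 0 <= Ex Q (fun w => h (V w) * g k w ^+ 2).
      by apply: Ex_ge0 => w; rewrite mulr_ge0 ?sqr_ge0//; have /andP[] := h01 (V w).
    have A2 : `|Ex Q (fun w => V w * (h (V w) * g k w ^+ 2))| <= 2.
      apply: le_trans (Ex_sqrV k); apply: norm_Ex_le.
      - by apply: tame_intg; apply: tameM => //; exact: tameM.
      - by apply: tame_intg; apply: tameM => //; exact: tame_norm.
      - move=> w; rewrite normrM normrM [leRHS]mulrC ler_wpM2l// [X in _ * X]ger0_norm ?sqr_ge0//.
        have /andP[? ?] := h01 (V w).
        by rewrite ger0_norm// ler_piMl ?sqr_ge0.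
    have := mu_le1 k; have := mu_ge0 k; move: A2; rewrite ler_norml => /andP[A2 A3].
    by nra.
  (* Since [mu_j <= 1], the fourth powers sum to at most [e], which cancels the [1 / e] in the bound
     of [h1]. *)
  have E5 : (K / e) * Ex Q (fun w => (chiR w - 1) ^+ 2 * g k w ^+ 2) <= 40 * K.
    have : \sum_j mu j ^+ 4 <= e.
      apply: le_trans emu; apply: ler_sum => j _.
      by rewrite exprS ler_piMl// exprn_ge0.
    move=> s4; apply: (@le_trans _ _ ((K / e) * (40 * e))).
      rewrite ler_wpM2l ?divr_ge0 ?(ltW e0)//; apply: (le_trans (Ex_sqr_chiR k)).
      by rewrite ler_pM2l.
    by rewrite le_eqVlt; apply/orP; left; apply/eqP; field; rewrite gt_eqF.
  apply: (@le_trans _ _ (Ex Q (fun w => 2 * (chiR w * `|h1 (V w)| * g k w ^+ 2) +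
      (K / e) * ((chiR w - 1) ^+ 2 * g k w ^+ 2)))); last first.
    rewrite ExD ?ExZ//; try exact: intgZ.
    by lra.
  apply: le_Ex.
  - by apply: tame_intg; exact: tameM.
  - by apply: intgD; exact: intgZ.
  - move=> w; have hK := h1K (V w); have := normr_ge0 (h1 (V w)).
    set a := `|h1 (V w)| in hK *; move=> a0.
    have c0 := sqr_ge0 (chiR w - 1); have g0 := sqr_ge0 (g k w).
    have : a <= 2 * (chiR w * a) + (K / e) * (chiR w - 1) ^+ 2.
      have : a * (chiR w - 1) ^+ 2 <= K / e * (chiR w - 1) ^+ 2 by rewrite ler_wpM2r.
      by have := mulr_ge0 a0 (sqr_ge0 (chiR w)); lra.
    move=> /(ler_wpM2l g0); lra.
(* The 12 is [2 * 2] from the term [2 |V|], plus the 8 of [key]. *)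
have bnd k : Ex Q (fun w => g k w ^+ 2 * `|f'' (V w)|) <= stein_cst + 12 + 40 * K.
  have ia : intg Q (fun w => stein_cst * g k w ^+ 2) by apply: intgZ; exact: tame_intg.
  have ib : intg Q (fun w => 2 * (g k w ^+ 2 * `|V w|)).
    by apply: intgZ; apply: tame_intg; apply: tameM => //; exact: tame_norm.
  have ic : intg Q (fun w => g k w ^+ 2 * `|h1 (V w)|).
    by apply: tame_intg; apply: tameM => //; exact: tame_norm.
  apply: (@le_trans _ _ (Ex Q (fun w => stein_cst * g k w ^+ 2 + 2 * (g k w ^+ 2 * `|V w|) +
      g k w ^+ 2 * `|h1 (V w)|))).
    apply: le_Ex => //; first by apply: intgD => //; exact: intgD.
    move=> w; have := ler_wpM2l (sqr_ge0 (g k w)) (f''b (V w)); lra.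
  rewrite ExD//; last exact: intgD.
  rewrite ExD// ExZ ?Ex_sqr; last exact: tame_intg.
  rewrite ExZ; last by apply: tame_intg; apply: tameM => //; exact: tame_norm.
  by have := key k; have := Ex_sqrV k; lra.
rewrite E2 normrN; apply: (le_trans (ler_norm_sum _ _ _)).
rewrite mulr_sumr; apply: ler_sum => k _.
have -> : Ex Q (fun w => g k w * (f'' (V w) * (2 * mu k * g k w))) =
    2 * mu k * Ex Q (fun w => g k w ^+ 2 * f'' (V w)).
  rewrite -ExZ; last by apply: tame_intg; exact: tameM.
  by apply: eq_Ex => w; ring.
have -> : 2 * mu k ^+ 2 * (2 * mu k * Ex Q (fun w => g k w ^+ 2 * f'' (V w))) =
   4 * mu k ^+ 3 * Ex Q (fun w => g k w ^+ 2 * f'' (V w)) by ring.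
rewrite normrM ger0_norm ?mulr_ge0 ?exprn_ge0//.
rewrite [leRHS]mulrAC ler_wpM2l ?mulr_ge0 ?exprn_ge0//.
apply: le_trans (bnd k); apply: norm_Ex_le => //.
- by apply: tame_intg; exact: tameM.
- by move=> w; rewrite normrM ger0_norm ?sqr_ge0.
Qed.

End chi_square.

(** * Functions of the norm *)

Section inner_product.
Variables (R : realType) (J : finType).
Implicit Types (u v x y : J -> R).

Definition ip u v : R := \sum_j u j * v j.
Definition nr u : R := Num.sqrt (ip u u).

Lemma ipC u v : ip u v = ip v u.
Proof. by apply: eq_bigr => j _; rewrite mulrC. Qed.

Lemma ip_ge0 u : 0 <= ip u u.
Proof. by apply: sumr_ge0 => j _; rewrite -expr2 sqr_ge0. Qed.

Lemma ipDl u v x : ip (fun j => u j + v j) x = ip u x + ip v x.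
Proof. by rewrite -big_split; apply: eq_bigr => j _; rewrite mulrDl. Qed.

Lemma ipZl a u x : ip (fun j => a * u j) x = a * ip u x.
Proof. by rewrite /ip mulr_sumr; apply: eq_bigr => j _; rewrite mulrA. Qed.

Lemma ipDr u v x : ip x (fun j => u j + v j) = ip x u + ip x v.
Proof. by rewrite ipC ipDl ![ip x _]ipC. Qed.

Lemma ipZr a u x : ip x (fun j => a * u j) = a * ip x u.
Proof. by rewrite ipC ipZl ipC. Qed.

Lemma nr_ge0 u : 0 <= nr u.
Proof. exact: sqrtr_ge0. Qed.

Lemma nr_sqr u : nr u ^+ 2 = ip u u.
Proof. by rewrite sqr_sqrtr// ip_ge0. Qed.

Lemma cauchy_schwarz u v : `|ip u v| <= nr u * nr v.
Proof.
have H : ip u v ^+ 2 <= ip u u * ip v v.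
  have [v0|v0] := eqVneq (ip v v) 0.
    have vj j : v j = 0.
      have : v j * v j <= 0.
        by rewrite -v0 /ip (bigD1 j)//= lerDl sumr_ge0// => k _; rewrite -expr2 sqr_ge0.
      by rewrite -expr2 => h; apply/eqP; rewrite -sqrf_eq0 eq_le h sqr_ge0.
    by rewrite v0 mulr0 (_ : ip u v = 0) ?expr0n// /ip big1// => j _; rewrite vj mulr0.
  have vp : 0 < ip v v by rewrite lt_neqAle eq_sym v0 ip_ge0.
  have := ip_ge0 (fun j => ip v v * u j + - ip u v * v j).
  rewrite ipDl !ipDr !ipZl !ipZr [ip v u]ipC => h.
  have : 0 <= ip v v * (ip u u * ip v v - ip u v ^+ 2) by lra.
  by rewrite pmulr_rge0// subr_ge0.
rewrite -(@ler_pXn2r _ 2)// ?nnegrE ?mulr_ge0 ?nr_ge0//.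
by rewrite real_normK ?num_real// exprMn !nr_sqr.
Qed.

Lemma nrZ a u : nr (fun j => a * u j) = `|a| * nr u.
Proof. by rewrite /nr ipZl ipZr mulrA -expr2 sqrtrM ?sqr_ge0// sqrtr_sqr. Qed.

Lemma nr_sqrD u v : nr (fun j => u j + v j) ^+ 2 <= 2 * nr u ^+ 2 + 2 * nr v ^+ 2.
Proof.
rewrite !nr_sqr ipDl !ipDr [ip v u]ipC.
have := ip_ge0 (fun j => u j + -1 * v j).
by rewrite ipDl !ipDr !ipZl !ipZr [ip v u]ipC; lra.
Qed.

Lemma der_ip (U V : R -> J -> R) (U' V' : J -> R) (x : R) :
  (forall j, der (fun z => U z j) x (U' j)) -> (forall j, der (fun z => V z j) x (V' j)) ->
  der (fun z => ip (U z) (V z)) x (ip U' (V x) + ip (U x) V').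
Proof.
move=> dU dV; apply: der_eq.
  by apply: der_sum => j _; apply: derM; [exact: dU|exact: dV].
by rewrite big_split/= addrC.
Qed.

Lemma measurable_ip d (T : measurableType d) (U V : T -> J -> R) :
  (forall j, measurable_fun [set: T] (fun t => U t j)) ->
  (forall j, measurable_fun [set: T] (fun t => V t j)) ->
  measurable_fun [set: T] (fun t => ip (U t) (V t)).
Proof.
move=> mU mV; have -> : (fun t => ip (U t) (V t)) = (fun t => \sum_(j <- index_enum J) U t j * V t j).
  by [].
by apply: measurable_sum => j; exact: measurable_funM.
Qed.

Lemma measurable_nr d (T : measurableType d) (U : T -> J -> R) :
  (forall j, measurable_fun [set: T] (fun t => U t j)) ->
  measurable_fun [set: T] (fun t => nr (U t)).
Proof.
move=> mU; apply: (@measurableT_comp _ _ _ _ _ _ (@Num.sqrt R)); last exact: measurable_ip.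
exact: continuous_measurable_fun (@sqrt_continuous R).
Qed.

End inner_product.

Section radial.
Variables (R : realType) (J : finType).
Variables (A B r K1 K2 K3 : R) (h h1 h2 h3 : R -> R).
Hypotheses (B0 : 0 < B) (r0 : 0 <= r).
Hypotheses (dh : forall x, der h x (h1 x)) (dh1 : forall x, der h1 x (h2 x))
  (dh2 : forall x, der h2 x (h3 x)).
Implicit Types (u v x y : J -> R).

Definition lvl u : R := (ip u u - A) / B.

Hypotheses (h1K : forall w, `|h1 w| <= K1) (h2K : forall w, `|h2 w| <= K2)
  (h3K : forall w, `|h3 w| <= K3).
Hypothesis supp : forall u, r < nr u -> [/\ h1 (lvl u) = 0, h2 (lvl u) = 0 & h3 (lvl u) = 0].

Definition radial u : R := h (lvl u).
Definition radial1 u x : R := 2 / B * h1 (lvl u) * ip u x.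
Definition radial2 u x y : R :=
  2 / B * h1 (lvl u) * ip x y + 4 / B ^+ 2 * h2 (lvl u) * (ip u x * ip u y).
(** The third differential in the directions [x], [x], [y]. Two equal directions are enough, since
    only [radial2 u x x] has to be compared at two points. *)
Definition radial3 u x y : R :=
  4 / B ^+ 2 * h2 (lvl u) * ip u y * ip x x +
  8 / B ^+ 3 * h3 (lvl u) * ip u y * ip u x ^+ 2 +
  8 / B ^+ 2 * h2 (lvl u) * (ip u x * ip x y).

(** [cr1], [cr2] and [cr3] bound the norms of the first three differentials: Cauchy-Schwarz inside
    the ball of radius [r], and [supp] outside it, where the differentials vanish. *)
Definition cr1 := 2 / B * K1 * r.
Definition cr2 := 2 / B * K1 + 4 / B ^+ 2 * K2 * r ^+ 2.
Definition cr3 := 12 / B ^+ 2 * K2 * r + 8 / B ^+ 3 * K3 * r ^+ 3.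

Let K10 : 0 <= K1. Proof. exact: le_trans (normr_ge0 _) (h1K 0). Qed.
Let K20 : 0 <= K2. Proof. exact: le_trans (normr_ge0 _) (h2K 0). Qed.
Let K30 : 0 <= K3. Proof. exact: le_trans (normr_ge0 _) (h3K 0). Qed.
Let Bn : B != 0. Proof. by rewrite gt_eqF. Qed.

Section paths.
Variables (U V : R -> J -> R) (U' V' : J -> R) (t : R).
Hypotheses (dU : forall j, der (fun z => U z j) t (U' j))
  (dV : forall j, der (fun z => V z j) t (V' j)).

Lemma der_lvl : der (fun z => lvl (U z)) t (2 / B * ip (U t) U').
Proof.
apply: der_eq.
  by apply: derM; [apply: derB; [exact: der_ip|exact: der_cst]|exact: der_cst].
by rewrite /= [ip U' _]ipC; field.
Qed.

Lemma der_radial : der (fun z => radial (U z)) t (radial1 (U t) U').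
Proof.
apply: der_eq; first by apply: der_comp; [exact: der_lvl|exact: dh].
by rewrite /radial1; ring.
Qed.

Lemma der_radial1 : der (fun z => radial1 (U z) (V z)) t (radial2 (U t) (V t) U' + radial1 (U t) V').
Proof.
apply: der_eq.
  apply: derM; last exact: der_ip dU dV.
  apply: derM; first exact: der_cst.
  by apply: der_comp; [exact: der_lvl|exact: dh1].
by rewrite /radial2 /radial1/= [ip U' _]ipC; field.
Qed.

Lemma der_radial2 x : der (fun z => radial2 (U z) x x) t (radial3 (U t) x U').
Proof.
have dx j : der (fun z => x j) t 0 by exact: der_cst.
have dUx : der (fun z => ip (U z) x) t (ip U' x).
  apply: der_eq; first exact: (der_ip (V := fun=> x)) dU dx.
  by rewrite {2}/ip big1 ?addr0// => j _; rewrite mulr0.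
apply: der_eq.
  apply: derD.
    apply: derM; last exact: der_cst.
    apply: derM; first exact: der_cst.
    by apply: der_comp; [exact: der_lvl|exact: dh1].
  apply: derM; last by apply: derM; exact: dUx.
  apply: derM; first exact: der_cst.
  by apply: der_comp; [exact: der_lvl|exact: dh2].
by rewrite /radial3/= [ip U' x]ipC; field.
Qed.

End paths.

Lemma radial1_bound u x : `|radial1 u x| <= cr1 * nr x.
Proof.
have cr0 : 0 <= cr1 * nr x by rewrite !mulr_ge0 ?nr_ge0// invr_ge0 ltW.
have [ur|/supp[E _ _]] := lerP (nr u) r; last by rewrite /radial1 E mulr0 mul0r normr0.
rewrite /radial1 /cr1 normrM normrM -[leRHS]mulrA; apply: ler_pM => //.
  by rewrite ger0_norm ?divr_ge0 ?(ltW B0)// ler_wpM2l// ?divr_ge0 ?(ltW B0).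
apply: (le_trans (cauchy_schwarz _ _)); by rewrite ler_wpM2r// nr_ge0.
Qed.

Lemma radial2_bound u x y : `|radial2 u x y| <= cr2 * (nr x * nr y).
Proof.
have cr0 : 0 <= cr2 * (nr x * nr y).
  by rewrite !mulr_ge0 ?nr_ge0// addr_ge0// !mulr_ge0 ?invr_ge0 ?exprn_ge0 ?(ltW B0).
have [ur|/supp[E1 E2 _]] := lerP (nr u) r; last first.
  by rewrite /radial2 E1 E2 !mulr0 !mul0r addr0 normr0.
rewrite /radial2 /cr2 [leRHS]mulrDl; apply: le_trans (ler_normD _ _) _; apply: lerD.
  rewrite normrM normrM; apply: ler_pM; [by rewrite mulr_ge0|by []| |exact: cauchy_schwarz].
  by rewrite ger0_norm ?divr_ge0 ?(ltW B0)// ler_wpM2l// ?divr_ge0 ?(ltW B0).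
have -> : 4 / B ^+ 2 * K2 * r ^+ 2 * (nr x * nr y) = 4 / B ^+ 2 * K2 * ((r * nr x) * (r * nr y)).
  by ring.
have c0 : 0 <= 4 / B ^+ 2 by rewrite divr_ge0// exprn_ge0// ltW.
rewrite normrM normrM; apply: ler_pM => //.
  by rewrite ger0_norm// ler_wpM2l.
rewrite normrM; apply: ler_pM => //; apply: (le_trans (cauchy_schwarz _ _));
  by rewrite ler_wpM2r// nr_ge0.
Qed.

Lemma radial3_bound u x y : `|radial3 u x y| <= cr3 * (nr x ^+ 2 * nr y).
Proof.
have cr0 : 0 <= cr3 * (nr x ^+ 2 * nr y).
  by rewrite !mulr_ge0 ?nr_ge0 ?exprn_ge0 ?nr_ge0// addr_ge0// !mulr_ge0 ?invr_ge0 ?exprn_ge0 ?(ltW B0).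
have [ur|/supp[E1 E2 E3]] := lerP (nr u) r; last first.
  by rewrite /radial3 E2 E3 !mulr0 !mul0r !addr0 normr0.
have C v z : `|ip v z| <= nr v * nr z := cauchy_schwarz v z.
have Cu z : `|ip u z| <= r * nr z.
  by apply: (le_trans (C _ _)); rewrite ler_wpM2r// nr_ge0.
have p2 : 0 <= (B ^+ 2)^-1 by rewrite invr_ge0 exprn_ge0// ltW.
have p3 : 0 <= (B ^+ 3)^-1 by rewrite invr_ge0 exprn_ge0// ltW.
have nx := nr_ge0 x; have ny := nr_ge0 y.
have -> : cr3 * (nr x ^+ 2 * nr y) =
  4 / B ^+ 2 * K2 * (r * nr y) * (nr x * nr x) +
  8 / B ^+ 3 * K3 * (r * nr y) * (r * nr x) ^+ 2 +
  8 / B ^+ 2 * K2 * ((r * nr x) * (nr x * nr y)) by rewrite /cr3; ring.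
rewrite /radial3; apply: le_trans (ler_normD _ _) _; apply: lerD.
  apply: le_trans (ler_normD _ _) _; apply: lerD.
    rewrite !normrM; apply: ler_pM => //; apply: ler_pM => //.
    by apply: ler_pM => //; rewrite -normrM ger0_norm// mulr_ge0.
  rewrite (normrM _ (_ ^+ 2)) normrX (normrM _ (ip u y)) (normrM _ (h3 _)); apply: ler_pM => //; last first.
    by rewrite lerXn2r// nnegrE// mulr_ge0.
  apply: ler_pM => //; apply: ler_pM => //; by rewrite ger0_norm// mulr_ge0.
rewrite !normrM; apply: ler_pM => //.
  by apply: ler_pM => //; rewrite -normrM ger0_norm// mulr_ge0.
exact: ler_pM.
Qed.

Lemma radial2_lip u x y :
  `|radial2 (fun j => u j + y j) x x - radial2 u x x| <= cr3 * (nr x ^+ 2 * nr y).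
Proof.
have dU t j : der (fun s => u j + s * y j) t (y j).
  apply: der_eq.
    by apply: derD; [exact: der_cst|apply: derM; [exact: der_id|exact: der_cst]].
  by rewrite /=; ring.
have H t : der (fun s => radial2 (fun j => u j + s * y j) x x) t (radial3 (fun j => u j + t * y j) x y).
  exact: (der_radial2 (U := fun s j => u j + s * y j)).
have := @der_bound _ _ _ 0 1 _ H (fun c _ => radial3_bound _ _ _).
rewrite subr0 normr1 mulr1.
have -> : (fun j => u j + 1 * y j) = (fun j => u j + y j).
  by apply/funext => j; rewrite mul1r.
by have -> : (fun j => u j + 0 * y j) = u by apply/funext => j; rewrite mul0r addr0.
Qed.

Lemma radial1_taylor u x c : exists2 s, `|s| <= `|c| &
  radial1 (fun j => u j + c * x j) x - radial1 u x = c * radial2 (fun j => u j + s * x j) x x.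
Proof.
have dU t j : der (fun s => u j + s * x j) t (x j).
  apply: der_eq.
    by apply: derD; [exact: der_cst|apply: derM; [exact: der_id|exact: der_cst]].
  by rewrite /=; ring.
have H t : der (fun s => radial1 (fun j => u j + s * x j) x) t (radial2 (fun j => u j + t * x j) x x).
  apply: der_eq.
    by apply: (der_radial1 (U := fun s j => u j + s * x j) (V := fun=> x) (V' := fun=> 0)) => // j;
      exact: der_cst.
  rewrite /radial1 (_ : ip _ (fun=> 0) = 0) ?mulr0 ?addr0//.
  by rewrite /ip big1// => j _; rewrite mulr0.
have [s sc E] := der_mvt 0 c H; exists s.
  by case: sc => /andP[s0 s1]; [rewrite !ger0_norm// (le_trans s0)|rewrite !ler0_norm ?lerN2// (le_trans s0)].
rewrite subr0 mulrC in E; rewrite -E; congr (_ - radial1 _ _).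
by apply/funext => j; rewrite mul0r addr0.
Qed.

Lemma measurable_lvl d (T : measurableType d) (U : T -> J -> R) :
  (forall j, measurable_fun [set: T] (fun t => U t j)) ->
  measurable_fun [set: T] (fun t => lvl (U t)).
Proof.
move=> mU; apply: measurable_funM => //; apply: measurable_funB => //.
exact: measurable_ip.
Qed.

Let mh : measurable_fun [set: R] h.
Proof. exact: continuous_measurable_fun (der_continuous dh). Qed.
Let mh1 : measurable_fun [set: R] h1.
Proof. exact: continuous_measurable_fun (der_continuous dh1). Qed.
Let mh2 : measurable_fun [set: R] h2.
Proof. exact: continuous_measurable_fun (der_continuous dh2). Qed.

Lemma measurable_radial d (T : measurableType d) (U : T -> J -> R) :
  (forall j, measurable_fun [set: T] (fun t => U t j)) ->
  measurable_fun [set: T] (fun t => radial (U t)).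
Proof. by move=> mU; apply: (measurableT_comp mh); exact: measurable_lvl. Qed.

Lemma measurable_radial1 d (T : measurableType d) (U V : T -> J -> R) :
  (forall j, measurable_fun [set: T] (fun t => U t j)) ->
  (forall j, measurable_fun [set: T] (fun t => V t j)) ->
  measurable_fun [set: T] (fun t => radial1 (U t) (V t)).
Proof.
move=> mU mV; apply: measurable_funM; last exact: measurable_ip.
by apply: measurable_funM => //; apply: (measurableT_comp mh1); exact: measurable_lvl.
Qed.

Lemma measurable_radial2 d (T : measurableType d) (U V V' : T -> J -> R) :
  (forall j, measurable_fun [set: T] (fun t => U t j)) ->
  (forall j, measurable_fun [set: T] (fun t => V t j)) ->
  (forall j, measurable_fun [set: T] (fun t => V' t j)) ->
  measurable_fun [set: T] (fun t => radial2 (U t) (V t) (V' t)).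
Proof.
move=> mU mV mV'; apply: measurable_funD; apply: measurable_funM.
- by apply: measurable_funM => //; apply: (measurableT_comp mh1); exact: measurable_lvl.
- exact: measurable_ip.
- by apply: measurable_funM => //; apply: (measurableT_comp mh2); exact: measurable_lvl.
- by apply: measurable_funM; exact: measurable_ip.
Qed.

End radial.

(** * Interpolation between sums and Gaussian vectors *)

Section hoelder_interpolation.
Variable R : realType.
Implicit Types a b q x M : R.

Lemma sqr_le_powR a q : 1 <= a -> 2 <= q -> a ^+ 2 <= a `^ q.
Proof. by move=> a1 q2; rewrite -powR_mulrn ?(le_trans ler01)// ler_powR. Qed.

Lemma cube_le_powR a q : 0 <= a <= 1 -> 0 < q <= 3 -> a ^+ 3 <= a `^ q.
Proof.
move=> /andP[a0 a1] /andP[q0 q3]; rewrite -powR_mulrn//.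
move: a0; rewrite le_eqVlt => /predU1P[<-|a0]; first by rewrite !powR0// gt_eqF.
by apply: ger_powR => //; rewrite a0.
Qed.

(** Everything is compared with the larger of [a] and [b]: the square bound serves when it is at
    least 1, the cube bound otherwise. *)
Lemma min_le_powR a b q M x : 0 <= a -> 0 <= b -> 2 < q <= 3 -> 0 <= M ->
  x <= M * a ^+ 2 -> x <= M * (a ^+ 2 * b) -> x <= M * (a `^ q + b `^ q).
Proof.
move=> a0 b0 /andP[q2 q3] M0 x1 x2.
have q0 : 0 < q <= 3 by rewrite q3 andbT; apply: lt_trans q2.
have pa := powR_ge0 a q; have pb := powR_ge0 b q.
have [ba|ab] := lerP b a.
  have [a1|a1] := lerP 1 a.
    apply: (le_trans x1); rewrite ler_wpM2l//.
    by have := sqr_le_powR a1 (ltW q2); lra.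
  apply: (le_trans x2); rewrite ler_wpM2l//.
  have : a ^+ 3 <= a `^ q by rewrite cube_le_powR// a0 ltW.
  have : a ^+ 2 * b <= a ^+ 3 by rewrite (exprSr a 2) ler_wpM2l ?sqr_ge0.
  lra.
have ab2 : a ^+ 2 <= b ^+ 2 by rewrite lerXn2r ?nnegrE// ltW.
have [b1|b1] := lerP 1 b.
  apply: (le_trans x1); rewrite ler_wpM2l//.
  by have := sqr_le_powR b1 (ltW q2); lra.
apply: (le_trans x2); rewrite ler_wpM2l//.
have : b ^+ 3 <= b `^ q by rewrite cube_le_powR// b0 ltW.
have : a ^+ 2 * b <= b ^+ 3 by rewrite (exprSr b 2) ler_wpM2r.
lra.
Qed.

End hoelder_interpolation.

Lemma measurable_csum d (T : measurableType d) (R : realType) (I : Type) (s : seq I)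
    (Q : pred I) (F : I -> T -> R) : (forall i, Q i -> measurable_fun [set: T] (F i)) ->
  measurable_fun [set: T] (fun x => \sum_(i <- s | Q i) F i x).
Proof.
move=> mF; have -> : (fun x => \sum_(i <- s | Q i) F i x) =
    (fun x => \sum_(i <- s) (if Q i then F i x else 0)).
  by apply/funext => x; exact: big_mkcond.
by apply: measurable_sum => i; have := mF i; case: (Q i) => [H|_]; [exact: H|exact: measurable_cst].
Qed.

Section approximate_ibp.
Context {d : measure_display} {T : measurableType d} {R : realType} (P : probability T R).
Variables (I J : finType) (X : I -> J -> T -> R) (q : R) (lam : J -> R).

(* [G] generates a sigma-algebra for which the variables [X k], [k != i], are
   measurable; only independence of [X i] and of this sigma-algebra is used, and
   only through first and second order monomials in [X i]. *)
Definition indep_from (i : I) : Prop := exists G : set (set T),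
  (forall k j, k != i -> measurable_fun [set: g_sigma_algebraType G] (X k j : g_sigma_algebraType G -> R)) /\
  forall U V : T -> R, (exists j, U = X i j) \/ (exists j k, U = fun w => X i j w * X i k w) ->
    measurable_fun [set: g_sigma_algebraType G] (V : g_sigma_algebraType G -> R) ->
    (exists C, forall w, `|V w| <= C) ->
    Ex P (fun w => U w * V w) = Ex P U * Ex P V.

Hypothesis q23 : 2 < q <= 3.
Hypothesis mX : forall i j, measurable_fun [set: T] (X i j).
Hypothesis Xq : forall i, intg P (fun w => nr (X i ^~ w) `^ q).
Hypothesis X0 : forall i j, Ex P (X i j) = 0.
Hypothesis cov : forall j k, \sum_i Ex P (fun w => X i j w * X i k w) = lam j * (j == k)%:R.
Hypothesis indX : forall i, indep_from i.

Let m i := Ex P (fun w => nr (X i ^~ w) `^ q).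

Lemma sqr_le_1powR (x : R) : 0 <= x -> x ^+ 2 <= 1 + x `^ q.
Proof.
move=> x0; have /andP[q2 _] := q23; have := powR_ge0 x q.
have [x1|x1] := lerP 1 x; first by have := sqr_le_powR x1 (ltW q2); lra.
have : x ^+ 2 <= 1 by rewrite expr_le1// ltW.
lra.
Qed.

Lemma measurable_nrX i : measurable_fun [set: T] (fun w => nr (X i ^~ w)).
Proof. exact: measurable_nr. Qed.

Lemma intg_nr2 i : intg P (fun w => nr (X i ^~ w) ^+ 2).
Proof.
apply: (@dom_intg _ _ _ _ _ (fun w => 1 + nr (X i ^~ w) `^ q)).
- by apply: measurable_funX; exact: measurable_nrX.
- by move=> w; rewrite ger0_norm ?exprn_ge0 ?nr_ge0// sqr_le_1powR// nr_ge0.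
- by apply: intgD; [exact: intg_cst|exact: Xq].
Qed.

Lemma coord_le_nr (u : J -> R) j : `|u j| <= nr u.
Proof.
rewrite -(@ler_pXn2r _ 2)// ?nnegrE ?nr_ge0// real_normK ?num_real// nr_sqr.
by rewrite /ip (bigD1 j)//= -expr2 lerDl sumr_ge0// => k _; rewrite -expr2 sqr_ge0.
Qed.

Lemma intg_XX i j k : intg P (fun w => X i j w * X i k w).
Proof.
apply: (dom_intg _ _ (intg_nr2 i)); first exact: measurable_funM.
by move=> w; rewrite normrM expr2 ler_pM// coord_le_nr.
Qed.

Lemma intg_X i j : intg P (X i j).
Proof.
apply: (@dom_intg _ _ _ _ _ (fun w => 1 + nr (X i ^~ w) ^+ 2)) => //.
  move=> w; have := coord_le_nr (X i ^~ w) j; have := nr_ge0 (X i ^~ w).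
  by nra.
by apply: intgD; [exact: intg_cst|exact: intg_nr2].
Qed.

Definition delta (j : J) : J -> R := fun k => (k == j)%:R.

Lemma ip_delta (u : J -> R) j : ip u (delta j) = u j.
Proof.
rewrite /ip (bigD1 j)//= /delta eqxx mulr1 big1 ?addr0// => k /negbTE ->.
by rewrite mulr0.
Qed.

Lemma nr_delta j : nr (delta j) = 1.
Proof. by rewrite /nr ip_delta /delta eqxx sqrtr1. Qed.

Lemma ip_suml (u v : J -> R) : ip u v = \sum_j u j * ip (delta j) v.
Proof. by apply: eq_bigr => j _; rewrite ipC ip_delta. Qed.

Variables (A B r K1 K2 K3 : R) (h h1 h2 h3 : R -> R).
Hypotheses (B0 : 0 < B) (r0 : 0 <= r).
Hypotheses (dh : forall x, der h x (h1 x)) (dh1 : forall x, der h1 x (h2 x))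
  (dh2 : forall x, der h2 x (h3 x)).
Hypotheses (h1K : forall w, `|h1 w| <= K1) (h2K : forall w, `|h2 w| <= K2)
  (h3K : forall w, `|h3 w| <= K3).
Hypothesis supp : forall u : J -> R, r < nr u ->
  [/\ h1 (lvl A B u) = 0, h2 (lvl A B u) = 0 & h3 (lvl A B u) = 0].
Variables (M kap : R).
Hypotheses (M0 : 0 <= M) (kap0 : 0 < kap).
Hypotheses (c2 : 2 * cr2 B r K1 K2 <= M * kap ^+ 2) (c3 : cr3 B r K2 K3 <= M * kap ^+ 3).

Local Notation rad1 := (radial1 A B h1).
Local Notation rad2 := (radial2 A B h1 h2).

Lemma radial1_sum (u x : J -> R) : rad1 u x = \sum_j x j * rad1 u (delta j).
Proof.
rewrite /radial1 ipC ip_suml mulr_sumr; apply: eq_bigr => j _.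
by rewrite [ip (delta j) u]ipC; ring.
Qed.

Lemma radial2_sum (u x : J -> R) : rad2 u x x = \sum_j \sum_k x j * x k * rad2 u (delta j) (delta k).
Proof.
have S1 : ip x x = \sum_j \sum_k x j * x k * ip (delta j) (delta k).
  rewrite ip_suml; apply: eq_bigr => j _.
  rewrite ipC ip_suml mulr_sumr; apply: eq_bigr => k _.
  by rewrite [ip (delta k) _]ipC mulrA.
have S2 : ip u x * ip u x = \sum_j \sum_k x j * x k * (ip u (delta j) * ip u (delta k)).
  rewrite [ip u x]ipC ip_suml mulr_suml; apply: eq_bigr => j _.
  rewrite mulr_sumr; apply: eq_bigr => k _.
  by rewrite ![ip (delta _) u]ipC; ring.
rewrite /radial2 S1 S2 !mulr_sumr -big_split; apply: eq_bigr => j _ /=.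
rewrite !mulr_sumr -big_split; apply: eq_bigr => k _ /=; ring.
Qed.

(** Twice the size bound and the Lipschitz bound are at most [M kap ^ 2 |x| ^ 2] and
    [M kap ^ 3 |x| ^ 2 |y|]. With lengths measured in units of [1 / kap] this is the situation of
    [min_le_powR], whence the factor [kap ^ q]. *)
Lemma radial2_hoelder (u x y : J -> R) : `|rad2 (fun j => u j + y j) x x - rad2 u x x| <=
  M * kap `^ q * (nr x `^ q + nr y `^ q).
Proof.
rewrite -mulrA mulrDr -!powRM ?nr_ge0 ?(ltW kap0)//.
have nx := nr_ge0 x; have ny := nr_ge0 y.
apply: min_le_powR; rewrite ?mulr_ge0 ?(ltW kap0)//.
- have b u' := radial2_bound B0 r0 h1K h2K supp u' x x.
  apply: le_trans (ler_normB _ _) _.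
  have := b u; have := b (fun j => u j + y j).
  have := ler_wpM2r (mulr_ge0 nx nx) c2; rewrite exprMn; lra.
- apply: (le_trans (radial2_lip B0 r0 dh1 dh2 h2K h3K supp u x y)).
  have := ler_wpM2r (mulr_ge0 (exprn_ge0 2 nx) ny) c3.
  by move/le_trans; apply; rewrite le_eqVlt; apply/orP; left; apply/eqP; ring.
Qed.

Section one_summand.
Variables (i : I) (c : R) (v : J -> R).
Hypothesis c1 : `|c| <= 1.

Let U w j := c * (\sum_(k | k != i) X k j w) + v j.
Let UX w j := c * (\sum_k X k j w) + v j.
Let Xi w := X i ^~ w.
Let sig j k := Ex P (fun w => X i j w * X i k w).

Let mU j : measurable_fun [set: T] (U ^~ j).
Proof.
apply: measurable_funD => //; apply: measurable_funM => //.
by apply: measurable_csum => // k _; exact: mX.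
Qed.

Let mUX j : measurable_fun [set: T] (UX ^~ j).
Proof.
apply: measurable_funD => //; apply: measurable_funM => //.
by apply: measurable_csum => // k _; exact: mX.
Qed.

Let UXE w : UX w = (fun j => U w j + c * X i j w).
Proof. by apply/funext => j; rewrite /UX /U (bigD1 i)//=; ring. Qed.

Let rad1_intg (V : T -> J -> R) : (forall j, measurable_fun [set: T] (V ^~ j)) ->
  intg P (fun w => rad1 (V w) (Xi w)).
Proof.
move=> mV; apply: (@dom_intg _ _ _ _ _ (fun w => cr1 B r K1 * (1 + nr (Xi w) ^+ 2))).
- by apply: (measurable_radial1 A B dh1) => // j; exact: mX.
- move=> w; apply: (le_trans (radial1_bound B0 r0 h1K supp _ _)).
  rewrite ler_wpM2l//.
    by rewrite /cr1 !mulr_ge0 ?invr_ge0 ?(ltW B0)// (le_trans (normr_ge0 _) (h1K 0)).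
  by have := nr_ge0 (Xi w); nra.
- by apply: intgZ; apply: intgD; [exact: intg_cst|exact: intg_nr2].
Qed.

Let rad2_intg (V : T -> J -> R) : (forall j, measurable_fun [set: T] (V ^~ j)) ->
  intg P (fun w => rad2 (V w) (Xi w) (Xi w)).
Proof.
move=> mV; apply: (@dom_intg _ _ _ _ _ (fun w => cr2 B r K1 K2 * nr (Xi w) ^+ 2)).
- by apply: (measurable_radial2 A B dh1 dh2) => // j; exact: mX.
- by move=> w; rewrite expr2; exact: (radial2_bound B0 r0 h1K h2K supp).
- by apply: intgZ; exact: intg_nr2.
Qed.

Let rad2d_bound u j k : `|rad2 u (delta j) (delta k)| <= cr2 B r K1 K2.
Proof.
by have := radial2_bound B0 r0 h1K h2K supp u (delta j) (delta k); rewrite !nr_delta !mulr1.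
Qed.

Let rad2d_intg (V : T -> J -> R) j k : (forall j, measurable_fun [set: T] (V ^~ j)) ->
  intg P (fun w => rad2 (V w) (delta j) (delta k)).
Proof.
move=> mV; apply: (@bounded_intg _ _ _ _ _ (cr2 B r K1 K2)); last by move=> w; exact: rad2d_bound.
by apply: (measurable_radial2 A B dh1 dh2) => //.
Qed.

Let indep_rad1 : Ex P (fun w => rad1 (U w) (Xi w)) = 0.
Proof.
have [G [mG prodG]] := indX i.
have mUG j : measurable_fun [set: g_sigma_algebraType G] (U ^~ j : g_sigma_algebraType G -> R).
  apply: measurable_funD => //; apply: measurable_funM => //.
  by apply: measurable_csum => // k ki; exact: mG.
have bd w j : `|rad1 (U w) (delta j)| <= cr1 B r K1.
  by have := radial1_bound B0 r0 h1K supp (U w) (delta j); rewrite nr_delta mulr1.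
have mUd j : measurable_fun [set: g_sigma_algebraType G]
    ((fun w => rad1 (U w) (delta j)) : g_sigma_algebraType G -> R).
  exact: (measurable_radial1 A B dh1).
have md j : measurable_fun [set: T] (fun w => rad1 (U w) (delta j)).
  exact: (measurable_radial1 A B dh1).
have -> : Ex P (fun w => rad1 (U w) (Xi w)) =
    Ex P (fun w => \sum_j X i j w * rad1 (U w) (delta j)).
  by apply: eq_Ex => w; rewrite radial1_sum.
rewrite Ex_sum => [|j _]; last first.
  by apply: (intg_mulbr (intg_X i j) (md j)) => w; exact: bd.
rewrite big1// => j _; rewrite (prodG (X i j)); [|by left; exists j|exact: mUd|].
  by rewrite X0 mul0r.
by exists (cr1 B r K1) => w; exact: bd.
Qed.

Let indep_rad2 : Ex P (fun w => rad2 (U w) (Xi w) (Xi w)) =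
  \sum_j \sum_k sig j k * Ex P (fun w => rad2 (U w) (delta j) (delta k)).
Proof.
have [G [mG prodG]] := indX i.
have mUG j : measurable_fun [set: g_sigma_algebraType G] (U ^~ j : g_sigma_algebraType G -> R).
  apply: measurable_funD => //; apply: measurable_funM => //.
  by apply: measurable_csum => // k ki; exact: mG.
have mUd j k : measurable_fun [set: g_sigma_algebraType G]
    ((fun w => rad2 (U w) (delta j) (delta k)) : g_sigma_algebraType G -> R).
  exact: (measurable_radial2 A B dh1 dh2).
have md j k : measurable_fun [set: T] (fun w => rad2 (U w) (delta j) (delta k)).
  exact: (measurable_radial2 A B dh1 dh2).
have ii j k : intg P (fun w => X i j w * X i k w * rad2 (U w) (delta j) (delta k)).
  by apply: (intg_mulbr (intg_XX i j k) (md j k)) => w; exact: rad2d_bound.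
have -> : Ex P (fun w => rad2 (U w) (Xi w) (Xi w)) =
    Ex P (fun w => \sum_j \sum_k X i j w * X i k w * rad2 (U w) (delta j) (delta k)).
  by apply: eq_Ex => w; rewrite radial2_sum.
rewrite Ex_sum => [|j _]; last by apply: intg_sum => k _; exact: ii.
apply: eq_bigr => j _; rewrite Ex_sum => [|k _]; last exact: ii.
apply: eq_bigr => k _.
rewrite (prodG (fun w => X i j w * X i k w))//; first by right; exists j, k.
by exists (cr2 B r K1 K2) => w; exact: rad2d_bound.
Qed.

Let MK0 : 0 <= M * kap `^ q.
Proof. by rewrite mulr_ge0// powR_ge0. Qed.

Let nr_cX w s : `|s| <= 1 -> nr (fun j => s * X i j w) `^ q <= nr (Xi w) `^ q.
Proof.
move=> s1; have /andP[q2 _] := q23.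
rewrite ge0_ler_powR ?nnegrE ?nr_ge0//; first by rewrite (le_trans _ (ltW q2)).
by rewrite nrZ ler_piMl// nr_ge0.
Qed.

(** [U] omits the summand [i], hence is independent of it, and the zeroth order term vanishes
    because [X i] is centered. The first order term is evaluated at an intermediate point, and
    moving it back to [U] costs the Hoelder bound. *)
Let taylor_part :
  `|Ex P (fun w => rad1 (UX w) (Xi w)) - c * Ex P (fun w => rad2 (U w) (Xi w) (Xi w))| <=
  2 * M * kap `^ q * m i.
Proof.
have -> : Ex P (fun w => rad1 (UX w) (Xi w)) - c * Ex P (fun w => rad2 (U w) (Xi w) (Xi w)) =
    Ex P (fun w => rad1 (UX w) (Xi w) - rad1 (U w) (Xi w) - c * rad2 (U w) (Xi w) (Xi w)).
  rewrite ExB; [|by apply: intgB; exact: rad1_intg|by apply: intgZ; exact: rad2_intg].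
  rewrite ExB ?ExZ ?indep_rad1 ?subr0//; by [exact: rad2_intg|exact: rad1_intg].
rewrite -[leRHS]ExZ; last exact: Xq.
apply: norm_Ex_le.
- apply: intgB; last by apply: intgZ; exact: rad2_intg.
  by apply: intgB; exact: rad1_intg.
- by apply: intgZ; exact: Xq.
- move=> w.
  have [s sc] := radial1_taylor A B0 dh1 (U w) (Xi w) c.
  rewrite -UXE => ->; rewrite -mulrBr normrM.
  apply: le_trans (ler_piMl (normr_ge0 _) c1) _.
  apply: (le_trans (radial2_hoelder _ _ _)).
  have s1 : `|s| <= 1 by exact: le_trans c1.
  have := ler_wpM2l MK0 (nr_cX w s1).
  by rewrite mulrDr; lra.
Qed.

(** In the covariance term [U] is replaced by the full sum [UX], so that the second differentials no
    longer depend on [i] and the covariances can be summed. *)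
Let swap_part : `|\sum_j \sum_k sig j k * Ex P (fun w => rad2 (U w) (delta j) (delta k)) -
    \sum_j \sum_k sig j k * Ex P (fun w => rad2 (UX w) (delta j) (delta k))| <=
  2 * M * kap `^ q * m i.
Proof.
pose D j k w := rad2 (UX w) (delta j) (delta k) - rad2 (U w) (delta j) (delta k).
have iD j k : intg P (D j k) by apply: intgB; exact: rad2d_intg.
have E : \sum_j \sum_k sig j k * Ex P (fun w => rad2 (UX w) (delta j) (delta k)) -
   \sum_j \sum_k sig j k * Ex P (fun w => rad2 (U w) (delta j) (delta k)) =
   Ex P (fun w => \sum_j \sum_k sig j k * D j k w).
  rewrite -sumrB Ex_sum => [|j _]; last by apply: intg_sum => k _; exact: intgZ.
  apply: eq_bigr => j _; rewrite -sumrB Ex_sum => [|k _]; last exact: intgZ.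
  apply: eq_bigr => k _; rewrite ExZ// ExB -?mulrBr//; exact: rad2d_intg.
rewrite distrC E.
have -> : 2 * M * kap `^ q * m i =
    Ex P (fun w => M * kap `^ q * (m i + nr (Xi w) `^ q)).
  rewrite ExZ; last by apply: intgD; [exact: intg_cst|exact: Xq].
  by rewrite ExD ?Ex_cst; [rewrite -/(m i); ring|exact: intg_cst|exact: Xq].
apply: norm_Ex_le.
- by apply: intg_sum => j _; apply: intg_sum => k _; exact: intgZ.
- by apply: intgZ; apply: intgD; [exact: intg_cst|exact: Xq].
- move=> w.
  (* [sig] is the covariance of an independent copy of the summand, drawn at [w']: for fixed [w] the
     double sum is an expectation of differences of [rad2] in the direction [Xi w'], to which the
     Hoelder bound applies. *)
  have -> : \sum_j \sum_k sig j k * D j k w =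
      Ex P (fun w' => rad2 (UX w) (Xi w') (Xi w') - rad2 (U w) (Xi w') (Xi w')).
    have EE u : Ex P (fun w' => rad2 u (Xi w') (Xi w')) =
        \sum_j \sum_k sig j k * rad2 u (delta j) (delta k).
      under eq_Ex do rewrite radial2_sum.
      rewrite Ex_sum => [|j _]; last first.
        apply: intg_sum => k _.
        apply: (eq_intg _ (intgZ (rad2 u (delta j) (delta k)) (intg_XX i j k))) => w'; exact: mulrC.
      apply: eq_bigr => j _; rewrite Ex_sum => [|k _]; last first.
        apply: (eq_intg _ (intgZ (rad2 u (delta j) (delta k)) (intg_XX i j k))) => w'; exact: mulrC.
      apply: eq_bigr => k _; rewrite mulrC -ExZ; last exact: intg_XX.
      by apply: eq_Ex => w'; rewrite mulrC.
    rewrite ExB; [|exact: (rad2_intg (V := fun=> UX w))|exact: (rad2_intg (V := fun=> U w))].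
    rewrite !EE -sumrB; apply: eq_bigr => j _; rewrite -sumrB; apply: eq_bigr => k _.
    by rewrite -mulrBr.
  have -> : M * kap `^ q * (m i + nr (Xi w) `^ q) =
      Ex P (fun w' => M * kap `^ q * (nr (Xi w') `^ q + nr (Xi w) `^ q)).
    rewrite ExZ; last by apply: intgD; [exact: Xq|exact: intg_cst].
    by rewrite ExD ?Ex_cst//; [exact: Xq|exact: intg_cst].
  apply: norm_Ex_le.
  + by apply: intgB; [exact: (rad2_intg (V := fun=> UX w))|exact: (rad2_intg (V := fun=> U w))].
  + by apply: intgZ; apply: intgD; [exact: Xq|exact: intg_cst].
  + move=> w'; rewrite UXE; apply: (le_trans (radial2_hoelder _ _ _)).
    by rewrite ler_wpM2l// lerD2l; exact: nr_cX.
Qed.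

Lemma approx_ibp1 :
  `|Ex P (fun w => rad1 (UX w) (Xi w)) -
    c * \sum_j \sum_k sig j k * Ex P (fun w => rad2 (UX w) (delta j) (delta k))| <=
  4 * M * kap `^ q * m i.
Proof.
have H1 := taylor_part; rewrite indep_rad2 in H1; have H2 := swap_part.
move: H1 H2; set a := Ex P _; set b := \sum_j _; set b' := \sum_j _ => H1 H2.
have -> : a - c * b' = (a - c * b) + c * (b - b') by ring.
apply: le_trans (ler_normD _ _) _; rewrite [X in _ + X]normrM.
have := ler_piMl (normr_ge0 (b - b')) c1; lra.
Qed.

End one_summand.

Definition Zsum w j := \sum_i X i j w.

(** Over all summands the covariances add up to the diagonal matrix [lam], and only second
    differentials along the coordinate axes survive. *)
Lemma approx_ibp c v : `|c| <= 1 ->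
  `|Ex P (fun w => rad1 (fun j => c * Zsum w j + v j) (Zsum w)) -
    c * \sum_j lam j * Ex P (fun w => rad2 (fun j => c * Zsum w j + v j) (delta j) (delta j))| <=
  4 * M * kap `^ q * \sum_i m i.
Proof.
move=> c1.
have mU j : measurable_fun [set: T] (fun w => c * Zsum w j + v j).
  apply: measurable_funD => //; apply: measurable_funM => //.
  by apply: measurable_csum => // k _; exact: mX.
have i1 i : intg P (fun w => rad1 (fun j => c * Zsum w j + v j) (X i ^~ w)).
  apply: (@dom_intg _ _ _ _ _ (fun w => cr1 B r K1 * (1 + nr (X i ^~ w) ^+ 2))).
  - by apply: (measurable_radial1 A B dh1) => // j; exact: mX.
  - move=> w; apply: (le_trans (radial1_bound B0 r0 h1K supp _ _)).
    rewrite ler_wpM2l//.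
      by rewrite /cr1 !mulr_ge0 ?invr_ge0 ?(ltW B0)// (le_trans (normr_ge0 _) (h1K 0)).
    by have := nr_ge0 (X i ^~ w); nra.
  - by apply: intgZ; apply: intgD; [exact: intg_cst|exact: intg_nr2].
have -> : Ex P (fun w => rad1 (fun j => c * Zsum w j + v j) (Zsum w)) =
    \sum_i Ex P (fun w => rad1 (fun j => c * Zsum w j + v j) (X i ^~ w)).
  rewrite -Ex_sum => [|i _]; last exact: i1.
  apply: eq_Ex => w; rewrite /radial1 -mulr_sumr; congr (_ * _).
  rewrite /ip exchange_big/=; apply: eq_bigr => j _.
  by rewrite -mulr_sumr.
have -> : \sum_j lam j * Ex P (fun w => rad2 (fun j => c * Zsum w j + v j) (delta j) (delta j)) =
  \sum_i \sum_j \sum_k Ex P (fun w => X i j w * X i k w) *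
    Ex P (fun w => rad2 (fun j => c * Zsum w j + v j) (delta j) (delta k)).
  rewrite exchange_big/=; apply: eq_bigr => j _; rewrite exchange_big/=.
  under eq_bigr do rewrite -mulr_suml cov.
  rewrite (bigD1 j)//= eqxx mulr1 big1 ?addr0// => k /negbTE.
  by rewrite eq_sym => ->; rewrite mulr0 mul0r.
rewrite mulr_sumr -sumrB; apply: (le_trans (ler_norm_sum _ _ _)).
rewrite mulr_sumr; apply: ler_sum => i _; exact: approx_ibp1.
Qed.

End approximate_ibp.

Section interpolation.
Context {d : measure_display} {T : measurableType d} {R : realType} (P : probability T R).
Variables (I J : finType) (X : I -> J -> T -> R) (q : R) (lam : J -> R).
Variable G : gspace R J.
Local Notation W := (gs_sort G).
Local Notation Q := (gs_prob G).
Local Notation g := (@gs_coord R J G).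
Local Notation Z := (Zsum X).

Hypothesis q23 : 2 < q <= 3.
Hypothesis mX : forall i j, measurable_fun [set: T] (X i j).
Hypothesis Xq : forall i, intg P (fun w => nr (X i ^~ w) `^ q).
Hypothesis X0 : forall i j, Ex P (X i j) = 0.
Hypothesis lam0 : forall j, 0 <= lam j.
Hypothesis cov : forall j k, \sum_i Ex P (fun w => X i j w * X i k w) = lam j * (j == k)%:R.
Hypothesis indX : forall i, indep_from P X i.

Variables (A B r K1 K2 K3 : R) (h h1 h2 h3 : R -> R).
Hypotheses (B0 : 0 < B) (r0 : 0 <= r).
Hypotheses (dh : forall x, der h x (h1 x)) (dh1 : forall x, der h1 x (h2 x))
  (dh2 : forall x, der h2 x (h3 x)).
Hypotheses (h1K : forall w, `|h1 w| <= K1) (h2K : forall w, `|h2 w| <= K2)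
  (h3K : forall w, `|h3 w| <= K3) (h01 : forall w, 0 <= h w <= 1).
Hypothesis supp : forall u : J -> R, r < nr u ->
  [/\ h1 (lvl A B u) = 0, h2 (lvl A B u) = 0 & h3 (lvl A B u) = 0].
Variables (M kap : R).
Hypotheses (M0 : 0 <= M) (kap0 : 0 < kap).
Hypotheses (c2 : 2 * cr2 B r K1 K2 <= M * kap ^+ 2) (c3 : cr3 B r K2 K3 <= M * kap ^+ 3).

Local Notation rad := (radial A B h).
Local Notation rad1 := (radial1 A B h1).
Local Notation rad2 := (radial2 A B h1 h2).
Local Notation err := (4 * M * kap `^ q * \sum_i Ex P (fun w => nr (X i ^~ w) `^ q)).

Definition gvec (w : W) (j : J) : R := Num.sqrt (lam j) * g j w.

Let mZ j : measurable_fun [set: T] (Z ^~ j).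
Proof. by apply: measurable_csum => i _; exact: mX. Qed.

Let mN j : measurable_fun [set: W] (gvec ^~ j).
Proof. by apply: measurable_funM => //; exact: measurable_gs_coord. Qed.

Let sqr_sum_intg (s : seq I) j : intg P (fun w => (\sum_(i <- s) X i j w) ^+ 2).
Proof.
elim: s => [|i s IH].
  by apply: (eq_intg _ (intg_cst P 0)) => w; rewrite big_nil expr0n.
apply: (@dom_intg _ _ _ _ _ (fun w => 2 * X i j w ^+ 2 + 2 * (\sum_(i <- s) X i j w) ^+ 2)).
- by apply: measurable_funX; apply: measurable_csum => k _; exact: mX.
- move=> w; rewrite big_cons ger0_norm ?sqr_ge0//.
  by have := sqr_ge0 (X i j w - \sum_(i <- s) X i j w); lra.
- apply: intgD; last exact: intgZ.
  apply: intgZ; apply: (eq_intg _ (intg_XX q23 mX Xq i j j)) => w; by rewrite expr2.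
Qed.

Let nrZ_intg : intg P (fun w => nr (Z w) ^+ 2).
Proof.
have : intg P (fun w => \sum_j (Z w j) ^+ 2) by apply: intg_sum => j _; exact: sqr_sum_intg.
by apply: eq_intg => w; rewrite nr_sqr; apply: eq_bigr => j _; rewrite expr2.
Qed.

Let nrN_intg : intg Q (fun w => nr (gvec w) ^+ 2).
Proof.
have : intg Q (fun w => \sum_j lam j * (g j w) ^+ 2).
  by apply: intg_sum => j _; apply: intgZ; apply: tame_intg; apply: tameX; exact: tame_coord.
apply: eq_intg => w; rewrite nr_sqr; apply: eq_bigr => j _.
by rewrite -expr2 exprMn sqr_sqrtr.
Qed.

Let rad1d_bound u j : `|rad1 u (@delta R J j)| <= cr1 B r K1.
Proof. by have := radial1_bound B0 r0 h1K supp u (@delta R J j); rewrite nr_delta mulr1. Qed.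

Let rad2d_bound u j : `|rad2 u (@delta R J j) (@delta R J j)| <= cr2 B r K1 K2.
Proof.
by have := radial2_bound B0 r0 h1K h2K supp u (@delta R J j) (@delta R J j); rewrite !nr_delta !mulr1.
Qed.

Let cr1_ge0 : 0 <= cr1 B r K1.
Proof. by rewrite /cr1 !mulr_ge0 ?invr_ge0 ?(ltW B0)// (le_trans (normr_ge0 _) (h1K 0)). Qed.

Let cr2_ge0 : 0 <= cr2 B r K1 K2.
Proof.
have k1 := le_trans (normr_ge0 _) (h1K 0); have k2 := le_trans (normr_ge0 _) (h2K 0).
by rewrite addr_ge0// !mulr_ge0 ?invr_ge0 ?exprn_ge0 ?(ltW B0).
Qed.

(** One factor [sqrt lam_j] comes from the vector, the other from differentiating along coordinate
    [j]; together they produce the variance [lam_j]. *)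
Lemma gauss_ibp u s :
  Ex Q (fun w => rad1 (fun j => u j + s * gvec w j) (gvec w)) =
  s * \sum_j lam j * Ex Q (fun w => rad2 (fun j => u j + s * gvec w j) (@delta R J j) (@delta R J j)).
Proof.
have mU j : measurable_fun [set: W] (fun w => u j + s * gvec w j).
  by apply: measurable_funD => //; exact: measurable_funM.
pose F j w := rad1 (fun j => u j + s * gvec w j) (@delta R J j).
pose F2 j w := rad2 (fun j => u j + s * gvec w j) (@delta R J j) (@delta R J j).
have tF j : tame (F j).
  apply: (@tame_bounded _ _ _ _ (cr1 B r K1)) => [|w]; last exact: rad1d_bound.
  exact: (measurable_radial1 A B dh1).
have tF2 j : tame (F2 j).
  apply: (@tame_bounded _ _ _ _ (cr2 B r K1 K2)) => [|w]; last exact: rad2d_bound.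
  exact: (measurable_radial2 A B dh1 dh2).
have dU j w x k : der (fun y => u k + s * gvec (@gs_resample R J G j (y, w)) k) x
    (s * Num.sqrt (lam j) * @delta R J j k).
  apply: der_eq.
    apply: derD; first exact: der_cst.
    apply: derM; first exact: der_cst.
    apply: derM; first exact: der_cst.
    have [_ _ + _] := pder_coord G j k; exact.
  by rewrite /delta /=; have [->|_] := eqVneq k j; rewrite /=; ring.
have pF j : pder j (F j) (fun w => s * Num.sqrt (lam j) * F2 j w).
  split; first exact: tF.
  - exact: tameM (tame_cst _ _) (tF2 j).
  - move=> w x; apply: der_eq.
      apply: (der_radial1 A B0 dh1 (U := fun y k => u k + s * gvec (@gs_resample R J G j (y, w)) k)
        (V := fun=> @delta R J j) (V' := fun=> 0)); first exact: dU.
      by move=> k; exact: der_cst.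
    have ip0 v : ip v (fun=> 0) = 0 :> R by rewrite /ip big1// => k _; rewrite mulr0.
    by rewrite /F2 /radial1 /radial2 ip0 !ipZr; ring.
  - move=> w x; apply: cvgM; first exact: cvg_cst.
    apply: (@der_continuous _ (fun y => F2 j (@gs_resample R J G j (y, w)))) => y.
    apply: (der_radial2 A B0 dh1 dh2 (U := fun y k => u k + s * gvec (@gs_resample R J G j (y, w)) k)).
    exact: dU.
transitivity (Ex Q (fun w => \sum_j gvec w j * F j w)).
  by apply: eq_Ex => w; exact: radial1_sum.
rewrite Ex_sum => [|j _]; last first.
  apply: tame_intg; apply: tameM => //.
  by apply: tameM; [exact: tame_cst|exact: tame_coord].
rewrite mulr_sumr; apply: eq_bigr => j _.
have -> : Ex Q (fun w => gvec w j * F j w) = Num.sqrt (lam j) * Ex Q (fun w => g j w * F j w).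
  rewrite -ExZ; last by apply: tame_intg; apply: tameM => //; exact: tame_coord.
  by apply: eq_Ex => w; rewrite mulrA.
rewrite (ibp1 (pF j)) ExZ; last exact: tame_intg.
by rewrite -[in RHS](sqr_sqrtr (lam0 j)); ring.
Qed.

Let PQ : probability (T * W)%type R := (P \x Q)%E.

Let U (t : R) (z : T * W) (j : J) : R := cos t * Z z.1 j + sin t * gvec z.2 j.
Let U' (t : R) (z : T * W) (j : J) : R := - sin t * Z z.1 j + cos t * gvec z.2 j.

Let mZ1 j : measurable_fun [set: T * W] (fun z => Z z.1 j).
Proof. exact: (measurableT_comp (mZ j) measurable_fst). Qed.

Let mN2 j : measurable_fun [set: T * W] (fun z => gvec z.2 j).
Proof. exact: (measurableT_comp (mN j) measurable_snd). Qed.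

Let mU t j : measurable_fun [set: T * W] (fun z => U t z j).
Proof. by apply: measurable_funD; apply: measurable_funM. Qed.

Let mU' t j : measurable_fun [set: T * W] (fun z => U' t z j).
Proof. by apply: measurable_funD; apply: measurable_funM. Qed.

Let dUt z t j : der (fun s => U s z j) t (U' t z j).
Proof.
apply: der_eq.
  by apply: derD; (apply: derM; last exact: der_cst); [exact: is_derive_cos|exact: is_derive_sin].
by rewrite /U' /=; ring.
Qed.

Let dU't z t j : der (fun s => U' s z j) t (- U t z j).
Proof.
apply: der_eq.
  apply: derD; (apply: derM; last exact: der_cst); last exact: is_derive_cos.
  by apply: derN; exact: is_derive_sin.
by rewrite /U /=; ring.
Qed.

Let env (z : T * W) : R := 1 + (2 * nr (Z z.1) ^+ 2 + 2 * nr (gvec z.2) ^+ 2).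

Let env_intg : intg PQ env.
Proof.
apply: intgD; first exact: intg_cst.
apply: intgD; apply: intgZ; [exact: (intg_fst Q nrZ_intg)|exact: (intg_snd P nrN_intg)].
Qed.

Let nrU t z : nr (U t z) ^+ 2 <= env z /\ nr (U' t z) ^+ 2 <= env z.
Proof.
have c1 : cos t ^+ 2 <= 1 by rewrite -(cos2Dsin2 t) lerDl sqr_ge0.
have s1 : sin t ^+ 2 <= 1 by rewrite -(cos2Dsin2 t) lerDr sqr_ge0.
have a0 := sqr_ge0 (nr (Z z.1)); have b0 := sqr_ge0 (nr (gvec z.2)).
have HH x y : x ^+ 2 <= 1 -> y ^+ 2 <= 1 ->
    nr (fun j => x * Z z.1 j + y * gvec z.2 j) ^+ 2 <= env z.
  move=> x1 y1; apply: (le_trans (nr_sqrD _ _)).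
  rewrite !nrZ !exprMn !real_normK ?num_real// /env.
  have := ler_piMl a0 x1; have := ler_piMl b0 y1; lra.
by split; apply: HH => //; rewrite sqrrN.
Qed.

Let nr_le1sqr (u : J -> R) : nr u <= 1 + nr u ^+ 2.
Proof. by have := nr_ge0 u; nra. Qed.

Let env_ge1 z : 1 <= env z.
Proof. by rewrite /env lerDl addr_ge0// mulr_ge0// sqr_ge0. Qed.

Let rad1_intg t (V : T * W -> J -> R) : (forall j, measurable_fun [set: T * W] (V ^~ j)) ->
  (forall z, nr (V z) ^+ 2 <= env z) -> intg PQ (fun z => rad1 (U t z) (V z)).
Proof.
move=> mV Vb; apply: (@dom_intg _ _ _ _ _ (fun z => cr1 B r K1 * (2 * env z))).
- exact: (measurable_radial1 A B dh1).
- move=> z; apply: (le_trans (radial1_bound B0 r0 h1K supp _ _)); rewrite ler_wpM2l//.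
  by have := nr_le1sqr (V z); have := Vb z; have := env_ge1 z; lra.
- by apply: intgZ; apply: intgZ.
Qed.

Let Theta t := Ex PQ (fun z => rad (U t z)).
Let D t := Ex PQ (fun z => rad1 (U t z) (U' t z)).

Let rad_intg t : intg PQ (fun z => rad (U t z)).
Proof.
apply: (@bounded_intg _ _ _ _ _ 1); first exact: (measurable_radial A B dh).
by move=> z; have /andP[h0 hle] := h01 (lvl A B (U t z)); rewrite ger0_norm.
Qed.

(** The path satisfies [U'' = - U], so the second derivative of the integrand is bounded by a
    constant times [env], uniformly in time; the expectation of the resulting quadratic remainder is
    what [der_quadratic] asks for. *)
Let dTheta t : der Theta t (D t).
Proof.
apply: (@der_quadratic _ _ _ _ (Ex PQ (fun z => (2 * cr1 B r K1 + cr2 B r K1 K2) * env z))) => y _.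
have i1 := rad1_intg t (mU' t) (fun z => (nrU t z).2).
have i2 : intg PQ (fun z => (y - t) * rad1 (U t z) (U' t z)) by exact: intgZ.
have -> : Theta y - Theta t - D t * (y - t) =
    Ex PQ (fun z => rad (U y z) - rad (U t z) - (y - t) * rad1 (U t z) (U' t z)).
  rewrite ExB//; last by apply: intgB; exact: rad_intg.
  by rewrite ExB ?ExZ ?[D t * _]mulrC//; exact: rad_intg.
rewrite mulrC -ExZ; last exact/intgZ/env_intg.
apply: norm_Ex_le.
- by apply: intgB => //; apply: intgB; exact: rad_intg.
- exact/intgZ/intgZ/env_intg.
move=> z.
have dp s : der (fun t => rad (U t z)) s (rad1 (U s z) (U' s z)).
  exact: (der_radial A B0 dh (U := fun t => U t z) (dUt z s)).
have dp' s : der (fun t => rad1 (U t z) (U' t z)) s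
    (rad2 (U s z) (U' s z) (U' s z) + rad1 (U s z) (fun j => - U s z j)).
  exact: (der_radial1 A B0 dh1 (U := fun t => U t z) (V := fun t => U' t z) (dUt z s) (dU't z s)).
have bp s : `|rad2 (U s z) (U' s z) (U' s z) + rad1 (U s z) (fun j => - U s z j)| <=
    (2 * cr1 B r K1 + cr2 B r K1 K2) * env z.
  have [a1 a2] := nrU s z.
  have nN : nr (fun j => - U s z j) = nr (U s z).
    have -> : (fun j => - U s z j) = (fun j => -1 * U s z j) by apply/funext => j; rewrite mulN1r.
    by rewrite nrZ normrN1 mul1r.
  have b1 := radial1_bound B0 r0 h1K supp (U s z) (fun j => - U s z j); rewrite nN in b1.
  have b2 := radial2_bound B0 r0 h1K h2K supp (U s z) (U' s z) (U' s z).
  rewrite -expr2 in b2.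
  apply: le_trans (ler_normD _ _) _.
  have := ler_wpM2l cr2_ge0 a2.
  have e1 : nr (U s z) <= 2 * env z.
    by have := nr_le1sqr (U s z); have := env_ge1 z; lra.
  have := ler_wpM2l cr1_ge0 e1; lra.
have [x xty ->] := der_mvt t y dp.
rewrite mulrC -mulrBr normrM [X in _ * X](_ : _ = `|rad1 (U x z) (U' x z) - rad1 (U t z) (U' t z)|)//.
have := @der_bound _ _ _ t x _ dp' (fun c _ => bp c); set b := _ * env z => H.
have b0 : 0 <= b by rewrite mulr_ge0 ?(le_trans ler01 (env_ge1 z))// addr_ge0// mulr_ge0.
have xt : `|x - t| <= `|y - t|.
  by case: xty => /andP[s0 s1]; [rewrite !ger0_norm ?subr_ge0 ?lerD2r// (le_trans s0)|
    rewrite !ler0_norm ?subr_le0// ?lerN2 ?lerD2r// (le_trans s0)].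
rewrite -(real_normK (num_real (y - t))) expr2 -mulrA ler_wpM2l// mulrC.
by apply: (le_trans H); rewrite ler_wpM2l.
Qed.

Let T2 t := Ex PQ (fun z => \sum_j lam j * rad2 (U t z) (@delta R J j) (@delta R J j)).

Let rad2s_intg t : intg PQ (fun z => \sum_j lam j * rad2 (U t z) (@delta R J j) (@delta R J j)).
Proof.
apply: intg_sum => j _; apply: intgZ.
apply: (@bounded_intg _ _ _ _ _ (cr2 B r K1 K2)) => [|z]; last exact: rad2d_bound.
exact: (measurable_radial2 A B dh1 dh2).
Qed.

Let cos_norm t : `|cos t| <= 1 :> R.
Proof. by rewrite ler_norml cos_geN1 cos_le1. Qed.
Let sin_norm t : `|sin t| <= 1 :> R.
Proof. by rewrite ler_norml sin_geN1 sin_le1. Qed.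

Let env_fst z : nr (Z z.1) ^+ 2 <= env z.
Proof. by rewrite /env; have := sqr_ge0 (nr (Z z.1)); have := sqr_ge0 (nr (gvec z.2)); lra. Qed.
Let env_snd z : nr (gvec z.2) ^+ 2 <= env z.
Proof. by rewrite /env; have := sqr_ge0 (nr (Z z.1)); have := sqr_ge0 (nr (gvec z.2)); lra. Qed.

Let Z_part t : `|Ex PQ (fun z => rad1 (U t z) (Z z.1)) - cos t * T2 t| <= err.
Proof.
have iZ := rad1_intg t mZ1 env_fst.
have sec_m v j : measurable_fun [set: T] (fun w => cos t * Z w j + sin t * gvec v j).
  by apply: measurable_funD => //; exact: measurable_funM.
have [|i1 ->] := Ex_fubini2 iZ.
  move=> v /=; apply: (@dom_intg _ _ _ _ _ (fun w => cr1 B r K1 * (1 + nr (Z w) ^+ 2))).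
  - by apply: (measurable_radial1 A B dh1) => //; exact: sec_m.
  - by move=> w; apply: (le_trans (radial1_bound B0 r0 h1K supp _ _)); rewrite ler_wpM2l.
  - by apply: intgZ; apply: intgD; [exact: intg_cst|exact: nrZ_intg].
have i2s v j : intg P (fun w => rad2 (U t (w, v)) (@delta R J j) (@delta R J j)).
  apply: (@bounded_intg _ _ _ _ _ (cr2 B r K1 K2)) => [|z]; last exact: rad2d_bound.
  by apply: (measurable_radial2 A B dh1 dh2) => //; exact: sec_m.
have [|i2 E2] := Ex_fubini2 (rad2s_intg t).
  by move=> v /=; apply: intg_sum => j _; apply: intgZ; exact: i2s.
rewrite /T2 E2 -ExZ// -ExB//; last exact: intgZ.
apply: norm_Ex_cst; first by apply: intgB => //; exact: intgZ.
move=> v /=.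
(* The Gaussian vector is frozen at [v] and enters only as a shift. *)
have := approx_ibp q23 mX Xq X0 cov indX B0 r0 dh1 dh2 h1K h2K h3K supp M0 kap0 c2 c3
  (fun j => sin t * gvec v j) (cos_norm t).
rewrite [X in `|_ - _ * X|](_ : _ = Ex P (fun w => \sum_j lam j * rad2 (U t (w, v)) (@delta R J j) (@delta R J j)))//.
rewrite Ex_sum => [|j _]; last by apply: intgZ; exact: i2s.
by apply: eq_bigr => j _; rewrite ExZ//; exact: i2s.
Qed.

Let N_part t : Ex PQ (fun z => rad1 (U t z) (gvec z.2)) = sin t * T2 t.
Proof.
have iN := rad1_intg t mN2 env_snd.
have sec_m v j : measurable_fun [set: W] (fun w => cos t * Z v j + sin t * gvec w j).
  by apply: measurable_funD => //; exact: measurable_funM.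
have [|i1 ->] := Ex_fubini1 iN.
  move=> v /=; apply: (@dom_intg _ _ _ _ _ (fun w => cr1 B r K1 * (1 + nr (gvec w) ^+ 2))).
  - by apply: (measurable_radial1 A B dh1) => //; exact: sec_m.
  - by move=> w; apply: (le_trans (radial1_bound B0 r0 h1K supp _ _)); rewrite ler_wpM2l.
  - by apply: intgZ; apply: intgD; [exact: intg_cst|exact: nrN_intg].
have i2s v j : intg Q (fun w => rad2 (U t (v, w)) (@delta R J j) (@delta R J j)).
  apply: (@bounded_intg _ _ _ _ _ (cr2 B r K1 K2)) => [|z]; last exact: rad2d_bound.
  by apply: (measurable_radial2 A B dh1 dh2) => //; exact: sec_m.
have [|i2 E2] := Ex_fubini1 (rad2s_intg t).
  by move=> v /=; apply: intg_sum => j _; apply: intgZ; exact: i2s.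
rewrite /T2 E2 -ExZ//; apply: eq_Ex => v /=.
have -> := gauss_ibp (fun j => cos t * Z v j) (sin t).
congr (_ * _); rewrite Ex_sum => [|j _]; last by apply: intgZ; exact: i2s.
by apply: eq_bigr => j _; rewrite ExZ//; exact: i2s.
Qed.

Let D_bound t : `|D t| <= err.
Proof.
have iZ := rad1_intg t mZ1 env_fst.
have iN := rad1_intg t mN2 env_snd.
(* The Gaussian term [cos t sin t T2] cancels the main part of the other one; what is left is the
   defect of integration by parts for the sum. *)
have -> : D t = - sin t * (Ex PQ (fun z => rad1 (U t z) (Z z.1)) - cos t * T2 t).
  transitivity (Ex PQ (fun z => - sin t * rad1 (U t z) (Z z.1) + cos t * rad1 (U t z) (gvec z.2))).
    by apply: eq_Ex => z; rewrite /radial1 ipDr !ipZr; ring.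
  rewrite ExD; [|exact: intgZ|exact: intgZ].
  by rewrite !ExZ// N_part; ring.
rewrite normrM normrN; apply: le_trans (ler_piMl (normr_ge0 _) (sin_norm t)) _.
exact: Z_part.
Qed.

(** Mean value inequality for [Theta] between 0, where the path is at the sum, and [pi / 2], where
    it is at the Gaussian vector; the factor 2 bounds [pi / 2]. *)
Lemma interpolation_bound :
  `|Ex P (fun w => rad (Z w)) - Ex Q (fun w => rad (gvec w))| <= 2 * err.
Proof.
have E0 : Theta 0 = Ex P (fun w => rad (Z w)).
  have iZ : intg P (fun w => rad (Z w)).
    apply: (@bounded_intg _ _ _ _ _ 1); first exact: (measurable_radial A B dh).
    by move=> z; have /andP[h0 hle] := h01 (lvl A B (Z z)); rewrite ger0_norm.
  rewrite -(Ex_fst Q iZ); apply: eq_Ex => z; congr (radial _ _ _ _).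
  by apply/funext => j; rewrite /U cos0 sin0 mul1r mul0r addr0.
have E1 : Theta (pi / 2) = Ex Q (fun w => rad (gvec w)).
  have iN : intg Q (fun w => rad (gvec w)).
    apply: (@bounded_intg _ _ _ _ _ 1); first exact: (measurable_radial A B dh).
    by move=> z; have /andP[h0 hle] := h01 (lvl A B (gvec z)); rewrite ger0_norm.
  rewrite -(Ex_snd P iN); apply: eq_Ex => z; congr (radial _ _ _ _).
  by apply/funext => j; rewrite /U cos_pihalf sin_pihalf mul1r mul0r add0r.
rewrite -E0 -E1 distrC.
have := @der_bound _ _ _ 0 (pi / 2) _ dTheta (fun c _ => D_bound c); rewrite subr0.
have p0 : 0 <= pi / 2 :> R by rewrite divr_ge0// pi_ge0.
rewrite (ger0_norm p0) => /le_trans; apply; rewrite mulrC ler_wpM2r//.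
  by apply: le_trans (D_bound 0).

exact: ltW (pihalf_lt2 R).
Qed.

End interpolation.

(** * The finite-dimensional bound *)

Section distribution_functions.
Context {d : measure_display} {T : measurableType d} {R : realType} (P : probability T R).

Lemma measurable_le_set (f : T -> R) c : measurable_fun [set: T] f ->
  measurable [set w | f w <= c].
Proof.
move=> mf; have := mf measurableT _ (measurable_itv `]-oo, c]); rewrite setTI.
by congr measurable; apply/seteqP; split => w /=; rewrite in_itv.
Qed.

Lemma measurable_lt_set (f : T -> R) c : measurable_fun [set: T] f ->
  measurable [set w | c < f w].
Proof.
move=> mf; have := mf measurableT _ (measurable_itv `]c, +oo[); rewrite setTI.
by congr measurable; apply/seteqP; split => w /=; rewrite in_itv/= andbT.
Qed.

(** Events are boolean functions, so that union bounds and sandwich arguments reduce to pointwise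
    inequalities between reals. *)
Definition prb (b : T -> bool) : R := Ex P (fun w => (b w)%:R).

Lemma prbE (b : T -> bool) : measurable [set w | b w] -> fine (P [set w | b w]) = prb b.
Proof.
move=> mb; rewrite prob_Ex//; apply: eq_Ex => w.
by rewrite indicE; case: (boolP (b w)) => bw; [rewrite mem_set|rewrite memNset //; exact/negP].
Qed.

Lemma intg_prb (b : T -> bool) : measurable [set w | b w] -> intg P (fun w => (b w)%:R).
Proof.
move=> mb; apply: (eq_intg _ (intg_indic P mb)) => w.
by rewrite indicE; case: (boolP (b w)) => bw; [rewrite mem_set|rewrite memNset //; exact/negP].
Qed.

Lemma prb_ge0 b : 0 <= prb b.
Proof. by apply: Ex_ge0. Qed.

Lemma prb_le1 (b : T -> bool) : measurable [set w | b w] -> prb b <= 1.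
Proof.
move=> mb; rewrite -[leRHS](Ex_cst P); apply: le_Ex; [exact: intg_prb|exact: intg_cst|].
by move=> w; case: (b w).
Qed.

Lemma le_prb2 (b c e : T -> bool) : measurable [set w | b w] -> measurable [set w | c w] ->
  measurable [set w | e w] -> (forall w, b w -> c w || e w) -> prb b <= prb c + prb e.
Proof.
move=> mb mc me bce; rewrite -ExD; try exact: intg_prb.
apply: le_Ex; [exact: intg_prb|by apply: intgD; exact: intg_prb|].
move=> w; have := bce w; case: (b w) => [/(_ isT)|_]; last by rewrite addr_ge0.
by case: (c w) => /= [_|->]; rewrite ?lerDl ?lerDr.
Qed.

Lemma le_prb (b c : T -> bool) : measurable [set w | b w] -> measurable [set w | c w] ->
  (forall w, b w -> c w) -> prb b <= prb c.
Proof.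
move=> mb mc bc; apply: le_Ex; [exact: intg_prb|exact: intg_prb|].
by move=> w; have := bc w; case: (b w) => // /(_ isT) ->.
Qed.

End distribution_functions.

Section finite_dimensional.
Variable R : realType.
Local Notation gam := (@gam R).
Local Notation b := (@bump_cst R).
Local Notation p := (@normal_peak R 1).

(* 608 = 2 * 12 * 4 + 8 * 4 ^ 3, from [cr3] with [r = 4 sqrt A] and [B eps <= 2 A]. *)
Definition core_M : R := 608 * b.
(** 64 is [2 * 4 * 8]: the bound 2 on the length of the path, the constant 4 of [approx_ibp] and the
    8 of [kappa_bound]. The second summand is the constant of [chi_square_stein] for [K = b]. *)
Definition core_C1 : R := 64 * core_M + 4 * (@stein_cst R + 12 + 40 * b).
(** The [8 * p] is [4 * p] for moving a level by [4 * eps] in the normal distribution function, and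
    [4 * p] for the levels beyond [A / B]. *)
Definition core_C3 : R := core_C1 + 8 * p.
Definition core_K : R := 1 + core_C3 + p.

Let b0 : 0 <= b. Proof. exact: bump_cst_ge0. Qed.
Let p0 : 0 <= p. Proof. exact: normal_peak_ge0. Qed.
Let st0 : 0 <= @stein_cst R. Proof. exact: le_trans ler01 (@stein_cst_ge1 R). Qed.

Lemma core_M_ge0 : 0 <= core_M.
Proof. by have := b0; rewrite /core_M; lra. Qed.

Lemma core_C1_ge0 : 0 <= core_C1.
Proof.
have := b0; have := st0; rewrite /core_C1 /core_M; lra.
Qed.

Lemma core_C3_ge0 : 0 <= core_C3.
Proof. by rewrite addr_ge0 ?core_C1_ge0// mulr_ge0. Qed.

Lemma core_K_ge1 : 1 <= core_K.
Proof. by rewrite /core_K -addrA lerDl addr_ge0// core_C3_ge0. Qed.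

Context {d : measure_display} {T : measurableType d} (P : probability T R).
Variables (I J : finType) (X : I -> J -> T -> R) (q : R) (lam : J -> R).
Hypothesis q23 : 2 < q <= 3.
Hypothesis mX : forall i j, measurable_fun [set: T] (X i j).
Hypothesis Xq : forall i, intg P (fun w => nr (X i ^~ w) `^ q).
Hypothesis X0 : forall i j, Ex P (X i j) = 0.
Hypothesis lam0 : forall j, 0 <= lam j.
Hypothesis cov : forall j k, \sum_i Ex P (fun w => X i j w * X i k w) = lam j * (j == k)%:R.
Hypothesis indX : forall i, indep_from P X i.
Hypothesis lam_pos : 0 < \sum_j lam j.

Let A := \sum_j lam j.
Let B := Num.sqrt (2 * \sum_j lam j ^+ 2).
Let rho := \sum_j (lam j / B) ^+ 3.
Let mq := \sum_i Ex P (fun w => nr (X i ^~ w) `^ q).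
Let L := A ^+ 3 / B ^+ 3 * (mq / A `^ (q / 2)).
Let S w := nr (Zsum X w) ^+ 2.

Let B2 : B ^+ 2 = 2 * \sum_j lam j ^+ 2.
Proof. by rewrite sqr_sqrtr// mulr_ge0// sumr_ge0// => j _; exact: sqr_ge0. Qed.

Let B0 : 0 < B.
Proof.
rewrite sqrtr_gt0 pmulr_rgt0// lt_neqAle sumr_ge0 ?andbT => [|j _]; last exact: sqr_ge0.
apply/eqP => /esym s0; move: lam_pos; rewrite big1 ?ltxx// => j _.
have : lam j ^+ 2 <= 0.
  by rewrite -s0 (bigD1 j)//= lerDl sumr_ge0// => k _; exact: sqr_ge0.
by move=> l0; apply/eqP; rewrite -sqrf_eq0 eq_le l0 sqr_ge0.
Qed.

Let lam_leA j : lam j <= A.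
Proof. by rewrite /A (bigD1 j)//= lerDl sumr_ge0. Qed.

Let BA : B <= 2 * A.
Proof.
have A0 : 0 <= A by exact: ltW.
rewrite -(@ler_pXn2r _ 2)// ?nnegrE ?mulr_ge0 ?(ltW B0)// B2 exprMn.
have : \sum_j lam j ^+ 2 <= A ^+ 2.
  rewrite expr2 {1}/A mulr_suml; apply: ler_sum => j _.
  by rewrite expr2 ler_wpM2l.
by have := sqr_ge0 A; lra.
Qed.

Let rhoE : rho * B ^+ 3 = \sum_j lam j ^+ 3.
Proof.
rewrite /rho mulr_suml; apply: eq_bigr => j _.
by rewrite expr_div_n divfK// expf_neq0// gt_eqF.
Qed.

Let BA_rho : B / A <= 4 * rho.
Proof.
(* Cauchy-Schwarz for [sqrt lam] and [lam sqrt lam]. *)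
have CS : (\sum_j lam j ^+ 2) ^+ 2 <= A * \sum_j lam j ^+ 3.
  pose u j := Num.sqrt (lam j); pose v j := lam j * Num.sqrt (lam j).
  have := cauchy_schwarz u v.
  have -> : ip u v = \sum_j lam j ^+ 2.
    by apply: eq_bigr => j _; rewrite mulrCA -expr2 sqr_sqrtr// expr2.
  move=> H; have s0 : 0 <= \sum_j lam j ^+ 2 by apply: sumr_ge0 => j _; exact: sqr_ge0.
  rewrite (ger0_norm s0) in H.
  have := H; rewrite -(@ler_pXn2r _ 2) ?nnegrE ?mulr_ge0 ?nr_ge0// => /le_trans; apply.
  rewrite exprMn !nr_sqr le_eqVlt; apply/orP; left; apply/eqP; congr (_ * _).
    by apply: eq_bigr => j _; rewrite -expr2 sqr_sqrtr.
  apply: eq_bigr => j _; rewrite mulrACA -[X in _ * X]expr2 sqr_sqrtr//; ring.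
rewrite ler_pdivrMr//.
have : B ^+ 2 * B ^+ 2 <= 4 * (A * (rho * B ^+ 3)).
  by rewrite B2 rhoE; move: CS; rewrite expr2; lra.
have -> : B ^+ 2 * B ^+ 2 = B * B ^+ 3 by ring.
have -> : 4 * (A * (rho * B ^+ 3)) = (4 * rho * A) * B ^+ 3 by ring.
by rewrite ler_pM2r// exprn_gt0.
Qed.

Let rho0 : 0 < rho.
Proof.
have : 0 < B / A by rewrite divr_gt0.
by have := BA_rho; lra.
Qed.

Let mq0 : 0 <= mq.
Proof. by apply: sumr_ge0 => i _; apply: Ex_ge0 => w; exact: powR_ge0. Qed.

Let L0 : 0 <= L.
Proof.
by rewrite !mulr_ge0 ?invr_ge0 ?powR_ge0 ?exprn_ge0 ?(ltW B0) ?(ltW lam_pos).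
Qed.

(** The fourth root of [L] balances the smoothing error [eps] against the interpolation error
    [L / eps ^ 3]. Adding [rho] makes [eps] an admissible scale in [chi_square_stein], and keeps it
    positive when [L = 0]. *)
Let eps := L `^ (1 / 4) + rho.

Let eps0 : 0 < eps.
Proof. by rewrite ltr_wpDl// powR_ge0. Qed.

Let L_eps : L <= eps ^+ 4.
Proof.
have -> : L = (L `^ (1 / 4)) ^+ 4.
  rewrite -powR_mulrn ?powR_ge0// -powRrM (_ : 1 / 4 * 4%:R = 1) ?powRr1//.
  by field.
by rewrite lerXn2r ?nnegrE ?powR_ge0 ?(ltW eps0)// lerDl ltW.
Qed.

Let mZ j : measurable_fun [set: T] (fun w => Zsum X w j).
Proof. by apply: measurable_csum => i _; exact: mX. Qed.

Let mS : measurable_fun [set: T] S.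
Proof. by apply: measurable_funX; exact: measurable_nr. Qed.

(** The left side is [(A / B) ^ q A ^ (- q / 2) eps ^ (- q)] times the moments. The powers [q] of
    [A / B] and of [1 / eps] are replaced by cubes, which leaves [8 L / eps ^ 3], at most
    [8 eps]. *)
Lemma kappa_bound : eps <= 1 ->
  (Num.sqrt A / (B * eps)) `^ q * mq <= 8 * eps.
Proof.
move=> e1; have /andP[q2 q3] := q23.
have A0 : 0 < A by [].
have q0 : 0 <= q by lra.
have Be0 : 0 < B * eps by rewrite mulr_gt0.
have AB0 : 0 <= A / B by rewrite divr_ge0// ltW.
have sA0 : 0 < Num.sqrt A by rewrite sqrtr_gt0.
have -> : Num.sqrt A / (B * eps) = A / B * (Num.sqrt A)^-1 * eps^-1.
  rewrite -[in A / B](sqr_sqrtr (ltW A0)); field.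
  by rewrite !gt_eqF.
rewrite (powRM _ (mulr_ge0 AB0 _)) ?invr_ge0 ?sqrtr_ge0 ?(ltW eps0)//.
rewrite (powRM _ AB0) ?invr_ge0 ?sqrtr_ge0//.
have i1 : (Num.sqrt A)^-1 `^ q = (A `^ (q / 2))^-1.
  have -> : (Num.sqrt A)^-1 = A `^ (- 2^-1) by rewrite powRN powR12_sqrt// ltW.
  by rewrite -powRrM -powRN; congr (_ `^ _); field.
have i2 : eps^-1 `^ q <= (eps ^+ 3)^-1.
  have -> : eps^-1 `^ q = (eps `^ q)^-1.
    by rewrite -(powR_inv1 (ltW eps0)) -powRrM mulN1r powRN.
  rewrite lef_pV2 ?posrE ?exprn_gt0 ?powR_gt0//.
  by apply: cube_le_powR; rewrite ?(ltW eps0)//; apply/andP; split => //; lra.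
(* [B <= 2 A] bounds [A / B] below by [1 / 2]; hence when [A / B < 1] its power [q] is at most 1,
   itself at most [(2 A / B) ^ 3]. *)
have i3 : (A / B) `^ q <= 8 * (A ^+ 3 / B ^+ 3).
  rewrite -expr_div_n; have [AB1|AB1] := lerP 1 (A / B).
    apply: (@le_trans _ _ ((A / B) ^+ 3)); last by have := exprn_ge0 3 AB0; lra.
    by rewrite -powR_mulrn// ler_powR.
  have h2 : 1 <= 2 * (A / B) by rewrite mulrA ler_pdivlMr// mul1r.
  have : (A / B) `^ q <= 1.
    rewrite -(powRr0 (A / B)); apply: ger_powR => //.
    by rewrite (ltW AB1) andbT divr_gt0.
  move=> /le_trans; apply; have : 1 <= (2 * (A / B)) ^+ 3 by rewrite exprn_ege1.
  by rewrite exprMn; lra.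
rewrite i1.
have l1 : (A / B) `^ q * (A `^ (q / 2))^-1 * eps^-1 `^ q * mq <=
    8 * (A ^+ 3 / B ^+ 3) * (A `^ (q / 2))^-1 * (eps ^+ 3)^-1 * mq.
  rewrite ler_wpM2r//; apply: ler_pM => //; rewrite ?mulr_ge0 ?invr_ge0 ?powR_ge0//.
  by rewrite ler_wpM2r// invr_ge0 powR_ge0.
apply: (le_trans l1).
have -> : 8 * (A ^+ 3 / B ^+ 3) * (A `^ (q / 2))^-1 * (eps ^+ 3)^-1 * mq = 8 * (L / eps ^+ 3).
  by rewrite /L; ring.
by rewrite ler_pM2l// ler_pdivrMr ?exprn_gt0.
Qed.

Lemma smooth_comparison (t : R) : eps <= 1 -> t <= A / B ->
  exists h : R -> R, [/\ forall x, 0 <= h x <= 1, forall x, x <= t -> h x = 1,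
    forall x, t + 4 * eps <= x -> h x = 0, continuous h &
    `|Ex P (fun w => h ((S w - A) / B)) - Ex gam h| <= core_C1 * eps].
Proof.
move=> e1 tAB; have A0 : 0 < A by [].
have [h [h1 [h2 [h3 [dh dh1 dh2 [ch1 ch2 ch3] [h01 hle hge h1le [b1 b2 b3]]]]]]] :=
  smooth_step t eps0.
have ch : continuous h by exact: der_continuous dh.
exists h; split => // [x /hge[]//|].
pose G := gspace_fin R J.
pose r := 4 * Num.sqrt A; pose kap := Num.sqrt A / (B * eps).
have sA0 : 0 < Num.sqrt A by rewrite sqrtr_gt0.
have sA2 : Num.sqrt A ^+ 2 = A by rewrite sqr_sqrtr// ltW.
have r0 : 0 <= r by rewrite mulr_ge0// ltW.
have kap0 : 0 < kap by rewrite divr_gt0// mulr_gt0.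
have Bi : 0 < B^-1 by rewrite invr_gt0.
have ei : 0 < eps^-1 by rewrite invr_gt0.
(* Outside the ball [|u| ^ 2 - A] exceeds [15 A], whereas [(t + 4 eps) B <= A + 4 B <= 9 A]. *)
have supp (u : J -> R) : r < nr u ->
    [/\ h1 (lvl A B u) = 0, h2 (lvl A B u) = 0 & h3 (lvl A B u) = 0].
  move=> ru; suff /hge[] : t + 4 * eps <= lvl A B u by [].
  have : r ^+ 2 <= ip u u by rewrite -nr_sqr lerXn2r ?nnegrE ?nr_ge0// ltW.
  rewrite /r exprMn sA2 /lvl ler_pdivlMr// => H.
  have h4 : eps * B <= B by rewrite ler_piMl// ltW.
  have : t * B <= A by rewrite -ler_pdivlMr.
  by have := BA; lra.
(* [B eps <= 2 A] absorbs the lower order term into the leading one. The same happens for [c3],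
   where 608 is attained as [48 * 2 + 512]. *)
have c2 : 2 * cr2 B r (b / eps) (b / eps ^+ 2) <= core_M * kap ^+ 2.
  have -> : core_M * kap ^+ 2 = 608 * (b * (A * B^-1 ^+ 2 * eps^-1 ^+ 2)).
    by rewrite /core_M /kap expr_div_n sA2; field; rewrite !gt_eqF.
  have -> : 2 * cr2 B r (b / eps) (b / eps ^+ 2) =
      4 * (b * (B^-1 ^+ 2 * eps^-1 ^+ 2 * (B * eps))) + 128 * (b * (A * B^-1 ^+ 2 * eps^-1 ^+ 2)).
    rewrite /cr2 /r exprMn sA2; field; by rewrite !gt_eqF.
  have k0 : 0 <= B^-1 ^+ 2 * eps^-1 ^+ 2 by rewrite mulr_ge0// sqr_ge0.
  have : B^-1 ^+ 2 * eps^-1 ^+ 2 * (B * eps) <= B^-1 ^+ 2 * eps^-1 ^+ 2 * (2 * A).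
    rewrite ler_wpM2l//; apply: le_trans BA; by rewrite ler_piMr// ltW.
  move=> /(ler_wpM2l b0); have : 0 <= b * (A * B^-1 ^+ 2 * eps^-1 ^+ 2).
    by rewrite mulr_ge0// -mulrA mulr_ge0// ltW.
  lra.
have c3 : cr3 B r (b / eps ^+ 2) (b / eps ^+ 3) <= core_M * kap ^+ 3.
  have A32 : Num.sqrt A ^+ 3 = A * Num.sqrt A by rewrite exprSr sA2.
  have -> : core_M * kap ^+ 3 = 608 * (b * (Num.sqrt A * A * B^-1 ^+ 3 * eps^-1 ^+ 3)).
    by rewrite /core_M /kap expr_div_n A32; field; rewrite !gt_eqF.
  have -> : cr3 B r (b / eps ^+ 2) (b / eps ^+ 3) =
      48 * (b * (Num.sqrt A * B^-1 ^+ 3 * eps^-1 ^+ 3 * (B * eps))) +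
      512 * (b * (Num.sqrt A * A * B^-1 ^+ 3 * eps^-1 ^+ 3)).
    rewrite /cr3 /r exprMn A32; field; by rewrite !gt_eqF.
  have k0 : 0 <= Num.sqrt A * B^-1 ^+ 3 * eps^-1 ^+ 3.
    by rewrite !mulr_ge0 ?exprn_ge0 ?(ltW sA0) ?(ltW Bi) ?(ltW ei).
  have : Num.sqrt A * B^-1 ^+ 3 * eps^-1 ^+ 3 * (B * eps) <=
      Num.sqrt A * B^-1 ^+ 3 * eps^-1 ^+ 3 * (2 * A).
    rewrite ler_wpM2l//; apply: le_trans BA; by rewrite ler_piMr// ltW.
  move=> /(ler_wpM2l b0); have : 0 <= b * (Num.sqrt A * B^-1 ^+ 3 * eps^-1 ^+ 3 * A).
    by rewrite mulr_ge0// mulr_ge0// ltW.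
  lra.
have M0 : 0 <= core_M by exact: core_M_ge0.
have H1 := interpolation_bound G q23 mX Xq X0 lam0 cov indX B0 r0 dh dh1 dh2 b1 b2 b3 h01
  supp M0 kap0 c2 c3.
have mu0 j : 0 <= lam j / B by rewrite divr_ge0// ltW.
have mu2 : 2 * \sum_j (lam j / B) ^+ 2 = 1.
  under eq_bigr do rewrite expr_div_n.
  by rewrite -mulr_suml mulrA -B2 divff// expf_neq0// gt_eqF.
have rho_eps : \sum_j (lam j / B) ^+ 3 <= eps by rewrite lerDr powR_ge0.
have H2 := chi_square_stein G mu0 mu2 dh ch1 h01 h1le eps0 b0 b1 rho_eps.
have EV : Ex (gs_prob G) (fun w => radial A B h (gvec lam w)) =
    Ex (gs_prob G) (fun w => h (quad (fun j => lam j / B) w)).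
  apply: eq_Ex => w; congr h; rewrite /lvl /quad /ip /A -sumrB mulr_suml.
  apply: eq_bigr => j _; rewrite -expr2 exprMn sqr_sqrtr//; ring.
have ES : Ex P (fun w => radial A B h (Zsum X w)) = Ex P (fun w => h ((S w - A) / B)).
  by apply: eq_Ex => w; rewrite /radial /lvl -nr_sqr.
rewrite EV ES in H1.
have HK := kappa_bound e1; rewrite -/kap in HK.
rewrite -/mq in H1; rewrite -/rho in H2.
set u1 := Ex P _ in H1 *; set u2 := Ex (gs_prob G) _ in H1 H2 *; set u3 := Ex gam h in H2 *.
have -> : u1 - u3 = (u1 - u2) + (u2 - u3) by ring.
apply: le_trans (ler_normD _ _) _.
have : 2 * (4 * core_M * kap `^ q * mq) <= 64 * core_M * eps.
  have := ler_wpM2l M0 HK; lra.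
have s1 : 0 <= 4 * (@stein_cst R + 12 + 40 * b) by have := b0; have := st0; lra.
have re : rho <= eps by [].
have := ler_wpM2l s1 re.
by rewrite [core_C1 * eps]mulrDl; lra.
Qed.

Let FS t := prb P (fun w => (S w - A) / B <= t).

Let mFS t : measurable [set w | (S w - A) / B <= t].
Proof.
apply: measurable_le_set; apply: measurable_funM => //; exact: measurable_funB.
Qed.

Let h_intg (h : R -> R) : continuous h -> (forall x, 0 <= h x <= 1) ->
  intg P (fun w => h ((S w - A) / B)) /\ intg gam h.
Proof.
move=> ch h01; split; apply: (@bounded_intg _ _ _ _ _ 1).
- apply: measurableT_comp; first exact: continuous_measurable_fun.
  by apply: measurable_funM => //; exact: measurable_funB.
- by move=> w; have /andP[? ?] := h01 ((S w - A) / B); rewrite ger0_norm.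
- exact: continuous_measurable_fun.
- by move=> w; have /andP[? ?] := h01 w; rewrite ger0_norm.
Qed.

(** The indicator of the half-line ending at [t] lies between the smooth steps that start at
    [t - 4 eps] and at [t]; the shift of [Phi] by [4 eps] costs its Lipschitz constant. *)
Let FS_low t : eps <= 1 -> t <= A / B -> `|FS t - Phi t| <= (core_C1 + 4 * p) * eps.
Proof.
move=> e1 tAB; rewrite ler_norml; apply/andP; split.
  have tAB' : t - 4 * eps <= A / B by rewrite (le_trans _ tAB)// gerBl mulr_ge0// ltW.
  have [h [h01 hle hge ch H]] := smooth_comparison e1 tAB'.
  have [i1 i2] := h_intg ch h01.
  have u1 : Ex P (fun w => h ((S w - A) / B)) <= FS t.
    apply: le_Ex => //; first exact: intg_prb.
    move=> w; have [wt|wt] := lerP ((S w - A) / B) t; first by have /andP[] := h01 ((S w - A) / B).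
    by rewrite hge// subrK ltW.
  have u2 : Phi (t - 4 * eps) <= Ex gam h.
    apply: le_Ex => //; first exact: intg_below1.
    move=> x; rewrite belowE; have [xt|xt] := lerP x (t - 4 * eps); first by rewrite hle.
    by have /andP[] := h01 x.
  have := Phi_lipschitz (t - 4 * eps) t; rewrite subKr.
  rewrite (ger0_norm (mulr_ge0 _ (ltW eps0)))// => u3.
  move: H u3; rewrite !ler_norml => /andP[H3 H4] /andP[H5 H6]; lra.
have [h [h01 hle hge ch H]] := smooth_comparison e1 tAB.
have [i1 i2] := h_intg ch h01.
have u1 : FS t <= Ex P (fun w => h ((S w - A) / B)).
  apply: le_Ex => //; first exact: intg_prb.
  move=> w; have [wt|wt] := lerP ((S w - A) / B) t; first by rewrite hle.
  by have /andP[] := h01 ((S w - A) / B).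
have u2 : Ex gam h <= Phi (t + 4 * eps).
  apply: le_Ex => //; first exact: intg_below1.
  move=> x; rewrite belowE; have [xt|xt] := lerP x (t + 4 * eps); first by have /andP[] := h01 x.
  by rewrite hge// ltW.
have := Phi_lipschitz t (t + 4 * eps); rewrite [t + _ - t]addrAC subrr add0r.
rewrite (ger0_norm (mulr_ge0 _ (ltW eps0)))// => u3.
move: H u3; rewrite !ler_norml => /andP[H3 H4] /andP[H5 H6]; lra.
Qed.

(** Beyond [A / B], both distribution functions lie between their value at [A / B] and 1, and
    [1 - Phi (A / B)] is at most [p B / A <= 4 p rho] by Mills' inequality. *)
Let FS_bound t : eps <= 1 -> `|FS t - Phi t| <= core_C3 * eps.
Proof.
move=> e1; have ep := mulr_ge0 p0 (ltW eps0).
have C3E : core_C3 * eps = (core_C1 + 4 * p) * eps + 4 * (p * eps) by rewrite /core_C3; ring.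
have [tAB|tAB] := lerP t (A / B).
  by apply: (le_trans (FS_low e1 tAB)); rewrite C3E; lra.
have := FS_low e1 (lexx (A / B)).
have F1 : FS (A / B) <= FS t.
  by apply: le_prb => // w wAB; apply: le_trans (ltW tAB).
have F2 : FS t <= 1 by exact: prb_le1.
have P1 := Phi_le (ltW tAB); have P2 := Phi_le1 t.
have A0 : 0 < A by [].
have : 1 - Phi (A / B) <= 4 * (p * eps).
  have m1 := le_trans (mills_right (A / B)) (gpdf_ub _).
  have m2 : 1 - Phi (A / B) <= p * (B / A).
    rewrite mulrA ler_pdivlMr// -ler_pdivrMr//.
    by apply: le_trans m1; rewrite le_eqVlt; apply/orP; left; apply/eqP; field; rewrite gt_eqF.
  apply: (le_trans m2); rewrite [4 * (p * eps)]mulrCA; apply: (ler_wpM2l p0); apply: (le_trans BA_rho).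
  by rewrite ler_pM2l// lerDr powR_ge0.
rewrite !ler_norml C3E => m3 /andP[m4 m5]; apply/andP; split; lra.
Qed.

Lemma finite_dimensional_bound (V : T -> R) (u x : R) : measurable_fun [set: T] V -> 0 < u ->
  `|prb P (fun w => V w <= A + B * x) - Phi x| <=
  core_K * (eps + prb P (fun w => u < `|V w - S w|) + u / B).
Proof.
move=> mV u0.
have mVS : measurable_fun [set: T] (fun w => `|V w - S w|).
  by apply: measurableT_comp => //; exact: measurable_funB.
have mD : measurable [set w | u < `|V w - S w|] by exact: measurable_lt_set.
have mVx : measurable [set w | V w <= A + B * x] by exact: measurable_le_set.
have D0 := prb_ge0 P (fun w => u < `|V w - S w|).
have uB : 0 < u / B by rewrite divr_gt0.
have K1 := core_K_ge1; have C30 := core_C3_ge0.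
have V1 := prb_le1 P mVx; have V0 := prb_ge0 P (fun w => V w <= A + B * x).
(* For [eps > 1] the bound exceeds 1, since [core_K >= 1]. *)
have [e1|e1] := lerP eps 1; last first.
  apply: (@le_trans _ _ 1).
    by have := Phi_ge0 x; have := Phi_le1 x; rewrite ler_norml => ? ?; apply/andP; split; lra.
  rewrite -[leLHS]mul1r; apply: ler_pM => //; lra.
have up : prb P (fun w => V w <= A + B * x) <=
    FS (x + u / B) + prb P (fun w => u < `|V w - S w|).
  apply: le_prb2 => // w wV; have [/ltW|du] := ltP u `|V w - S w|; first by rewrite orbT.
  rewrite orbF ler_pdivrMr// mulrDl divfK ?gt_eqF//.
  by have := ler_norm (S w - V w); rewrite distrC; lra.
have lo : FS (x - u / B) <=
    prb P (fun w => V w <= A + B * x) + prb P (fun w => u < `|V w - S w|).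
  apply: le_prb2 => // w wS; have [/ltW|du] := ltP u `|V w - S w|; first by rewrite orbT.
  rewrite orbF; move: wS; rewrite ler_pdivrMr// mulrBl divfK ?gt_eqF//.
  by have := ler_norm (V w - S w); lra.
have F1 := FS_bound (x + u / B) e1; have F2 := FS_bound (x - u / B) e1.
have P1 := Phi_lipschitz x (x + u / B); rewrite [x + _ - x]addrAC subrr add0r (gtr0_norm uB) in P1.
have P2 := Phi_lipschitz (x - u / B) x; rewrite subKr (gtr0_norm uB) in P2.
have k1 : core_C3 * eps <= core_K * eps by rewrite ler_pM2r// /core_K; have := p0; lra.
have k2 : p * (u / B) <= core_K * (u / B) by rewrite ler_pM2r// /core_K; lra.
have k3 : prb P (fun w => u < `|V w - S w|) <= core_K * prb P (fun w => u < `|V w - S w|).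
  by rewrite ler_peMl.
rewrite 2!(mulrDr core_K); move: F1 F2 P1 P2; rewrite !ler_norml.
move=> /andP[a1 a2] /andP[a3 a4] /andP[a5 a6] /andP[a7 a8]; apply/andP; split; lra.
Qed.

End finite_dimensional.

(** * Hilbert spaces *)

Section quadratic.
Variable R : realType.

Lemma quadratic_eq0 (a c : R) : 0 <= a -> (forall t, 0 <= t ^+ 2 * a + 2 * t * c) -> c = 0.
Proof.
move=> a0 H; have a1 : 0 < a + 1 by rewrite ltr_wpDl.
(* [a + 1] instead of [a], so that the choice makes sense for [a = 0] too. *)
have := H (- (c / (a + 1))).
have -> : (- (c / (a + 1))) ^+ 2 * a + 2 * - (c / (a + 1)) * c =
    - ((c / (a + 1)) ^+ 2 * (a + 2)) by field; rewrite gt_eqF.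
rewrite oppr_ge0 pmulr_lle0 ?ltr_wpDl// => H2; apply/eqP.
have : (c / (a + 1)) ^+ 2 == 0 by rewrite eq_le H2 sqr_ge0.
by rewrite sqrf_eq0 mulf_eq0 invr_eq0 (gt_eqF a1) orbF.
Qed.

Lemma quadratic_discr (a c e : R) : 0 <= a -> 0 <= e ->
  (forall s t, 0 <= s ^+ 2 * a + 2 * s * t * c + t ^+ 2 * e) -> c ^+ 2 <= a * e.
Proof.
move=> a0 e0 H; have [a_eq|aN] := eqVneq a 0.
  suff -> : c = 0 by rewrite expr0n/= mulr_ge0.
  apply: (@quadratic_eq0 e) => // t; have := H 1 t; rewrite a_eq; lra.
have := H c (- a).
have -> : c ^+ 2 * a + 2 * c * - a * c + (- a) ^+ 2 * e = a * (a * e - c ^+ 2) by ring.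
by rewrite pmulr_rge0 ?subr_ge0// lt_neqAle eq_sym aN.
Qed.

End quadratic.

Section hilbert.
Context {R : realType} {H : completeNormedModType R} (dot : {dot H for idfun}).
Hypothesis dotE : hilbert_dot dot.

Lemma dotC x y : dot x y = dot y x.
Proof. by rewrite hermC/= expr0 mul1r. Qed.

Lemma dotDl x y z : dot (x + y) z = dot x z + dot y z.
Proof. exact: linearDl. Qed.

Lemma dotDr x y z : dot x (y + z) = dot x y + dot x z.
Proof. by rewrite dotC dotDl !(dotC x). Qed.

Lemma dotZl a x y : dot (a *: x) y = a * dot x y.
Proof. exact: linearZl_LR. Qed.

Lemma dotZr a x y : dot x (a *: y) = a * dot x y.
Proof. by rewrite dotC dotZl dotC. Qed.

Lemma dot0l x : dot 0 x = 0.
Proof. exact: linear0l. Qed.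

Lemma dot0r x : dot x 0 = 0.
Proof. by rewrite dotC dot0l. Qed.

Lemma dotNl x y : dot (- x) y = - dot x y.
Proof. exact: linearNl. Qed.

Lemma dotNr x y : dot x (- y) = - dot x y.
Proof. by rewrite dotC dotNl dotC. Qed.

Lemma dotBl x y z : dot (x - y) z = dot x z - dot y z.
Proof. by rewrite dotDl dotNl. Qed.

Lemma dotBr x y z : dot x (y - z) = dot x y - dot x z.
Proof. by rewrite dotDr dotNr. Qed.

Lemma dot_suml (I : Type) (r : seq I) (Q : pred I) (F : I -> H) y :
  dot (\sum_(i <- r | Q i) F i) y = \sum_(i <- r | Q i) dot (F i) y.
Proof. by elim/big_rec2: _ => [|i u v _ <-]; rewrite ?dot0l ?dotDl. Qed.

Lemma dot_sumr (I : Type) (r : seq I) (Q : pred I) (F : I -> H) y :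
  dot y (\sum_(i <- r | Q i) F i) = \sum_(i <- r | Q i) dot y (F i).
Proof. by rewrite dotC dot_suml; apply: eq_bigr => i _; rewrite dotC. Qed.

Lemma dot_ge0 x : 0 <= dot x x.
Proof. by rewrite dotE sqr_ge0. Qed.

Lemma dot_eq0 x : (forall y, dot x y = 0) -> x = 0.
Proof. by move=> /(_ x); rewrite dotE => /eqP; rewrite sqrf_eq0 normr_eq0 => /eqP. Qed.

Lemma dot_inj x y : (forall z, dot x z = dot y z) -> x = y.
Proof.
by move=> xy; apply/eqP; rewrite -subr_eq0; apply/eqP/dot_eq0 => z; rewrite dotBl xy subrr.
Qed.

Lemma dot_norm x y : `|dot x y| <= `|x| * `|y|.
Proof.
rewrite -(@ler_pXn2r _ 2) ?nnegrE ?mulr_ge0// real_normK ?num_real// exprMn -!dotE.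
apply: quadratic_discr => [||s t]; try exact: dot_ge0.
have := dot_ge0 (s *: x + t *: y).
by rewrite !(dotDl, dotDr, dotZl, dotZr) (dotC y x); lra.
Qed.

Lemma lipschitz_continuous (f : H -> R) M :
  (forall x y, `|f x - f y| <= M * `|x - y|) -> continuous f.
Proof.
move=> fM x; apply/(@cvgrPdist_le _ R^o) => e e0; near=> z.
apply: (le_trans (fM _ _)); apply: (@le_trans _ _ (`|M| * `|x - z|)).
  by rewrite ler_wpM2r// ler_norm.
have : `|x - z| <= e / (`|M| + 1).
  near: z; apply: cvgr_dist_le; last by rewrite divr_gt0// ltr_wpDl.
  exact: cvg_id.
rewrite ler_pdivlMr ?ltr_wpDl// mulrC; apply: le_trans.
by rewrite ler_wpM2r// lerDl.
Unshelve. all: by end_near. Qed.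

Lemma dot_continuousl y : continuous (fun x => dot x y).
Proof.
apply: (@lipschitz_continuous _ `|y|) => x z; rewrite -dotBl mulrC; exact: dot_norm.
Qed.

Lemma psd_cauchy_schwarz (L : H -> H) : (forall x y, dot (L x) y = dot x (L y)) ->
  (forall x, 0 <= dot (L x) x) -> forall x y,
  dot (L x) y ^+ 2 <= dot (L x) x * dot (L y) y.
Proof.
move=> Ls Lp x y; apply: quadratic_discr => // s t.
have := Lp (s *: x + t *: y); rewrite Ls !(dotDl, dotZl) -!Ls !(dotDr, dotZr).
by rewrite (Ls y x) (dotC y (L x)); lra.
Qed.

Section riesz.
Variables (phi : H -> R) (M : R).
Hypothesis phi_lin : forall a x y, phi (a *: x + y) = a * phi x + phi y.
Hypothesis phiM : forall x, `|phi x| <= M * `|x|.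

Let Jf v := dot v v - 2 * phi v.

Let phi0 : phi 0 = 0.
Proof. by have := phiM 0; rewrite normr0 mulr0 normr_le0 => /eqP. Qed.

Let phiD x y : phi (x + y) = phi x + phi y.
Proof. by have := phi_lin 1 x y; rewrite scale1r mul1r. Qed.

Let phiZ a x : phi (a *: x) = a * phi x.
Proof. by have := phi_lin a x 0; rewrite phi0 !addr0. Qed.

Let Jf_ge v : - M ^+ 2 <= Jf v.
Proof.
have := phiM v; rewrite ler_norml => /andP[_ h]; rewrite /Jf dotE.
have := sqr_ge0 (`|v| - M); rewrite sqrrB; lra.
Qed.

(** [Jf] is minimized: the parallelogram identity makes minimizing sequences Cauchy, and the first
    variation at their limit is the representation. This is what makes weakly defined expectations
    exist as vectors. *)
Lemma riesz : exists m, forall v, phi v = dot m v.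
Proof.
pose E := [set Jf v | v in [set: H]].
have iE : has_inf E.
  by split; [exists (Jf 0), 0|exists (- M ^+ 2) => _ [v _ <-]; exact: Jf_ge].
pose j := inf E.
have jle v : j <= Jf v by apply: ge_inf; [exact: iE.2|exists v].
have ex k : exists v, Jf v < j + k.+1%:R^-1.
  have k0 : (0 : R) < k.+1%:R^-1 by rewrite invr_gt0 ltr0n.
  by have [_ [v _ <-] ?] := inf_adherent k0 iE; exists v.
have [v vP] := choice ex.
have par x y : `|x - y| ^+ 2 <= 2 * (Jf x - j) + 2 * (Jf y - j).
  have := jle (2^-1 *: (x + y)).
  rewrite -dotE /Jf phiZ phiD !(dotBl, dotBr, dotZl, dotZr, dotDl, dotDr) (dotC y x).
  lra.
have : cvg (v @ \oo).
  apply: cauchy_cvg; apply: cauchy_exP => e e0.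
  have e8 : 0 < e ^+ 2 / 8 by rewrite divr_gt0// exprn_gt0.
  have [N _ NP] := near_infty_natSinv_lt (PosNum e8).
  exists (v N), N => // m Nm; rewrite /= -ball_normE /ball_/=.
  rewrite -(@ltr_pXn2r _ 2) ?nnegrE ?(ltW e0)//.
  apply: (le_lt_trans (par _ _)).
  have h1 : N.+1%:R^-1 < e ^+ 2 / 8 by exact: NP N (leqnn N).
  have h2 : m.+1%:R^-1 < e ^+ 2 / 8 by exact: NP m Nm.
  have h3 : Jf (v N) < j + e ^+ 2 / 8 by apply: (lt_trans (vP N)); rewrite ltrD2l.
  have h4 : Jf (v m) < j + e ^+ 2 / 8 by apply: (lt_trans (vP m)); rewrite ltrD2l.
  have := exprn_gt0 2 e0; lra.
move=> /cvg_ex[/= m vm]; exists m => w; apply/eqP; rewrite eq_sym -subr_eq0; apply/eqP.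
(* Almost minimality of [v k], tested against [v k + t w], is a quadratic inequality in [t] up to
   [1 / (k + 1)], in which [k] tends to infinity. *)
apply: (@quadratic_eq0 _ (dot w w)); first exact: dot_ge0.
move=> t.
have cw : (fun k => t ^+ 2 * dot w w + 2 * t * (dot (v k) w - phi w)) @ \oo -->
    t ^+ 2 * dot w w + 2 * t * (dot m w - phi w).
  apply: cvgD; first exact: cvg_cst.
  apply: cvgM; first exact: cvg_cst.
  apply: cvgB; last exact: cvg_cst.
  exact: (cvg_comp _ _ vm (@dot_continuousl w m)).
have ch : (fun k => - (k.+1%:R^-1 : R)) @ \oo --> (0 : R).
  by rewrite -oppr0; apply: cvgN; exact: cvg_harmonic.
apply: (ler_cvg_to ch cw); near=> k.
have := jle (v k + t *: w); have := vP k; move: (k.+1%:R^-1 : R) => z.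
rewrite /Jf phiD phiZ !(dotDl, dotDr, dotZl, dotZr) (dotC w (v k)); lra.
Unshelve. all: by end_near. Qed.

End riesz.

End hilbert.

(** * Gram-Schmidt orthonormalization and Parseval's identity *)

Section gram_schmidt.
Context {R : realType} {H : completeNormedModType R} (dot : {dot H for idfun}).
Hypothesis dotE : hilbert_dot dot.

(** A Parseval sequence instead of an orthonormal basis: zero vectors are allowed, so that finite
    dimension and redundant dense sequences need no separate treatment. *)
Definition parseval (b : nat -> H) := forall x,
  (fun K => \sum_(k < K) dot x (b k) ^+ 2) @ \oo --> dot x x.

Definition proj (s : seq H) (x : H) : H := \sum_(v <- s) dot x v *: v.

Lemma proj_rcons s v x : proj (rcons s v) x = proj s x + dot x v *: v.
Proof. by rewrite /proj -cats1 big_cat big_seq1. Qed.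

Lemma proj_sym s x y : dot (proj s x) y = dot x (proj s y).
Proof.
rewrite dot_suml dot_sumr; apply: eq_bigr => v _.
by rewrite dotZl dotZr (dotC dot v) mulrC.
Qed.

Lemma projD s x y : proj s (x + y) = proj s x + proj s y.
Proof. by apply: (dot_inj dotE) => z; rewrite dotDl !proj_sym dotDl. Qed.

Lemma projZ s a x : proj s (a *: x) = a *: proj s x.
Proof. by apply: (dot_inj dotE) => z; rewrite dotZl !proj_sym dotZl. Qed.

Lemma projB s x y : proj s (x - y) = proj s x - proj s y.
Proof. by rewrite projD -scaleN1r projZ scaleN1r. Qed.

(** A vector in the span of its predecessors leaves a zero residual and contributes the zero vector,
    which keeps the indexing uniform. *)
Fixpoint gs (d : nat -> H) (n : nat) : seq H :=
  if n is m.+1 then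
    rcons (gs d m) (`|d m - proj (gs d m) (d m)|^-1 *: (d m - proj (gs d m) (d m)))
  else [::].

Definition gs_vec d m := `|d m - proj (gs d m) (d m)|^-1 *: (d m - proj (gs d m) (d m)).

Lemma big_gs d n (F : H -> R) : \sum_(v <- gs d n) F v = \sum_(k < n) F (gs_vec d k).
Proof.
elim: n => [|n IH]; first by rewrite big_nil big_ord0.
by rewrite big_ord_recr/= -IH -cats1 big_cat big_seq1.
Qed.

Let gs_vec_fix d m : dot (gs_vec d m) (gs_vec d m) *: gs_vec d m = gs_vec d m.
Proof.
rewrite /gs_vec; set r := d m - _; have [->|r0] := eqVneq r 0; first by rewrite !scaler0.
rewrite dotZl dotZr dotE; have n0 : `|r| != 0 by rewrite normr_eq0.
rewrite (_ : `|r|^-1 * (`|r|^-1 * `|r| ^+ 2) = 1) ?scale1r//.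
by rewrite mulrA -invfM -expr2 mulVf// sqrf_eq0.
Qed.

Let gs_vec_inv d m : dot (d m - proj (gs d m) (d m)) (gs_vec d m) *: gs_vec d m =
  d m - proj (gs d m) (d m).
Proof.
rewrite /gs_vec; set r := d m - _; have [->|r0] := eqVneq r 0; first by rewrite !scaler0.
rewrite dotZr dotE scalerA; have n0 : `|r| != 0 by rewrite normr_eq0.
rewrite (_ : `|r|^-1 * `|r| ^+ 2 * `|r|^-1 = 1) ?scale1r//.
by field.
Qed.

Let gs_ortho d m s : (forall v, v \in gs d m -> proj (gs d m) v = v) -> s = gs d m ->
  proj s (gs_vec d m) = 0.
Proof.
move=> I1 sE; rewrite /proj big1_seq// => v /=; rewrite sE => vs.
by rewrite /gs_vec dotZl dotBl proj_sym (I1 v vs) subrr mulr0 scale0r.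
Qed.

Lemma proj_gs_mem d n v : v \in gs d n -> proj (gs d n) v = v.
Proof.
elim: n v => [//|n IH] v; have b0 := gs_ortho IH erefl; rewrite /= -/(gs_vec d n).
rewrite mem_rcons inE proj_rcons => /predU1P[->|vs].
  by rewrite b0 add0r gs_vec_fix.
by rewrite IH// -{2}(IH v vs) proj_sym b0 dot0r scale0r addr0.
Qed.

Lemma proj_gs_gen d n m : (m < n)%N -> proj (gs d n) (d m) = d m.
Proof.
elim: n => [//|n IH]; have b0 := gs_ortho (@proj_gs_mem d n) erefl.
rewrite ltnS leq_eqVlt /= -/(gs_vec d n) proj_rcons => /predU1P[->|mn].
  have -> : dot (d n) (gs_vec d n) = dot (d n - proj (gs d n) (d n)) (gs_vec d n).
    by rewrite dotBl proj_sym b0 dot0r subr0.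
  by rewrite gs_vec_inv addrC subrK.
by rewrite IH// -{2}(IH mn) proj_sym b0 dot0r scale0r addr0.
Qed.

Lemma proj_gs_proj d n x : proj (gs d n) (proj (gs d n) x) = proj (gs d n) x.
Proof.
apply: (dot_inj dotE) => z; rewrite proj_sym /proj !dot_suml; apply: eq_big_seq => v vs.
by rewrite !dotZl -!/(proj _ _) -proj_sym proj_gs_mem.
Qed.

Lemma gs_pythagoras d n x :
  dot (x - proj (gs d n) x) (x - proj (gs d n) x) =
  dot x x - \sum_(k < n) dot x (gs_vec d k) ^+ 2.
Proof.
rewrite dotBl !dotBr [dot (proj _ x) (proj _ x)]proj_sym proj_gs_proj proj_sym subrr subr0.
congr (_ - _); rewrite -(big_gs _ _ (fun v => dot x v ^+ 2)) dot_sumr; apply: eq_bigr => v _.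
by rewrite dotZr expr2.
Qed.

(** A point [y] of the dense set is fixed by every projection of index beyond its code [f y], so the
    residual of [x] is that of [x - y], whose square is at most [|x - y| ^ 2 < e]. *)
Lemma parseval_ex : separable_space H -> exists b, parseval b.
Proof.
move=> [D /countable_injP[f fD] dD].
pose d n := xget 0 [set x | D x /\ f x = n].
have dP x : D x -> d (f x) = x.
  move=> Dx; have [Dy fy] : [set y | D y /\ f y = f x] (d (f x)) by apply: (@xgetI _ _ _ x).
  by apply: fD => //; rewrite inE.
exists (gs_vec d) => x; apply/cvgrPdist_lt => e e0.
have [y [/= xy /dP dy]] : ball x (Num.sqrt e) `&` D !=set0.
  apply: dD; last exact: ball_open.
  by exists x; apply: ballxx; rewrite sqrtr_gt0.
exists (f y).+1 => // K /= yK.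
rewrite -gs_pythagoras ger0_norm ?dot_ge0//.
have py : proj (gs d K) y = y by rewrite -dy proj_gs_gen.
have -> : x - proj (gs d K) x = (x - y) - proj (gs d K) (x - y).
  by rewrite projB py opprB addrA subrK.
rewrite gs_pythagoras; apply: (@le_lt_trans _ _ (dot (x - y) (x - y))).
  by rewrite gerBl sumr_ge0// => k _; exact: sqr_ge0.
move: xy; rewrite -ball_normE /ball_/= => xy.
by rewrite dotE -(sqr_sqrtr (ltW e0)) ltr_pXn2r ?nnegrE ?sqrtr_ge0.
Qed.

End gram_schmidt.

Lemma sqr_le_norm (R : realType) (a c : R) : `|a| <= c -> a ^+ 2 <= c ^+ 2.
Proof.
move=> ac; rewrite -(ger0_norm (sqr_ge0 a)) normrX lerXn2r// nnegrE.
exact: le_trans ac.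
Qed.

Lemma series_tail (R : realType) (u : nat -> R) (M e : R) : (forall k, 0 <= u k) ->
  (forall n, \sum_(k < n) u k <= M) -> 0 < e ->
  exists K, forall n, \sum_(K <= k < K + n) u k <= e.
Proof.
move=> u0 uM e0; pose S n := \sum_(k < n) u k.
have nd : nondecreasing_seq S.
  by apply/nondecreasing_seqP => n; rewrite /S big_ord_recr/= lerDl.
have cS : cvgn S by apply: nondecreasing_is_cvgn => //; exists M => _ [n _ <-]; exact: uM.
have /cvgrPdist_le/(_ _ e0)[K _ KP] := cS.
exists K => n; have := KP K (leqnn K); have := nondecreasing_cvgn_le nd cS (K + n).
rewrite ler_distlC => h1 /= /andP[h2 h3].
have -> : \sum_(K <= k < K + n) u k = S (K + n)%N - S K.
  rewrite /S -!(big_mkord xpredT u).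
  by rewrite (@big_cat_nat _ _ _ K 0 (K + n)) ?leq_addr//= addrAC subrr add0r.
lra.
Qed.

(** * Bessel's inequality for a Parseval sequence, and compactness of Hilbert cubes *)

Section parseval_sequence.
Context {R : realType} {H : completeNormedModType R} (dot : {dot H for idfun}).
Hypothesis dotE : hilbert_dot dot.
Variable b : nat -> H.
Hypothesis pb : parseval dot b.

Lemma parseval_le x n : \sum_(k < n) dot x (b k) ^+ 2 <= dot x x.
Proof.
have nd : nondecreasing_seq (fun K => \sum_(k < K) dot x (b k) ^+ 2).
  by apply/nondecreasing_seqP => K; rewrite big_ord_recr/= lerDl sqr_ge0.
rewrite -(cvg_lim (@Rhausdorff R) (@pb x)).
by apply: nondecreasing_cvgn_le => //; apply/cvg_ex; exists (dot x x).
Qed.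

Lemma parseval_vec_le1 k : dot (b k) (b k) <= 1.
Proof.
have : dot (b k) (b k) ^+ 2 <= dot (b k) (b k).
  apply: le_trans (parseval_le (b k) k.+1).
  by rewrite big_ord_recr/= lerDr sumr_ge0// => j _; exact: sqr_ge0.
have := dot_ge0 dotE (b k); rewrite le_eqVlt => /predU1P[<-|b0]; first by rewrite ler01.
by rewrite expr2 -[leRHS]mul1r ler_pM2r.
Qed.

Section hilbert_cube.
Variables (c : nat -> R) (M : R).
Hypothesis cM : forall n, \sum_(k < n) c k ^+ 2 <= M.

Let A := [set y | forall k, `|dot y (b k)| <= c k].

Let tail e : 0 < e -> exists K, forall n, \sum_(K <= k < K + n) c k ^+ 2 <= e.
Proof. by apply: series_tail cM => k; exact: sqr_ge0. Qed.

Let cube_close e : 0 < e -> exists (K : nat) (d : R), 0 < d /\ forall y z, A y -> A z ->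
  (forall k, (k < K)%N -> dot (y - z) (b k) ^+ 2 <= d) -> `|y - z| < e.
Proof.
move=> e0; have e2 : 0 < e ^+ 2 by rewrite exprn_gt0.
have e16 : 0 < e ^+ 2 / 16 by rewrite divr_gt0.
(* [e ^ 2 / 4] is spent on the first [K] coordinates and [4 * (e ^ 2 / 16)] on the tail, where each
   coordinate of [y - z] is at most [2 c k]. *)
have [K KP] := tail e16; exists K, (e ^+ 2 / 4 / K.+1%:R); split; first by rewrite !divr_gt0.
move=> y z Ay Az yz; rewrite -(@ltr_pXn2r _ 2) ?nnegrE ?(ltW e0)// -dotE.
apply: (@le_lt_trans _ _ (e ^+ 2 / 4 + 4 * (e ^+ 2 / 16))); last lra.
apply: (cvgr_to_le (@pb (y - z))); exists K => // n /= Kn; rewrite -(subnKC Kn).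
rewrite -(big_mkord xpredT (fun k => dot (y - z) (b k) ^+ 2)).
rewrite (@big_cat_nat _ _ _ K) ?leq_addr//=; apply: lerD.
  rewrite big_mkord; apply: (@le_trans _ _ (\sum_(k < K) e ^+ 2 / 4 / K.+1%:R)).
    by apply: ler_sum => k _; exact: yz.
  rewrite sumr_const card_ord -[leLHS]mulr_natr -mulrA ger_pMr ?divr_gt0//.
  by rewrite mulrC ler_pdivrMr// mul1r ler_nat.
apply: le_trans (ler_wpM2l _ (KP (n - K)%N)) => //; rewrite mulr_sumr.
apply: ler_sum => k _; rewrite dotBl.
have := Ay k; have := Az k => u1 u2.
have -> : 4 * c k ^+ 2 = (2 * c k) ^+ 2 by ring.
by apply: sqr_le_norm; apply: (le_trans (ler_normB _ _)); lra.
Qed.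

(* An ultrafilter on the cube converges coordinatewise, and is then Cauchy in norm
   since the tails of [sum_k c_k^2] are small. *)
Lemma hilbert_cube_compact : compact A.
Proof.
rewrite compact_ultra => U UU UA.
have ex k : exists t : R, (fun y => dot y (b k)) @ U --> t.
  have [|t [_ tU]] := @segment_compact _ (- c k) (c k) ((fun y => dot y (b k)) @ U).
    rewrite -[_ (_ @ U) _]/(U [set y | `[- c k, c k]%classic (dot y (b k))]).
    by apply: filterS UA => y yA; rewrite /= in_itv/= -ler_norml; exact: yA.
  exists t => B Bt.
  have [//|UB] := in_ultra_setVsetC ((fun y => dot y (b k)) @^-1` B) UU.
  by have [z []] := tU _ _ (UB : ((fun y => dot y (b k)) @ U) (~` B)) Bt.
have [t tP] := choice ex.
have Uc : cvg U.
  apply: cauchy_cvg; apply: cauchy_exP => e e0.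
  have [K [d [d0 HK]]] := cube_close e0.
  have d4 : 0 < Num.sqrt (d / 4) by rewrite sqrtr_gt0 divr_gt0.
  have UD : \forall y \near U, A y /\ forall k : 'I_K, `|t k - dot y (b k)| <= Num.sqrt (d / 4).
    near=> y; split; first by near: y.
    near: y; apply: filter_forall => k.
    exact: cvgr_dist_le (tP k) _ d4.
  have [x0 [Ax0 x0t]] := filter_ex UD.
  exists x0; apply: filterS UD => y [Ay yt]; rewrite -ball_normE /ball_/=.
  apply: HK => // k kK; have := x0t (Ordinal kK); have := yt (Ordinal kK) => /=.
  rewrite dotBl => h1 h2.
  have h : `|dot x0 (b k) - dot y (b k)| <= 2 * Num.sqrt (d / 4).
    have -> : dot x0 (b k) - dot y (b k) = (t k - dot y (b k)) - (t k - dot x0 (b k)) by ring.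
    by apply: (le_trans (ler_normB _ _)); lra.
  have -> : d = (2 * Num.sqrt (d / 4)) ^+ 2.
    by rewrite exprMn sqr_sqrtr ?divr_ge0 ?(ltW d0)//; field.
  exact: sqr_le_norm.
exists (lim U) => //; split => // k.
have h0 : (fun y => dot y (b k)) @ U --> dot (lim U) (b k).
  exact: (cvg_comp _ _ Uc (@dot_continuousl _ _ _ dotE (b k) (lim U))).
have h : (fun y => `|dot y (b k)|) @ U --> `|dot (lim U) (b k)|.
  exact: (@cvg_norm R R^o _ U _ _ _ h0).
by apply: (cvgr_to_le h); apply: filterS UA => y /(_ k).
Unshelve. all: by end_near. Qed.

End hilbert_cube.

End parseval_sequence.

(** * Trace-class positive operators *)

Section psd_operator.
Context {R : realType} {H : completeNormedModType R} (dot : {dot H for idfun}).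
Hypothesis dotE : hilbert_dot dot.

(** Linearity is derived from symmetry, in [psdD] and [psdZ]. For the covariance operator the bound
    [a] will be the trace. *)
Record psd (L : H -> H) (a : R) : Prop := Psd {
  psd_sym : forall x y, dot (L x) y = dot x (L y);
  psd_ge0 : forall x, 0 <= dot (L x) x;
  psd_le : forall x, dot (L x) x <= a * dot x x;
  psd_cst : 0 <= a }.

Section one_operator.
Variables (L : H -> H) (a : R).
Hypothesis pL : psd L a.

Lemma psdD x y : L (x + y) = L x + L y.
Proof. by apply: (dot_inj dotE) => z; rewrite dotDl !(psd_sym pL) dotDl. Qed.

Lemma psdZ c x : L (c *: x) = c *: L x.
Proof. by apply: (dot_inj dotE) => z; rewrite dotZl !(psd_sym pL) dotZl. Qed.

Lemma psdB x y : L (x - y) = L x - L y.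
Proof. by rewrite psdD -scaleN1r psdZ scaleN1r. Qed.

Lemma psd_sum (I : Type) (r : seq I) (F : I -> H) :
  L (\sum_(i <- r) F i) = \sum_(i <- r) L (F i).
Proof.
elim: r => [|i r IH]; first by rewrite !big_nil -{1}(scale0r 0) psdZ scale0r.
by rewrite !big_cons psdD IH.
Qed.

(** Cauchy-Schwarz for the form [dot (L x) y] at [y = L x], divided by [|L x| ^ 2]. *)
Lemma psd_sqr x : dot (L x) (L x) <= a * dot (L x) x.
Proof.
have := psd_cauchy_schwarz (psd_sym pL) (psd_ge0 pL) x (L x).
have := dot_ge0 dotE (L x); rewrite le_eqVlt => /predU1P[<- _|L0].
  by rewrite mulr_ge0 ?(psd_cst pL) ?(psd_ge0 pL).
move=> h; have := le_trans h (ler_wpM2l (psd_ge0 pL x) (psd_le pL (L x))).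
by rewrite expr2 mulrA [dot (L x) x * a]mulrC ler_pM2r.
Qed.

Lemma psd_norm x : `|L x| <= a * `|x|.
Proof.
have a0 := psd_cst pL; rewrite -(@ler_pXn2r _ 2) ?nnegrE ?mulr_ge0// exprMn -!dotE.
apply: (le_trans (psd_sqr x)); rewrite expr2 -mulrA ler_wpM2l//.
exact: psd_le.
Qed.

(** By symmetry the coordinates of [L x] are at most [|L (b k)|] for [x] in the unit ball, and these
    are square summable by [psd_sqr] and the bound on the trace: the image lies in a Hilbert
    cube. *)
Lemma psd_compact (b : nat -> H) (t : R) : parseval dot b ->
  (forall n, \sum_(k < n) dot (L (b k)) (b k) <= t) -> compact_operator L.
Proof.
move=> pb tb; have a0 := psd_cst pL.
have cM n : \sum_(k < n) `|L (b k)| ^+ 2 <= a * t.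
  apply: le_trans (ler_wpM2l a0 (tb n)); rewrite mulr_sumr.
  by apply: ler_sum => k _; rewrite -dotE; exact: psd_sqr.
have := @hilbert_cube_compact _ _ _ dotE _ pb (fun k => `|L (b k)|) _ cM.
move=> /(compact_precompact (@norm_hausdorff _ _)); apply: precompact_subset.
move=> _ [x x1 <-] k; rewrite (psd_sym pL).
apply: (le_trans (dot_norm dotE _ _)); rewrite -[leRHS]mul1r.
by rewrite ler_wpM2r.
Qed.

(** Membership means [L (L e) = s ^ 2 e]. Then [f = L e - s e] satisfies [L f = - s f], which
    positivity allows only for [f = 0]. *)
Lemma singular_spaceP s e : 0 < s -> singular_space dot L s e <-> L e = s *: e.
Proof.
move=> s0; split => [h|Le x]; last first.
  by rewrite Le dotZl -(psd_sym pL) Le dotZl mulrA expr2.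
have LL : L (L e) = s ^+ 2 *: e.
  by apply: (dot_inj dotE) => x; rewrite (psd_sym pL) h dotZl.
pose f := L e - s *: e.
have Lf : L f = - s *: f.
  by rewrite /f psdB psdZ LL !scalerBr !scalerA scaleNr mulNr -expr2 scaleNr opprK addrC.
have := psd_ge0 pL f; rewrite Lf dotZl mulNr oppr_ge0 pmulr_rle0// => f0.
have : dot f f = 0 by apply/eqP; rewrite eq_le f0 dot_ge0.
by rewrite dotE => /eqP; rewrite sqrf_eq0 normr_eq0 subr_eq0 => /eqP.
Qed.

Lemma small_norm_eq0 (x : H) (C : R) : (forall d, 0 < d -> `|x| <= C * d) -> x = 0.
Proof.
move=> h; apply/eqP; rewrite -normr_le0; apply/ler_addgt0Pr => e e0; rewrite add0r.
have C1 : 0 < `|C| + 1 by rewrite ltr_wpDl.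
apply: (le_trans (h _ (divr_gt0 e0 C1))); rewrite mulrA ler_pdivrMr// mulrC ler_wpM2l ?(ltW e0)//.
by apply: (le_trans (ler_norm _)); rewrite lerDl.
Qed.

End one_operator.

(* With [mu] the supremum of [<L x, x>] on the unit ball, [|L x - mu x|^2] is at
   most [mu^2 - mu <L x, x>]: along a maximizing sequence [x_n], every cluster
   point of [L x_n] is an eigenvector for [mu]. *)
Lemma psd_eigen (L : H -> H) (a : R) (x0 : H) (eta : R) : psd L a -> compact_operator L ->
  `|x0| <= 1 -> 0 < eta -> eta < dot (L x0) x0 ->
  exists mu e, [/\ eta < mu, dot e e = 1 & L e = mu *: e].
Proof.
move=> pL cL x01 eta0 Lx0.
pose E := [set dot (L x) x | x in [set x : H | `|x| <= 1]].
have sE : has_sup E.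
  split; first by exists (dot (L x0) x0), x0.
  exists a => _ [x x1 <-]; apply: (le_trans (psd_le pL x)).
  by rewrite dotE ler_piMr ?(psd_cst pL)// expr_le1.
pose mu := sup E.
have muE x : `|x| <= 1 -> dot (L x) x <= mu by move=> x1; apply: ub_le_sup; [exact: sE.2|exists x].
have mu_eta : eta < mu by apply: (lt_le_trans Lx0); exact: muE.
have mu0 : 0 < mu by exact: lt_trans mu_eta.
have pmu : psd L mu.
  split; [exact: psd_sym pL|exact: psd_ge0 pL| |exact: ltW] => x.
  have [->|xN] := eqVneq x 0; first by rewrite dot0r dot0r mulr0.
  have n0 : 0 < `|x| by rewrite normr_gt0.
  have := muE (`|x|^-1 *: x); rewrite normrZ normfV normr_id mulVf ?gt_eqF// => /(_ (lexx 1)).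
  rewrite (psdZ pL) dotZl dotZr mulrA -expr2 mulrC exprVn ler_pdivrMr ?exprn_gt0//.
  by rewrite dotE.
have ex n : exists x, `|x| <= 1 /\ mu - n.+1%:R^-1 < dot (L x) x.
  have n0 : (0 : R) < n.+1%:R^-1 by rewrite invr_gt0 ltr0n.
  by have [_ [x x1 <-] ?] := sup_adherent n0 sE; exists x.
have [x xP] := choice ex.
move: cL; rewrite /compact_operator precompactE => /(_ ((fun n => L (x n)) @ \oo)).
case=> [|y [_ yc]].
  exists 0 => // n _; apply: subset_closure; exists (x n) => //=; by have [] := xP n.
have key d : 0 < d -> exists z, [/\ `|z| <= 1, mu - d ^+ 2 < dot (L z) z & `|L z - y| < d].
  move=> d0; have d2 : 0 < d ^+ 2 by rewrite exprn_gt0.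
  have [N _ NP] := near_infty_natSinv_lt (PosNum d2).
  have [_ [/= [n Nn <-] yn]] := yc ((fun n => L (x n)) @` [set n | (N <= n)%N]) (ball y d)
    (ex_intro2 _ _ N I (fun n Nn => ex_intro2 _ _ n Nn erefl)) (nbhsx_ballx y d d0).
  exists (x n); have [x1 xm] := xP n; split => //.
    by apply: le_lt_trans xm; rewrite lerD2l lerN2; exact: ltW (NP n Nn).
  by move: yn; rewrite -ball_normE /ball_/= distrC.
have Ly : L y = mu *: y.
  apply/eqP; rewrite -subr_eq0; apply/eqP.
  apply: (@small_norm_eq0 _ (mu + mu * (mu + 1) + mu)) => d d0.
  have [z [z1 zm zy]] := key d d0.
  have r1 : `|L z - mu *: z| <= (mu + 1) * d.
    rewrite -(@ler_pXn2r _ 2) ?nnegrE ?mulr_ge0 ?addr_ge0 ?(ltW mu0) ?(ltW d0)//.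
    rewrite -dotE dotBl !dotBr !dotZl !dotZr (dotC dot z (L z)).
    have h1 := psd_sqr pmu z.
    have h2 : dot z z <= 1 by rewrite dotE expr_le1.
    have h3 : mu * (mu * dot z z) <= mu * (mu * 1) by rewrite !ler_wpM2l ?(ltW mu0).
    have h4 : mu * (mu - d ^+ 2) <= mu * dot (L z) z by rewrite ler_wpM2l ?(ltW mu0)// ltW.
    have h5 : 0 <= (mu ^+ 2 + mu + 1) * d ^+ 2 by rewrite mulr_ge0 ?sqr_ge0// !addr_ge0 ?sqr_ge0 ?ltW.
    lra.
  have -> : L y - mu *: y = L (y - L z) + L (L z - mu *: z) + mu *: (L z - y).
    rewrite !(psdB pL) (psdZ pL) scalerBr !addrA; congr (_ - _).
    by rewrite subrK subrK.
  apply: (le_trans (ler_normD _ _)); rewrite normrZ (gtr0_norm mu0) 2!mulrDl.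
  apply: lerD; last by rewrite ler_wpM2l ?(ltW mu0)// ltW.
  apply: (le_trans (ler_normD _ _)); apply: lerD.
    by apply: (le_trans (psd_norm pmu _)); rewrite ler_wpM2l ?(ltW mu0)// distrC ltW.
  by apply: (le_trans (psd_norm pmu _)); rewrite -mulrA ler_wpM2l ?(ltW mu0).
have y0 : y != 0.
  (* If [y = 0] then [mu - d ^ 2 < dot (L z) z <= |L z| < d], so [mu < 2 d] because [d <= 1], and
     [d <= mu / 3] excludes this. *)
  apply/eqP => y0; pose d := Num.min 1 (mu / 3).
  have d0 : 0 < d by rewrite lt_min ltr01 divr_gt0.
  have [z [z1 zm zy]] := key d d0; move: zy; rewrite y0 subr0 => zy.
  have : dot (L z) z <= `|L z|.
    apply: (le_trans (ler_norm _)); apply: (le_trans (dot_norm dotE _ _)).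
    by rewrite ler_piMr.
  have d1 : d <= 1 by rewrite ge_min lexx.
  have d3 : d <= mu / 3 by rewrite ge_min lexx orbT.
  have : d ^+ 2 <= d by rewrite expr2 ler_piMr ?(ltW d0).
  lra.
have n0 : `|y| != 0 by rewrite normr_eq0.
exists mu, (`|y|^-1 *: y); split => //.
  by rewrite dotZl dotZr dotE; field.
by rewrite (psdZ pL) Ly !scalerA mulrC.
Unshelve. all: by end_near. Qed.

End psd_operator.

Section spectral.
Context {R : realType} {H : completeNormedModType R} (dot : {dot H for idfun}).
Hypothesis dotE : hilbert_dot dot.

Definition orthonormal (J : finType) (e : J -> H) :=
  forall i j, dot (e i) (e j) = (i == j)%:R.

Lemma dot_comb (J : finType) (e : J -> H) (c : J -> R) j : orthonormal e ->
  dot (\sum_i c i *: e i) (e j) = c j.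
Proof.
move=> oe; rewrite dot_suml (bigD1 j)//= dotZl oe eqxx mulr1 big1 ?addr0// => i ij.
by rewrite dotZl oe (negPf ij) mulr0.
Qed.

Lemma bessel (J : finType) (e : J -> H) x : orthonormal e ->
  \sum_j dot x (e j) ^+ 2 <= dot x x.
Proof.
move=> oe; pose y := \sum_j dot x (e j) *: e j.
have xy : dot x y = \sum_j dot x (e j) ^+ 2.
  by rewrite dot_sumr; apply: eq_bigr => j _; rewrite dotZr expr2.
have yy : dot y y = \sum_j dot x (e j) ^+ 2.
  by rewrite {2}/y dot_sumr; apply: eq_bigr => j _; rewrite dotZr dot_comb// expr2.
have := dot_ge0 dotE (x - y); rewrite dotBl !dotBr (dotC dot y x) xy yy; lra.
Qed.

Section deflation.
Variables (L : H -> H) (a : R) (b : nat -> H).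
Hypothesis pL : psd dot L a.
Hypothesis pb : parseval dot b.
Hypothesis trL : (fun K => \sum_(k < K) dot (L (b k)) (b k)) @ \oo --> a.
Variables (J : finType) (e : J -> H) (lam : J -> R).
Hypothesis oe : orthonormal e.
Hypothesis Le : forall j, L (e j) = lam j *: e j.
Hypothesis lam0 : forall j, 0 <= lam j.

(* The restriction of [L] to the orthogonal complement of the [e j]. *)
Definition defl x := L x - \sum_j (lam j * dot x (e j)) *: e j.

Lemma defl_dot x y : dot (defl x) y = dot (L x) y - \sum_j lam j * dot x (e j) * dot y (e j).
Proof.
rewrite dotBl dot_suml; congr (_ - _); apply: eq_bigr => j _.
by rewrite dotZl (dotC dot (e j)).
Qed.

Lemma defl_eigen j : defl (e j) = 0.
Proof.
rewrite /defl Le (bigD1 j)//= oe eqxx mulr1 big1 ?addr0 ?subrr// => i ij.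
by rewrite oe eq_sym (negPf ij) mulr0 scale0r.
Qed.

Let defl_sym x y : dot (defl x) y = dot x (defl y).
Proof.
rewrite (dotC dot x) !defl_dot (psd_sym pL) (dotC dot x); congr (_ - _).
by apply: eq_bigr => j _; rewrite mulrAC.
Qed.

(** [defl x] is [L] applied to the residual of [x] and is orthogonal to the removed part, so the
    left operand is the form of [L] at this residual. *)
Let defl_ge0 x : 0 <= dot (defl x) x.
Proof.
pose y := x - \sum_j dot x (e j) *: e j.
have Ly : L y = defl x.
  rewrite /y (psdB dotE pL) (psd_sum dotE pL); congr (_ - _); apply: eq_bigr => j _.
  by rewrite (psdZ dotE pL) Le scalerA mulrC.
have dy : dot (defl x) y = dot (defl x) x.
  rewrite /y dotBr dot_sumr [X in _ - X]big1 ?subr0// => j _.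
  by rewrite dotZr defl_sym defl_eigen dot0r mulr0.
by rewrite -dy -Ly; exact: psd_ge0 pL _.
Qed.

Lemma defl_le x : dot (defl x) x <= dot (L x) x.
Proof.
rewrite defl_dot gerBl sumr_ge0// => j _.
by rewrite -mulrA -expr2 mulr_ge0// sqr_ge0.
Qed.

Lemma defl_psd : psd dot defl a.
Proof.
split; [exact: defl_sym|exact: defl_ge0| |exact: psd_cst pL] => x.
exact: le_trans (defl_le x) (psd_le pL x).
Qed.

Lemma defl_trace :
  (fun K => \sum_(k < K) dot (defl (b k)) (b k)) @ \oo --> a - \sum_j lam j.
Proof.
have -> : (fun K => \sum_(k < K) dot (defl (b k)) (b k)) = (fun K =>
    \sum_(k < K) dot (L (b k)) (b k) - \sum_j lam j * \sum_(k < K) dot (e j) (b k) ^+ 2).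
  apply/funext => K; under eq_bigr do rewrite defl_dot.
  rewrite sumrB; congr (_ - _); rewrite exchange_big; apply: eq_bigr => j _.
  by rewrite mulr_sumr; apply: eq_bigr => k _; rewrite (dotC dot (e j)) -mulrA -expr2.
apply: cvgB => //; apply: cvg_big => [|j _]; first exact: add_continuous.
rewrite -[X in _ --> X]mulr1.
apply: cvgM; first exact: cvg_cst.
by have := @pb (e j); rewrite oe eqxx.
Qed.

Lemma defl_trace_le n : \sum_(k < n) dot (defl (b k)) (b k) <= a - \sum_j lam j.
Proof.
rewrite -(cvg_lim (@Rhausdorff R) defl_trace).
apply: (nondecreasing_cvgn_le (u_ := fun K => \sum_(k < K) dot (defl (b k)) (b k))).
  by apply/nondecreasing_seqP => K; rewrite big_ord_recr/= lerDl defl_ge0.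
by apply/cvg_ex; exists (a - \sum_j lam j); exact: defl_trace.
Qed.

(** Even the empty partial sum of the trace of [defl] is at most [a] minus the eigenvalues. *)
Lemma eigen_sum_le : \sum_j lam j <= a.
Proof. by have := defl_trace_le 0; rewrite big_ord0 subr_ge0. Qed.

Lemma defl_compact : compact_operator defl.
Proof. exact: (psd_compact dotE defl_psd pb defl_trace_le). Qed.

Lemma defl_new_eigen (x0 : H) (eta : R) : `|x0| <= 1 -> 0 < eta ->
  eta < dot (defl x0) x0 -> exists mu v, [/\ eta < mu, dot v v = 1, L v = mu *: v &
    forall j, dot v (e j) = 0].
Proof.
move=> x1 eta0 h.
have [mu [v [mu1 vv Dv]]] := psd_eigen dotE defl_psd defl_compact x1 eta0 h.
have mu0 : mu != 0 by rewrite gt_eqF// (lt_trans eta0).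
have ve j : dot v (e j) = 0.
  have : mu * dot v (e j) = 0 by rewrite -dotZl -Dv defl_sym defl_eigen dot0r.
  by move=> /eqP; rewrite mulf_eq0 (negPf mu0) => /eqP.
exists mu, v; split => //; rewrite -Dv /defl big1 ?subr0// => j _.
by rewrite ve mulr0 scale0r.
Qed.

(** The first [K] vectors [b k] have norm at most 1 and contribute at most [eta] each; on the others
    the form of [defl] is below that of [L], whose trace has the tail bound [tl]. *)
Lemma defl_trace_small (eta : R) K (tl : R) : 0 <= eta ->
  (forall x, `|x| <= 1 -> dot (defl x) x <= eta) ->
  (forall n, \sum_(K <= k < K + n) dot (L (b k)) (b k) <= tl) ->
  a - \sum_j lam j <= K%:R * eta + tl.
Proof.
move=> eta0 small tail; apply: (cvgr_to_le defl_trace); exists K => // n /= Kn.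
rewrite -(subnKC Kn) -(big_mkord xpredT (fun k => dot (defl (b k)) (b k))).
rewrite (@big_cat_nat _ _ _ K) ?leq_addr//=; apply: lerD.
  rewrite big_mkord; apply: (@le_trans _ _ (\sum_(k < K) eta)).
    apply: ler_sum => k _; apply: small.
    rewrite -(@ler_pXn2r _ 2) ?nnegrE// expr1n -dotE.
    exact: parseval_vec_le1.
  by rewrite sumr_const card_ord mulr_natl.
apply: le_trans (tail (n - K)%N); apply: ler_sum => k _; exact: defl_le.
Qed.

End deflation.

End spectral.

(** * Schatten norms of a positive operator of finite trace *)

Section schatten_norms.
Context {R : realType} {H : completeNormedModType R} (dot : {dot H for idfun}).
Hypothesis dotE : hilbert_dot dot.
Variables (L : H -> H) (a : R) (b : nat -> H).
Hypothesis pL : psd dot L a.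
Hypothesis pb : parseval dot b.
Hypothesis trL : (fun K => \sum_(k < K) dot (L (b k)) (b k)) @ \oo --> a.

Definition eigenfamily (s : R) (m : nat) (e : 'I_m -> H) :=
  orthonormal dot e /\ forall i, L (e i) = s *: e i.

Let a0 : 0 <= a. Proof. exact: psd_cst pL. Qed.

Lemma eigenfamily_le s m (e : 'I_m -> H) : 0 < s -> eigenfamily s e -> m%:R * s <= a.
Proof.
move=> s0 [oe Le].
have := @eigen_sum_le _ _ _ dotE _ _ _ pL pb trL _ _ (fun=> s) oe Le.
by rewrite sumr_const card_ord mulr_natl.
Qed.

(** An orthonormal family for the eigenvalue [s] has at most [a / s] members, so a largest one
    exists; its size is the multiplicity, zero when [s] is not an eigenvalue. *)
Let maximal_ex s : exists p : {m : nat & 'I_m -> H}, 0 < s ->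
  eigenfamily s (projT2 p) /\
  forall m (e : 'I_m -> H), eigenfamily s e -> (m <= projT1 p)%N.
Proof.
have [s0|sN] := ltP 0 s; last by exists (existT _ 0%N (fun=> 0)).
pose Q m := `[< exists e : 'I_m -> H, eigenfamily s e >].
have Q0 : exists m, Q m by exists 0%N; apply/asboolP; exists (fun=> 0); split=> -[].
have Qub m : Q m -> (m <= Num.truncn (a / s))%N.
  move=> /asboolP[e /(eigenfamily_le s0) ms].
  by rewrite truncn_ge_nat ?divr_ge0 ?(ltW s0)// ler_pdivlMr.
case: (ex_maxnP Q0 Qub) => m /asboolP[e em] mmax.
exists (existT _ m e) => _; split => // k f fk; apply: mmax.
by apply/asboolP; exists f.
Qed.

Let pm := projT1 (choice maximal_ex).
Let m s := projT1 (pm s).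
Let E s : 'I_(m s) -> H := projT2 (pm s).

Let mP s : 0 < s -> eigenfamily s (@E s).
Proof. by move=> /(projT2 (choice maximal_ex) s)[]. Qed.

Let mmax s k (e : 'I_k -> H) : 0 < s -> eigenfamily s e -> (k <= m s)%N.
Proof. by move=> /(projT2 (choice maximal_ex) s)[_ h]; exact: h. Qed.

Let hdimE s : 0 < s -> hilbert_dim dot (singular_space dot L s) = (m s)%:R%:E.
Proof.
move=> s0; apply/eqP; rewrite eq_le; apply/andP; split.
  apply: ge_ereal_sup => _ [k [e oe Le] <-]; rewrite lee_fin ler_nat.
  apply: (mmax (e := e)) => //; split => // i.
  exact/(singular_spaceP dotE pL)/Le.
apply: ereal_sup_ubound; exists (m s) => //; have [oe Le] := mP s0.
by exists (@E s) => // i; apply/(singular_spaceP dotE pL).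
Qed.

(** Finite sets of positive reals, as in the definition of [esum]; members that are not singular
    values have [m s = 0] and add nothing to [W]. *)
Let pos (F : seq R) := uniq F /\ forall s, s \in F -> 0 < s.
Let W n (F : seq R) := \sum_(s <- F) (m s)%:R * s ^+ n.

(** The index type is the dependent sum, over [F], of the bases of the eigenspaces. Distinct
    eigenvalues have orthogonal eigenvectors by symmetry of [L]. *)
Let family F : pos F -> exists (J : finType) (e : J -> H) (lam : J -> R),
  [/\ orthonormal dot e, forall j, L (e j) = lam j *: e j, forall j, 0 < lam j,
      forall n, \sum_j lam j ^+ n = W n F &
      forall s i, s \in F -> exists j, e j = @E s i].
Proof.
move=> [uF F0]; pose sF (i : 'I_(size F)) := F`_i.
have sFin i : sF i \in F by exact: mem_nth.
exists {i : 'I_(size F) & 'I_(m (sF i))}, (fun p => @E (sF (tag p)) (tagged p)),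
  (fun p => sF (tag p)).
have sF0 i : 0 < sF i by exact: F0.
split.
- move=> [i k] [i' k'] /=; have [ii|ii] := eqVneq i i'.
    by subst i'; rewrite (mP (sF0 i)).1 -tag_eqE /tag_eq/= eqxx tagged_asE.
  have -> : (existT _ i k == existT _ i' k' :> {i : 'I_(size F) & 'I_(m (sF i))}) = false.
    by rewrite -tag_eqE /tag_eq/= (negPf ii).
  have ss : sF i - sF i' != 0.
    by rewrite subr_eq0 /sF nth_uniq.
  have : (sF i - sF i') * dot (@E _ k) (@E _ k') = 0.
    rewrite mulrBl -dotZl -dotZr -(mP (sF0 i)).2 -(mP (sF0 i')).2.
    by rewrite (psd_sym pL) subrr.
  by move=> /eqP; rewrite mulf_eq0 (negPf ss) => /eqP.
- by move=> [i k] /=; rewrite (mP (sF0 i)).2.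
- by move=> [i k] /=.
- move=> n; rewrite /W (big_nth 0) big_mkord.
  transitivity (\sum_(i < size F) \sum_(k < m (sF i)) sF i ^+ n).
    by rewrite (sig_big_dep (J := fun i => 'I_(m (sF i))) _ (fun _ => xpredT)
      (fun i _ => sF i ^+ n)).
  by apply: eq_bigr => i _; rewrite sumr_const card_ord mulr_natl.
- move=> s i sF'; have sz : (index s F < size F)%N by rewrite index_mem.
  have si : sF (Ordinal sz) = s by rewrite /sF /= nth_index.
  move: i; rewrite -si => i.
  by exists (existT _ (Ordinal sz) i).
Qed.

Let W1_le F : pos F -> W 1 F <= a.
Proof.
move=> pF; have [J [e [lam [oe Le lam0 WE _]]]] := family pF.
rewrite -WE; under eq_bigr do rewrite expr1.
exact: (eigen_sum_le dotE pL pb trL oe Le).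
Qed.

(** Every eigenvalue is at most [a], which reduces the power [n] to the trace bound. This makes the
    suprema [T n] finite. *)
Let Wn_le n F : (0 < n)%N -> pos F -> W n F <= a ^+ n.
Proof.
case: n => // n _ pF; rewrite exprSr.
apply: le_trans (ler_wpM2l (exprn_ge0 n a0) (W1_le pF)); rewrite mulr_sumr.
rewrite /W big_seq [leRHS]big_seq; apply: ler_sum => s sF.
have s0 : 0 < s by exact: pF.2.
rewrite expr1 exprSr mulrCA; have [->|m0] := eqVneq (m s) 0%N.
  by rewrite !mul0r !mulr0.
have m1 : (1 : R) <= (m s)%:R by rewrite ler1n lt0n.
have sa : s <= a.
  apply: le_trans (eigenfamily_le s0 (mP s0)).
  by rewrite ler_peMl// ltW.
rewrite ler_wpM2r ?mulr_ge0 ?(ltW s0)//.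
by rewrite lerXn2r// nnegrE ltW.
Qed.

Let W_mono n F F' : pos F -> pos F' -> {subset F <= F'} -> W n F <= W n F'.
Proof.
move=> pF pF' FF'; rewrite /W [leRHS](bigID (mem F))/= -[leLHS]addr0 lerD//.
  rewrite -[leRHS]big_filter le_eqVlt; apply/orP; left; apply/eqP; apply: perm_big.
  apply: uniq_perm; [exact: pF.1|by rewrite filter_uniq// pF'.1|move=> s].
  by rewrite mem_filter; case: (boolP (s \in F)) => //= /FF' ->.
rewrite big_seq_cond sumr_ge0// => s /andP[/pF'.2 s0 _].
by rewrite mulr_ge0// exprn_ge0// ltW.
Qed.

Let Ws n := [set W n F | F in pos].
Let T n := sup (Ws n).

Let Ws_sup n : (0 < n)%N -> has_sup (Ws n).
Proof.
move=> n0; split; first by exists (W n [::]), [::].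
by exists (a ^+ n) => _ [F pF <-]; exact: Wn_le.
Qed.

Let W_le_T n F : (0 < n)%N -> pos F -> W n F <= T n.
Proof. by move=> n0 pF; apply: ub_le_sup; [exact: (Ws_sup n0).2|exists F]. Qed.

Let T_adherent n e : (0 < n)%N -> 0 < e -> exists2 F, pos F & T n - e < W n F.
Proof. by move=> n0 e0; have [_ [F pF <-] ?] := sup_adherent e0 (Ws_sup n0); exists F. Qed.

Let tr_le n : \sum_(k < n) dot (L (b k)) (b k) <= a.
Proof.
have nd : nondecreasing_seq (fun K => \sum_(k < K) dot (L (b k)) (b k)).
  by apply/nondecreasing_seqP => K; rewrite big_ord_recr/= lerDl (psd_ge0 pL).
rewrite -(cvg_lim (@Rhausdorff R) trL).
by apply: nondecreasing_cvgn_le => //; apply/cvg_ex; exists a.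
Qed.

(* If [W 1 F] is within [eta] of its supremum, then [defl] has no eigenvalue above
   [eta], since it would enlarge [F] or the multiplicity of an element of [F]. *)
Let T1E : T 1 = a.
Proof.
apply/eqP; rewrite eq_le; apply/andP; split.
  by apply: ge_sup; [exact: (Ws_sup _).1|move=> _ [F pF <-]; exact: W1_le].
apply/ler_addgt0Pr => e e0; have e2 : 0 < e / 2 by rewrite divr_gt0.
have [K KP] := series_tail (fun k => psd_ge0 pL (b k)) tr_le e2.
pose eta := e / 2 / K.+1%:R; have eta0 : 0 < eta by rewrite !divr_gt0.
have [F pF FT] := T_adherent (ltn0Sn 0) eta0.
have [J [f [lam [oe Le lam0 WE fE]]]] := family pF.
have lam0' j : 0 <= lam j by exact: ltW.
have lamW : \sum_j lam j = W 1 F by rewrite -WE; apply: eq_bigr => j _; rewrite expr1.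
have small x : `|x| <= 1 -> dot (defl dot L f lam x) x <= eta.
  move=> x1; rewrite leNgt; apply/negP => h.
  have [mu [v [mu1 vv Lv vf]]] := defl_new_eigen dotE pL pb trL oe Le lam0' x1 eta0 h.
  have mu0 : 0 < mu by exact: lt_trans mu1.
  have [muF|muF] := boolP (mu \in F).
    have [oE LE] := mP mu0; have vE i : dot v (@E mu i) = 0.
      by have [j <-] := fE mu i muF.
    pose e' (i : 'I_(m mu).+1) := if unlift ord0 i is Some k then @E mu k else v.
    have : eigenfamily mu e'.
      split=> [i j|i]; rewrite /e'; last by case: unliftP => [k _|_].
      case: unliftP => [k ->|->]; case: unliftP => [l ->|->].
      - by rewrite oE (inj_eq lift_inj).
      - by rewrite (dotC dot) vE eq_sym (negPf (neq_lift _ _)).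
      - by rewrite vE (negPf (neq_lift _ _)).
      - by rewrite vv eqxx.
    by move=> /(mmax mu0); rewrite ltnn.
  have pF' : pos (mu :: F).
    split; first by rewrite /= muF pF.1.
    by move=> s; rewrite inE => /predU1P[->//|/pF.2].
  have : W 1 (mu :: F) <= T 1 by exact: W_le_T.
  rewrite {1}/W big_cons -/(W 1 F) expr1.
  have e1 : eigenfamily mu (fun _ : 'I_1 => v).
    by split=> // i j; rewrite vv !ord1 eqxx.
  have := mmax mu0 e1; rewrite -(ler_nat R) => m1.
  have : mu <= (m mu)%:R * mu by rewrite ler_peMl// ltW.
  lra.
have := defl_trace_small dotE pb trL oe lam0' (ltW eta0) small KP.
rewrite lamW; have : W 1 F <= T 1 by exact: W_le_T.
have : K%:R * eta <= e / 2.
  rewrite /eta mulrCA ger_pMr// ler_pdivrMr// mul1r.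
  by rewrite ler_nat.
lra.
Qed.

Let esumE n : (0 < n)%N ->
  \esum_(s in [set s : R | (0 < s)%R])
    (hilbert_dim dot (singular_space dot L s) * (s `^ n%:R)%:E)%E = (T n)%:E.
Proof.
move=> n0; rewrite /T -ereal_sup_EFin; [|exact: (Ws_sup n0).2|exact: (Ws_sup n0).1].
congr ereal_sup; apply/seteqP; split => [_ [A [fA A0] <-]|_ [_ [F pF <-] <-]] /=.
  have [Fs [uF FA FE]] : exists F : seq R, [/\ uniq F, (forall s, s \in F -> A s) &
      forall f : R -> \bar R, (\sum_(s \in A) f s = \sum_(s <- F) f s)%E].
    exists (finmap.enum_fset (fset_set A)); split; [exact: finmap.fset_uniq| |by move=> f; rewrite fsbig_finite].
    by move=> s; rewrite in_fset_set// inE.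
  exists (W n Fs); last first.
    rewrite FE /W -sumEFin big_seq [RHS]big_seq; apply: eq_bigr => s /FA/A0 s0.
    by rewrite hdimE// EFinM powR_mulrn// ltW.
  by exists Fs => //; split => // s /FA/A0.
exists [set` F]; first by split; [exact: finite_seq|move=> s /=; exact: pF.2].
rewrite -fsbig_seq ?pF.1// /W -sumEFin big_seq [RHS]big_seq; apply: eq_bigr => s sF.
by have s0 := pF.2 s sF; rewrite hdimE// EFinM powR_mulrn// ltW.
Qed.

Let Tge0 n : (0 < n)%N -> 0 <= T n.
Proof. by move=> n0; have := @W_le_T n [::] n0; rewrite /W big_nil; apply. Qed.

Let schattenE n : (0 < n)%N -> schatten dot n%:R L = (T n `^ n%:R^-1)%:E.
Proof.
move=> n0; rewrite /schatten asboolT ?esumE ?poweR_EFin//.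
exact: (psd_compact dotE pL pb tr_le).
Qed.

(** The truncations suited to the exponents 1, 2 and 3 are united into one finite set; [W n] is
    monotone in the set, so a single family of eigenvectors serves the three norms. *)
Lemma spectral_approximation : exists t2 t3 : R, [/\
  schatten dot 1 L = a%:E, schatten dot 2 L = (Num.sqrt t2)%:E,
  schatten dot 3 L = (t3 `^ 3^-1)%:E, 0 <= t2 /\ 0 <= t3 &
  forall eps, 0 < eps -> exists (J : finType) (e : J -> H) (lam : J -> R), [/\
    orthonormal dot e, forall j, L (e j) = lam j *: e j, forall j, 0 < lam j &
    [/\ a - eps < \sum_j lam j <= a, t2 - eps < \sum_j lam j ^+ 2 <= t2 &
        t3 - eps < \sum_j lam j ^+ 3 <= t3]]].
Proof.
exists (T 2), (T 3); split.
- by rewrite (schattenE (ltn0Sn 0)) T1E invr1 powRr1.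
- by rewrite (schattenE (ltn0Sn 1)) powR12_sqrt// Tge0.
- by rewrite (schattenE (ltn0Sn 2)).
- by rewrite !Tge0.
move=> eps eps0.
have [F1 p1 h1] := T_adherent (ltn0Sn 0) eps0.
have [F2 p2 h2] := T_adherent (ltn0Sn 1) eps0.
have [F3 p3 h3] := T_adherent (ltn0Sn 2) eps0.
pose F := undup (F1 ++ F2 ++ F3).
have pF : pos F.
  split; first exact: undup_uniq.
  by move=> s; rewrite mem_undup !mem_cat => /or3P[/p1.2|/p2.2|/p3.2].
have s1 : {subset F1 <= F} by move=> s sF; rewrite mem_undup !mem_cat sF.
have s2 : {subset F2 <= F} by move=> s sF; rewrite mem_undup !mem_cat sF orbT.
have s3 : {subset F3 <= F} by move=> s sF; rewrite mem_undup !mem_cat sF !orbT.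
have [J [f [lam [oe Le lam0 WE _]]]] := family pF.
exists J, f, lam; split => //.
have -> : \sum_j lam j = W 1 F by rewrite -WE; apply: eq_bigr => j _; rewrite expr1.
rewrite !WE -[in a - eps]T1E W1_le// !W_le_T// !andbT.
split; [exact: lt_le_trans h1 (W_mono _ p1 pF s1)|exact: lt_le_trans h2 (W_mono _ p2 pF s2)|].
exact: lt_le_trans h3 (W_mono _ p3 pF s3).
Qed.

End schatten_norms.

(** * Independence *)

Section independence.
Context {d d' : measure_display} {T : measurableType d} {E : measurableType d'} {R : realType}
  (P : probability T R) (X : {RV P >-> E}) (G : set (set T)).
Hypothesis Gm : G `<=` measurable.
Hypothesis GI : setI_closed G.
Hypothesis GT : G setT.
Hypothesis XG : forall A B, measurable A -> G B ->
  P (X @^-1` A `&` B) = (P (X @^-1` A) * P B)%E.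

Let mXA A : measurable A -> measurable (X @^-1` A).
Proof. by move=> mA; rewrite -[_ @^-1` _]setTI; exact: measurable_funP. Qed.

(** For fixed [A], both sides are finite measures in [B] that agree on the pi-system [G], hence on
    the sigma-algebra it generates. *)
Let XsG A B : measurable A -> <<s G >> B -> P (X @^-1` A `&` B) = (P (X @^-1` A) * P B)%E.
Proof.
move=> mA sB; have pA0 : 0 <= fine (P (X @^-1` A)) by exact: fine_ge0.
pose m1 : {measure set T -> \bar R} := mrestr P (mXA mA).
pose m2 : {measure set T -> \bar R} := mscale (NngNum pA0) P.
have -> : (P (X @^-1` A) * P B)%E = m2 B.
  by rewrite /m2 /= /mscale /= fineK// fin_num_measure//; exact: mXA.
have -> : P (X @^-1` A `&` B) = m1 B by rewrite /m1 /= /mrestr setIC.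
apply: (g_sigma_algebra_measure_unique G Gm (fun=> setT)) => //.
- by rewrite bigcup_const//; exists 0.
- by move=> C GC; rewrite /m1 /m2 /= /mscale /mrestr/= setIC XG// fineK// fin_num_measure//; exact: mXA.
- by move=> _; rewrite /m1 /= /mrestr setTI; rewrite -ge0_fin_numE// fin_num_measure//; exact: mXA.
Qed.

Let Gtype := g_sigma_algebraType G.

Let sGm : <<s G >> `<=` measurable.
Proof. exact: smallest_sub (@sigma_algebra_measurable _ T) Gm. Qed.

(* The joint law of [X] and of the identity, seen as a variable with values in the
   space with sigma-algebra [<<s G >>], is a product. *)
Definition to_sub (w : T) : Gtype := w.

Let measurable_to_sub : measurable_fun [set: T] to_sub.
Proof. by move=> _ B sB; rewrite setTI; exact: sGm. Qed.

HB.instance Definition _ := isMeasurableFun.Build _ _ T Gtype to_sub measurable_to_sub.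

Let PG : probability Gtype R := distribution P to_sub.
Let PX : probability E R := distribution P X.

Let psi (w : T) : E * Gtype := (X w, to_sub w).

Let mpsi : measurable_fun [set: T] psi.
Proof. by apply/measurable_fun_pairP; split; exact: measurable_funP. Qed.

Let PXG : probability (E * Gtype)%type R := (PX \x PG)%E.

Let psiE A : measurable A -> P (psi @^-1` A) = PXG A.
Proof.
move=> mA; rewrite -[LHS]/(push_measure P mpsi A); apply/esym.
by apply: product_measure_unique => // C D mC mD; exact: XsG.
Qed.

Lemma Ex_indep (f : E -> R) (V : T -> R) : measurable_fun [set: E] f ->
  measurable_fun [set: Gtype] (V : Gtype -> R) -> intg P (fun w => f (X w)) -> intg P V ->
  intg P (fun w => f (X w) * V w) /\
  Ex P (fun w => f (X w) * V w) = Ex P (fun w => f (X w)) * Ex P V.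
Proof.
move=> mf mV fi Vi.
have mF : measurable_fun setT (fun z : E * Gtype => f z.1 * V z.2).
  apply: measurable_funM.
    by apply: (@measurableT_comp _ _ _ _ _ _ f).
  by apply: (@measurableT_comp _ _ _ _ _ _ (V : Gtype -> R)).
have fi' : intg PX f by exact: (transport_intg (@measurable_funPT _ _ _ _ X) _ mf fi).
have Vi' : intg PG (V : Gtype -> R) by exact: (transport_intg measurable_to_sub _ mV Vi).
have Fi := intg_prodM fi' Vi'.
split.
  exact: (intg_transport mpsi psiE mF Fi).
have -> : Ex P (fun w => f (X w) * V w) = Ex PXG (fun z => f z.1 * V z.2).
  by rewrite -(Ex_transport mpsi psiE mF).
have [|_ ->] := Ex_fubini1 Fi; first by move=> x; exact: (intgZ (f x) Vi').
under eq_Ex do rewrite /= (ExZ (f _) Vi') mulrC.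
rewrite (ExZ _ fi') mulrC; congr (_ * _).
  exact/esym/(Ex_transport (P := P) (@measurable_funPT _ _ _ _ X) _ mf).
exact/esym/(Ex_transport (P := P) measurable_to_sub _ mV).
Qed.

End independence.

(** * Hilbert-valued variables *)

Lemma Ex_dominated {d : measure_display} {T : measurableType d} {R : realType}
    (P : probability T R) (u : nat -> T -> R) (f g : T -> R) :
  (forall n, measurable_fun [set: T] (u n)) -> (forall w, u ^~ w @ \oo --> f w) ->
  intg P g -> (forall n w, `|u n w| <= g w) ->
  intg P f /\ (fun n => Ex P (u n)) @ \oo --> Ex P f.
Proof.
move=> mu uf gi ug; have mf : measurable_fun [set: T] f by exact: (measurable_fun_cvg mu).
have mEu n : measurable_fun [set: T] (fun w => (u n w)%:E) by exact/measurable_EFinP.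
have mEf : measurable_fun [set: T] (fun w => (f w)%:E) by exact/measurable_EFinP.
have := @dominated_convergence _ T R P _ measurableT (fun n w => (u n w)%:E)
  (fun w => (f w)%:E) (fun w => (g w)%:E).
move=> /(_ mEu mEf); case=> //.
- by apply/aeW => w _; apply: cvg_EFin; [exact: nearW|exact: uf].
- by apply: aeW => w n _; rewrite lee_fin; exact: ug.
move=> fi _ h; split => //; rewrite (Ex_EFin fi) in h; exact: (fine_cvg h).
Qed.

Section hilbert_rv.
Context {R : realType} {H : completeNormedModType R} (dot : {dot H for idfun}).
Hypothesis dotE : hilbert_dot dot.
Context {d : measure_display} {T : measurableType d} (P : probability T R).

Lemma continuous_borel (f : H -> R) : continuous f ->
  measurable_fun [set: borel H] (f : borel H -> R).
Proof.
move=> cf; apply: (@measurability _ _ _ _ _ _ (@RGenOInfty.G R)).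
  exact: RGenOInfty.measurableE.
move=> _ [_ [c ->] <-]; rewrite setTI; apply: sub_sigma_algebra.
apply: open_comp; last exact: interval_open.
by move=> x _; exact: cf.
Qed.

Section one_variable.
Variables (q : R) (y : {RV P >-> borel H}).
Hypothesis q23 : 2 < q <= 3.
Hypothesis yq : (norm_moment P q (y : T -> H) < +oo)%E.

Lemma measurable_dotY v : measurable_fun [set: T] (fun w => dot (y w) v).
Proof.
apply: (@measurableT_comp _ _ _ _ _ _ (fun x : borel H => dot (x : H) v)) => //.
exact: (continuous_borel (@dot_continuousl _ _ _ dotE v)).
Qed.

Lemma measurable_normY : measurable_fun [set: T] (fun w => `|y w : H|).
Proof.
apply: (@measurableT_comp _ _ _ _ _ _ (fun x : borel H => `|x : H|)) => //.
exact: (continuous_borel (@norm_continuous _ H)).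
Qed.

Lemma intg_normq : intg P (fun w => `|y w : H| `^ q).
Proof.
apply/integrableP; split.
  apply/measurable_EFinP.
  exact: (measurableT_comp (measurable_powR q) measurable_normY).
move: yq; rewrite /norm_moment unlock; under [X in _ -> (X < _)%E]eq_integral do
  rewrite /= ger0_norm ?powR_ge0//.
by [].
Qed.

Lemma norm_momentE : norm_moment P q (y : T -> H) = (Ex P (fun w => `|y w : H| `^ q))%:E.
Proof. by rewrite /norm_moment unlock Ex_EFin//; exact: intg_normq. Qed.

Lemma intg_norm2 : intg P (fun w => `|y w : H| ^+ 2).
Proof.
apply: (@dom_intg _ _ _ _ _ (fun w => 1 + `|y w : H| `^ q)).
- exact: measurable_funX measurable_normY.
- by move=> w; rewrite ger0_norm ?sqr_ge0//; exact: sqr_le_1powR.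
- exact: (intgD (intg_cst P 1) intg_normq).
Qed.

Lemma intg_dotdot x v : intg P (fun w => dot (y w) x * dot (y w) v).
Proof.
apply: (dom_intg _ _ (intgZ (`|x| * `|v|) intg_norm2)).
  by apply: measurable_funM; exact: measurable_dotY.
move=> w; rewrite normrM mulrC.
apply: (le_trans (ler_pM _ _ (dot_norm dotE _ _) (dot_norm dotE _ _))) => //.
by rewrite mulrACA -expr2 mulrC [`|v| * _]mulrC.
Qed.

Lemma intg_dotY x : intg P (fun w => dot (y w) x).
Proof.
apply: (dom_intg _ _ (intgZ `|x| (intgD (intg_cst P 1) intg_norm2))).
  exact: measurable_dotY.
move=> w; apply: (le_trans (dot_norm dotE _ _)); rewrite mulrC ler_wpM2l//.
have := sqr_ge0 (`|y w : H| - 2^-1); rewrite sqrrB; lra.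
Qed.

(** [op_expectation] selects a weak expectation if there is one and is 0 otherwise; Riesz' theorem
    provides existence, and any selected vector has the same pairings. *)
Lemma hexpectation_tensor x v :
  dot (op_expectation P dot (fun w => tensor dot (y w) (y w)) x) v =
  Ex P (fun w => dot (y w) x * dot (y w) v).
Proof.
have [m mE] : exists m, forall v, Ex P (fun w => dot (y w) x * dot (y w) v) = dot m v.
  apply: (@riesz _ _ _ dotE _ (Ex P (fun w => `|y w : H| ^+ 2) * `|x|)).
    move=> a u z; rewrite -ExZ; last exact: intg_dotdot.
    rewrite -ExD; [|exact/intgZ/intg_dotdot|exact: intg_dotdot].
    by apply: eq_Ex => w; rewrite dotDr dotZr; ring.
  move=> u; rewrite -mulrA mulrC -ExZ; last exact: intg_norm2.
  apply: norm_Ex_le; [exact: intg_dotdot|exact/intgZ/intg_norm2|].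
  move=> w; rewrite normrM.
  apply: (le_trans (ler_pM _ _ (dot_norm dotE _ _) (dot_norm dotE _ _))) => //.
  by rewrite mulrACA -expr2 mulrC.
have : is_expectation P dot (fun w => tensor dot (y w) (y w) x) m.
  move=> u; rewrite unlock -mE -Ex_EFin; last exact: intg_dotdot.
  by apply: eq_integral => w _; rewrite /tensor dotZl.
move=> mP; have := @xgetPex _ 0 [set m | is_expectation P dot
  (fun w => tensor dot (y w) (y w) x) m] (ex_intro _ m mP) v.
rewrite -/(hexpectation P dot (fun w => tensor dot (y w) (y w) x)).
rewrite /op_expectation => h; apply/EFin_inj; rewrite -h unlock -Ex_EFin; last exact: intg_dotdot.
by apply: eq_integral => w _; rewrite /tensor dotZl.
Qed.

End one_variable.

Section many_variables.
Variables (q : R) (n : nat) (Y : 'I_n -> {RV P >-> borel H}) (b : nat -> H).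
Hypothesis q23 : 2 < q <= 3.
Hypothesis n0 : (0 < n)%N.
Hypothesis pb : parseval dot b.
Hypothesis indY : mutually_independent Y.
Hypothesis Y0 : forall i, is_expectation P dot (Y i) 0.
Hypothesis Yq : forall i, (norm_moment P q (Y i : T -> H) < +oo)%E.

Let Psi := avg_covariance P dot Y.
Let S w := n%:R^-1 * `|\sum_(i < n) (Y i w : H)| ^+ 2.
(** The trace of [Psi] and the mean of [S] at once; it also serves as operator bound in
    [psd_Psi]. *)
Let a := n%:R^-1 * \sum_i Ex P (fun w => `|Y i w : H| ^+ 2).

Let ni0 : (0 : R) < n%:R^-1. Proof. by rewrite invr_gt0 ltr0n. Qed.

Let Ydd i x v : intg P (fun w => dot (Y i w) x * dot (Y i w) v).
Proof. exact: intg_dotdot q23 (Yq i) x v. Qed.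

Lemma Psi_dot x v :
  dot (Psi x) v = n%:R^-1 * \sum_i Ex P (fun w => dot (Y i w) x * dot (Y i w) v).
Proof.
rewrite dotZl dot_suml; congr (_ * _); apply: eq_bigr => i _.
exact: hexpectation_tensor q23 (Yq i) x v.
Qed.

Lemma psd_Psi : psd dot Psi a.
Proof.
split=> [x y|x|x|].
- rewrite (dotC dot x) !Psi_dot; congr (_ * _); apply: eq_bigr => i _.
  by apply: eq_Ex => w; rewrite mulrC.
- rewrite Psi_dot mulr_ge0 ?(ltW ni0)// sumr_ge0// => i _; apply: Ex_ge0 => w.
  by rewrite -expr2 sqr_ge0.
- rewrite Psi_dot -mulrA ler_wpM2l ?(ltW ni0)// mulr_suml; apply: ler_sum => i _.
  rewrite mulrC -ExZ; last exact: intg_norm2 q23 (Yq i).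
  apply: le_Ex => [||w]; [exact: Ydd|exact: intgZ (intg_norm2 q23 (Yq i))|].
  rewrite -expr2 dotE -exprMn mulrC; apply: sqr_le_norm; exact: dot_norm.
- rewrite mulr_ge0 ?(ltW ni0)// sumr_ge0// => i _; apply: Ex_ge0 => w.
  exact: sqr_ge0.
Qed.

(** Parseval's identity for each [Y i], taken under the expectation by dominated convergence with
    bound [|Y i| ^ 2]. *)
Lemma trace_Psi : (fun K => \sum_(k < K) dot (Psi (b k)) (b k)) @ \oo --> a.
Proof.
have -> : (fun K => \sum_(k < K) dot (Psi (b k)) (b k)) =
    (fun K => n%:R^-1 * \sum_i Ex P (fun w => \sum_(k < K) dot (Y i w) (b k) ^+ 2)).
  apply/funext => K; under eq_bigr do rewrite Psi_dot.
  rewrite -mulr_sumr exchange_big; congr (_ * _); apply: eq_bigr => i _.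
  by rewrite -Ex_sum => [|k _]; [apply: eq_Ex => w; apply: eq_bigr|exact: Ydd].
apply: cvgM; first exact: cvg_cst.
apply: cvg_big => [|i _]; first exact: add_continuous.
apply: (Ex_dominated (u := fun K w => \sum_(k < K) dot (Y i w) (b k) ^+ 2) _ _
  (intg_norm2 q23 (Yq i)) _).2.
- move=> K; apply: measurable_csum => k _; apply: measurable_funX; exact: measurable_dotY.
- by move=> w; rewrite -dotE; exact: pb.
- move=> K w; rewrite ger0_norm ?sumr_ge0// => [|k _]; last exact: sqr_ge0.
  by rewrite -dotE; exact: (parseval_le pb).
Qed.

(** A pi-system of cylinders in the variables other than [Y i], generating the sigma-algebra that
    [indep_from] asks for. *)
Let G i : set (set T) := [set \bigcap_(k in [set` [set~ i]%SET]) (Y k @^-1` A k) |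
  A in [set A : 'I_n -> set (borel H) | forall k, measurable (A k)]].

Let mYA k A : measurable A -> measurable (Y k @^-1` A).
Proof. by move=> mA; rewrite -[_ @^-1` _]setTI; exact: measurable_funP. Qed.

Let Gm i : G i `<=` measurable.
Proof.
move=> _ [A mA <-]; apply: fin_bigcap_measurable; first exact: finite_finset.
by move=> k _; exact: mYA.
Qed.

Let GI i : setI_closed (G i).
Proof.
move=> _ _ [A mA <-] [A' mA' <-]; exists (fun k => A k `&` A' k).
  by move=> k; exact: measurableI.
apply/seteqP; split => [w h|w [h h'] k ki]; last by split; [exact: h|exact: h'].
by split => k ki; have [] := h k ki.
Qed.

Let GT i : G i setT.
Proof.
exists (fun=> setT) => //; apply/seteqP; split => // w _ k _.
Qed.

(** Independence is used twice: for all indices, with the sets [C'] that have [A] at place [i], and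
    for the indices other than [i]. *)
Let YG i A B : measurable A -> G i B -> P (Y i @^-1` A `&` B) = (P (Y i @^-1` A) * P B)%E.
Proof.
move=> mA [C mC <-]; pose C' k := if k == i then A else C k.
have mC' k : measurable (C' k) by rewrite /C'; case: ifP.
rewrite (indY [set~ i]%SET mC).
have -> : Y i @^-1` A `&` \bigcap_(k in [set` [set~ i]%SET]) (Y k @^-1` C k) =
    \bigcap_(k in [set` [set: 'I_n]%SET]) (Y k @^-1` C' k).
  apply/seteqP; split => [w [Aw Cw] k _|w Cw]; rewrite /C'.
    by rewrite /preimage/=; case: eqP => [->//|/eqP ki]; apply: Cw; rewrite /= !inE.
  split; first by have := Cw i; rewrite /C' /preimage/= eqxx; apply; rewrite /= inE.
  move=> k /=; rewrite !inE => ki; have := Cw k; rewrite /C' /preimage/= (negPf ki).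
  by apply; rewrite /= inE.
rewrite (indY [set: 'I_n]%SET mC') (bigD1 i) ?inE//= /C' eqxx; congr (_ * _)%E.
apply: eq_big => [k|k]; first by rewrite !inE.
by move=> /andP[_ /negPf ->].
Qed.

Let measurable_sub i k v : k != i ->
  measurable_fun [set: g_sigma_algebraType (G i)] ((fun w => dot (Y k w) v) :
    g_sigma_algebraType (G i) -> R).
Proof.
move=> ki _ B mB; rewrite setTI; apply: sub_sigma_algebra.
exists (fun j => if j == k then [set x : borel H | B (dot (x : H) v)] else setT).
  move=> j; case: ifP => // _; rewrite -[X in measurable X]setTI.
  exact: (continuous_borel (@dot_continuousl _ _ _ dotE v)).
apply/seteqP; split => [w h|w Bw j _].
  by have := h k; rewrite /preimage/= eqxx; apply; rewrite /= !inE.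
by rewrite /preimage/=; case: ifP => // /eqP ->.
Qed.

Lemma Ex_dotY i v : Ex P (fun w => dot (Y i w) v) = 0.
Proof.
have := Y0 i v; rewrite unlock Ex_EFin ?dot0l => [[]//|].
exact: intg_dotY q23 (Yq i) v.
Qed.

Lemma Ex_cross i k x v : i != k -> intg P (fun w => dot (Y i w) x * dot (Y k w) v) /\
  Ex P (fun w => dot (Y i w) x * dot (Y k w) v) = 0.
Proof.
rewrite eq_sym => ki.
have [h1 h2] := Ex_indep (Gm (i := i)) (@GI i) (GT i) (@YG i)
  (continuous_borel (@dot_continuousl _ _ _ dotE x)) (measurable_sub v ki)
  (intg_dotY q23 (Yq i) x) (intg_dotY q23 (Yq k) v).
by split => //; rewrite h2 Ex_dotY mul0r.
Qed.

Lemma Ex_sum_sqr x : intg P (fun w => dot (\sum_i (Y i w : H)) x ^+ 2) /\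
  Ex P (fun w => dot (\sum_i (Y i w : H)) x ^+ 2) = n%:R * dot (Psi x) x.
Proof.
have E w : \sum_i \sum_k dot (Y i w) x * dot (Y k w) x = dot (\sum_i (Y i w : H)) x ^+ 2.
  rewrite expr2 dot_suml mulr_suml; apply: eq_bigr => i _.
  by rewrite mulr_sumr.
have I i k : intg P (fun w => dot (Y i w) x * dot (Y k w) x).
  by have [->|ik] := eqVneq i k; [exact: Ydd|exact: (Ex_cross x x ik).1].
have I' i : intg P (fun w => \sum_k dot (Y i w) x * dot (Y k w) x).
  by apply: intg_sum => k _; exact: I.
split; first by apply: (eq_intg E); apply: intg_sum => i _; exact: I'.
rewrite -(eq_Ex P E) Ex_sum => [|i _]; last exact: I'.
rewrite Psi_dot mulVKf ?pnatr_eq0 -?lt0n//; apply: eq_bigr => i _.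
rewrite Ex_sum => [|k _]; last exact: I.
rewrite (bigD1 i)//= big1 ?addr0// => k ki.
by rewrite (Ex_cross x x _).2// eq_sym.
Qed.

Lemma Ex_S : intg P S /\ Ex P S = a.
Proof.
pose u K w := n%:R^-1 * \sum_(k < K) dot (\sum_i (Y i w : H)) (b k) ^+ 2.
(* From [|Y i| |Y k| <= |Y i| ^ 2 + |Y k| ^ 2] in the expanded square of the sum of the norms: a
   dominating function that involves second moments only. *)
pose g w := n%:R^-1 * \sum_i \sum_k (`|Y i w : H| ^+ 2 + `|Y k w : H| ^+ 2).
have gi : intg P g.
  apply: intgZ; apply: intg_sum => i _; apply: intg_sum => k _.
  by apply: intgD; [exact: intg_norm2 q23 (Yq i)|exact: intg_norm2 q23 (Yq k)].
have iu K : intg P (fun w => \sum_(k < K) dot (\sum_i (Y i w : H)) (b k) ^+ 2).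
  by apply: intg_sum => k _; exact: (Ex_sum_sqr (b k)).1.
have uS w : u ^~ w @ \oo --> S w.
  by apply: cvgM; [exact: cvg_cst|rewrite -dotE; exact: pb].
have ug K w : `|u K w| <= g w.
  rewrite ger0_norm; last first.
    by rewrite mulr_ge0 ?(ltW ni0)// sumr_ge0// => k _; exact: sqr_ge0.
  rewrite ler_wpM2l ?(ltW ni0)//; apply: (le_trans (parseval_le pb _ _)).
  rewrite dotE; apply: (@le_trans _ _ ((\sum_i `|Y i w : H|) ^+ 2)).
    by apply: sqr_le_norm; rewrite normr_id; exact: ler_norm_sum.
  rewrite expr2 mulr_suml; apply: ler_sum => i _; rewrite mulr_sumr; apply: ler_sum => k _.
  have := sqr_ge0 (`|Y i w : H| - `|Y k w : H|).
  by have := sqr_ge0 (`|Y i w : H| + `|Y k w : H|); lra.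
have [Si Sc] := Ex_dominated (fun K => intg_measurable (intgZ _ (iu K))) uS gi ug.
split => //; rewrite -(cvg_lim (@Rhausdorff R) Sc) -(cvg_lim (@Rhausdorff R) trace_Psi).
congr (lim (_ @ \oo)); apply/funext => K; rewrite ExZ; last exact: iu.
rewrite Ex_sum => [|k _]; last exact: (Ex_sum_sqr (b k)).1.
rewrite mulr_sumr; apply: eq_bigr => k _.
by rewrite (Ex_sum_sqr (b k)).2 mulKf// pnatr_eq0 -lt0n.
Qed.

Section coordinates.
Variables (J : finType) (e : J -> H) (lam : J -> R).
Hypothesis oe : orthonormal dot e.
Hypothesis Pe : forall j, Psi (e j) = lam j *: e j.

Let r := (Num.sqrt n%:R : R)^-1.
Let r0 : 0 < r. Proof. by rewrite invr_gt0 sqrtr_gt0 ltr0n. Qed.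
Let r2 : r ^+ 2 = n%:R^-1. Proof. by rewrite exprVn sqr_sqrtr// ler0n. Qed.

Definition coord_rv i j w : R := r * dot (Y i w) (e j).
Local Notation X := coord_rv.

Lemma measurable_coord i j : measurable_fun [set: T] (X i j).
Proof. by apply: measurable_funM => //; exact: measurable_dotY. Qed.

Lemma nr_coord i w : nr (X i ^~ w) <= r * `|Y i w : H|.
Proof.
rewrite -(@ler_pXn2r _ 2) ?nnegrE ?nr_ge0 ?mulr_ge0 ?(ltW r0)// nr_sqr exprMn -dotE.
rewrite /ip; under eq_bigr do rewrite /X mulrACA -!expr2.
by rewrite -mulr_sumr ler_wpM2l ?sqr_ge0//; exact: (bessel dotE _ oe).
Qed.

Lemma nr_coord_powR i w : nr (X i ^~ w) `^ q <= r `^ q * `|Y i w : H| `^ q.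
Proof.
have q0 : 0 <= q by have /andP[] := q23; lra.
rewrite -powRM ?(ltW r0)//; apply: ge0_ler_powR; rewrite ?nnegrE ?nr_ge0//.
  by rewrite mulr_ge0 ?(ltW r0).
exact: nr_coord.
Qed.

Lemma intg_coordq i : intg P (fun w => nr (X i ^~ w) `^ q).
Proof.
apply: (dom_intg _ _ (intgZ (r `^ q) (intg_normq (Yq i)))).
  by apply: (measurableT_comp (measurable_powR q)); apply: measurable_nr => j;
    exact: measurable_coord.
by move=> w; rewrite ger0_norm ?powR_ge0//; exact: nr_coord_powR.
Qed.

Lemma Ex_coordq i : Ex P (fun w => nr (X i ^~ w) `^ q) <=
  r `^ q * fine (norm_moment P q (Y i : T -> H)).
Proof.
rewrite norm_momentE// /= -ExZ; last exact: intg_normq.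
by apply: le_Ex => [||w]; [exact: intg_coordq|apply: intgZ; exact: intg_normq|
  exact: nr_coord_powR].
Qed.

Lemma Ex_coord i j : Ex P (X i j) = 0.
Proof. by rewrite ExZ ?Ex_dotY ?mulr0//; exact: intg_dotY q23 (Yq i) _. Qed.

Lemma cov_coord j k : \sum_i Ex P (fun w => X i j w * X i k w) = lam j * (j == k)%:R.
Proof.
rewrite -oe -dotZl -Pe Psi_dot mulr_sumr; apply: eq_bigr => i _.
rewrite -ExZ; last exact: Ydd.
by apply: eq_Ex => w; rewrite -r2 /X; ring.
Qed.

(** The monomials of [indep_from] are continuous functions of [Y i], so independence of [Y i] from
    the cylinders suffices. *)
Lemma indep_coord i : indep_from P X i.
Proof.
have cd j : continuous (fun x : H => r * dot x (e j)).
  move=> x; apply: cvgM; first exact: cvg_cst.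
  exact: dot_continuousl.
exists (G i); split => [k j ki|U V UX mV [C VC]].
  by apply: measurable_funM => //; exact: measurable_sub.
have mVT : measurable_fun [set: T] V.
  move=> _ B mB; have := mV measurableT B mB; rewrite !setTI.
  exact: (smallest_sub (@sigma_algebra_measurable _ T) (Gm (i := i))).
have Vi : intg P V by exact: bounded_intg mVT VC.
have [f cf [fi ->]] : exists2 f : H -> R, continuous f &
    intg P (fun w => f (Y i w)) /\ U = (fun w => f (Y i w)).
  case: UX => [[j ->]|[j [k ->]]].
    exists (fun x => r * dot x (e j)); first exact: cd.
    by split => //; apply: intgZ; exact: intg_dotY q23 (Yq i) _.
  exists (fun x => (r * dot x (e j)) * (r * dot x (e k))).
    by move=> x; apply: cvgM; exact: cd.
  split => //; apply: (eq_intg _ (intgZ (r ^+ 2) (Ydd i (e j) (e k)))) => w; ring.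
exact: (Ex_indep (Gm (i := i)) (@GI i) (GT i) (@YG i) (continuous_borel cf) mV fi Vi).2.
Qed.

Lemma nr_Zsum_coord w :
  nr (Zsum X w) ^+ 2 = n%:R^-1 * \sum_j dot (\sum_i (Y i w : H)) (e j) ^+ 2.
Proof.
rewrite nr_sqr mulr_sumr; apply: eq_bigr => j _.
by rewrite /Zsum /X -mulr_sumr -dot_suml mulrACA -!expr2 r2.
Qed.

Lemma coord_le_S w : nr (Zsum X w) ^+ 2 <= S w.
Proof.
rewrite nr_Zsum_coord ler_wpM2l ?(ltW ni0)// -dotE; exact: (bessel dotE _ oe).
Qed.

Lemma Ex_nr_coord : intg P (fun w => nr (Zsum X w) ^+ 2) /\
  Ex P (fun w => nr (Zsum X w) ^+ 2) = \sum_j lam j.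
Proof.
have I : intg P (fun w => \sum_j dot (\sum_i (Y i w : H)) (e j) ^+ 2).
  by apply: intg_sum => j _; exact: (Ex_sum_sqr (e j)).1.
split; first by apply: (eq_intg _ (intgZ n%:R^-1 I)) => w; rewrite nr_Zsum_coord.
under eq_Ex do rewrite nr_Zsum_coord.
rewrite ExZ// Ex_sum => [|j _]; last exact: (Ex_sum_sqr (e j)).1.
rewrite mulr_sumr; apply: eq_bigr => j _.
by rewrite (Ex_sum_sqr (e j)).2 mulKf ?pnatr_eq0 -?lt0n// Pe dotZl oe eqxx mulr1.
Qed.

End coordinates.

End many_variables.

End hilbert_rv.

(** * From finite to infinite dimension *)

(** Truncation loses [2 ^ 3] through [B], and at most [2 ^ 2] through the power [q / 2 <= 2] of [A];
    the product 32 is below [4 ^ 4], whose fourth root is the factor 4. [N] stands for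
    [n ^ (- q / 2)], whose fourth root is the factor [n ^ (- q / 8)] of the theorem. *)
Lemma lyapunov_term_le (R : realType) (q A B s BF M N m : R) :
  2 < q <= 3 -> 0 < A -> 0 < B -> A / 2 <= s <= A -> B / 2 <= BF ->
  0 <= N -> 0 <= M -> 0 <= m <= N * M ->
  (s ^+ 3 / BF ^+ 3 * (m / s `^ (q / 2))) `^ (1 / 4) <=
  4 * (N `^ (1 / 4) * (A ^+ 3 / B ^+ 3 * (M / A `^ (q / 2))) `^ (1 / 4)).
Proof.
move=> /andP[q2 q3] A0 B0 /andP[sA As] BFB N0 M0 /andP[m0 mM].
have s0 : 0 < s by lra.
have BF0 : 0 < BF by lra.
have h1 : s ^+ 3 <= A ^+ 3 by rewrite lerXn2r ?nnegrE ?(ltW s0) ?(ltW A0).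
have h2 : (BF ^+ 3)^-1 <= 8 * (B ^+ 3)^-1.
  have -> : 8 * (B ^+ 3)^-1 = ((B / 2) ^+ 3)^-1 by field; rewrite gt_eqF.
  rewrite lef_pV2 ?posrE ?exprn_gt0 ?divr_gt0//.
  by rewrite lerXn2r ?nnegrE ?divr_ge0 ?(ltW B0) ?(ltW BF0).
have h3 : (s `^ (q / 2))^-1 <= 4 * (A `^ (q / 2))^-1.
  rewrite -[4]invrK -invfM lef_pV2 ?posrE ?mulr_gt0 ?invr_gt0 ?powR_gt0//.
  rewrite ler_pdivrMl//; apply: (@le_trans _ _ ((2 * s) `^ (q / 2))).
    by apply: ge0_ler_powR; rewrite ?nnegrE; lra.
  rewrite powRM ?(ltW s0)// ler_wpM2r ?powR_ge0//.
  apply: (@le_trans _ _ (2 `^ 2%:R)); first by apply: ler_powR; lra.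
  by rewrite powR_mulrn//; lra.
set L := A ^+ 3 / B ^+ 3 * _.
have L0 : 0 <= L by rewrite !mulr_ge0 ?invr_ge0 ?powR_ge0 ?exprn_ge0 ?(ltW A0) ?(ltW B0).
have -> : 4 * (N `^ (1 / 4) * L `^ (1 / 4)) = (4 ^+ 4 * (N * L)) `^ (1 / 4).
  rewrite (powRM _ (exprn_ge0 4 (ler0n R 4)) (mulr_ge0 N0 L0)) (powRM _ N0 L0); congr (_ * _).
  rewrite -powR_mulrn// -powRrM (_ : 4%:R * (1 / 4) = 1) ?powRr1//.
  by field.
have b0 : 0 <= (BF ^+ 3)^-1 by rewrite invr_ge0 exprn_ge0 ?ltW.
have c0 : 0 <= (s `^ (q / 2))^-1 by rewrite invr_ge0 powR_ge0.
have s3 : 0 <= s ^+ 3 by rewrite exprn_ge0// ltW.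
have l1 : s ^+ 3 / BF ^+ 3 <= A ^+ 3 * (8 * (B ^+ 3)^-1) by exact: ler_pM.
have l2 : m / s `^ (q / 2) <= N * M * (4 * (A `^ (q / 2))^-1) by exact: ler_pM.
have p1 : 0 <= s ^+ 3 / BF ^+ 3 by exact: mulr_ge0.
have p2 : 0 <= m / s `^ (q / 2) by exact: mulr_ge0.
have NL := mulr_ge0 N0 L0.
apply: ge0_ler_powR; rewrite ?nnegrE.
- by rewrite divr_ge0.
- exact: mulr_ge0.
- by rewrite mulr_ge0// exprn_ge0.
apply: (le_trans (ler_pM p1 p2 l1 l2)).
have -> : A ^+ 3 * (8 * (B ^+ 3)^-1) * (N * M * (4 * (A `^ (q / 2))^-1)) = 32 * (N * L).
  by rewrite /L; ring.
by rewrite ler_wpM2r//; lra.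
Qed.

Lemma prb_markov (d : measure_display) (T : measurableType d) (R : realType)
  (P : probability T R) (f : T -> R) c : intg P f -> (forall w, 0 <= f w) -> 0 < c ->
  prb P (fun w => c < f w) <= Ex P f / c.
Proof.
move=> fi f0 c0; rewrite mulrC -ExZ//; apply: le_Ex => [||w].
- by apply: intg_prb; apply: measurable_lt_set; exact: (intg_measurable fi).
- exact: intgZ.
rewrite mulrC; case: ltP => cf; last by rewrite divr_ge0// ltW.
by rewrite ler_pdivlMr// mul1r ltW.
Qed.

Theorem proposition4 (R : realType) (q : R) (hq : 2 < q <= 3) :
  exists2 K : R, 0 < K &
  forall (d : measure_display) (Omega : measurableType d)
    (P : probability Omega R)
    (H : completeNormedModType R) (dot : {dot H for idfun})
    (n : nat) (Y : 'I_n -> {RV P >-> borel H}) (T : {RV P >-> R})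
    (d' : measure_display) (Omega' : measurableType d')
    (P' : probability Omega' R) (G : {RV P' >-> R}),
  let S : Omega -> R := fun w => n%:R^-1 * `|\sum_(i < n) (Y i w : H)| ^+ 2 in
  let Psi : H -> H := avg_covariance P dot Y in
  let A : R := fine (schatten dot 1 Psi) in
  let B : R := Num.sqrt 2 * fine (schatten dot 2 Psi) in
  let C : R := 2 * fine (schatten dot 3 Psi) in
  hilbert_dot dot ->
  separable_space H ->
  mutually_independent Y ->
  (forall i, is_expectation P dot (Y i) 0) ->
  (forall i, (norm_moment P q (Y i : Omega -> H) < +oo)%E) ->
  Psi <> (fun=> 0) ->
  std_normal G ->
  forall u : R, 0 < u ->
  kolmogorov_dist P (fun w => (T w - A) / B) P' G <=
  K * (n%:R `^ (- q / 8) *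
         (A ^+ 3 / B ^+ 3 *
          \sum_(i < n) fine (norm_moment P q (Y i : Omega -> H)) / A `^ (q / 2))
         `^ (1 / 4)
       + (C / B) ^+ 3
       + fine (P [set w | u < `|T w - S w|])
       + u / B).
Proof.
have K1 := @core_K_ge1 R; have p0 := @normal_peak_ge0 R 1.
exists (4 * core_K R); first by rewrite mulr_gt0// (lt_le_trans ltr01).
move=> d Om P H dot n Y T d' Om' P' G S Psi A B C dotE sepH indY Y0 Yq PsiN stdG u u0.
(* For [n = 0] the inverse of 0 is 0, so [Psi] would vanish. *)
have n0 : (0 < n)%N.
  rewrite lt0n; apply/eqP => n0; apply: PsiN; apply/funext => x.
  have nz : n%:R^-1 = 0 :> R by rewrite n0 invr0.
  by rewrite /Psi /avg_covariance nz scale0r.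
have [b pb] := parseval_ex dotE sepH.
pose a := n%:R^-1 * \sum_i Ex P (fun w => `|Y i w : H| ^+ 2).
have pP : psd dot Psi a := psd_Psi dotE hq n0 Yq.
have a0 : 0 < a.
  rewrite lt_neqAle (psd_cst pP) andbT; apply/eqP => az; apply: PsiN; apply/funext => x.
  by apply/eqP; rewrite -normr_le0; have := psd_norm dotE pP x; rewrite -az mul0r.
have [t2 [t3 [E1 E2 E3 [t20 t30] approx]]] :=
  spectral_approximation dotE pP pb (@trace_Psi _ _ _ dotE _ _ _ _ _ _ _ hq pb Yq).
have [t2p t3p] : 0 < t2 /\ 0 < t3.
  (* With tolerance [a] the retained eigenvalues have a positive sum, so there is at least one. *)
  have [J [e [lam [oe Le lam0 [/andP[h1 _] /andP[_ h2] /andP[_ h3]]]]]] := approx a a0.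
  rewrite subrr in h1.
  have [j _] : exists2 j, true & 0 < lam j.
    have [j _|J0] := pickP (fun _ : J => true); first by exists j.
    by move: h1; rewrite big_pred0// ltxx.
  move=> lj; split; [apply: lt_le_trans h2|apply: lt_le_trans h3];
    by rewrite (bigD1 j)//= ltr_pwDl ?exprn_gt0// sumr_ge0// => i _; rewrite exprn_ge0// ltW.
have AE : A = a by rewrite /A E1.
have BE : B = Num.sqrt (2 * t2) by rewrite /B E2 sqrtrM.
have B0 : 0 < B by rewrite BE sqrtr_gt0 mulr_gt0.
have B2 : B ^+ 2 = 2 * t2 by rewrite BE sqr_sqrtr// mulr_ge0.
pose rho := t3 / B ^+ 3.
have rho0 : 0 < rho by rewrite divr_gt0// exprn_gt0.
have C3 : (C / B) ^+ 3 = 8 * rho.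
  rewrite /C E3 expr_div_n exprMn /= -[(t3 `^ _) ^+ 3]powR_mulrn ?powR_ge0// -powRrM.
  by rewrite mulVf// powRr1// /rho; ring.
pose M := \sum_i fine (norm_moment P q (Y i : Om -> H)).
apply: ge_sup; first by exists `|fine (P [set w | (T w - A) / B <= 0]) - fine (P' [set w | G w <= 0])|, 0.
move=> _ [x _ <-].
have -> : fine (P' [set w | G w <= x]) = Phi x.
  have GE : P' (G @^-1` [set` `]-oo, x]]) = @gam R [set` `]-oo, x]].
    by apply: stdG; exact: measurable_itv.
  rewrite PhiE -GE; have -> // : [set w | G w <= x] = G @^-1` [set` `]-oo, x]].
  by apply/seteqP; split => w /=; rewrite in_itv.
have mT : measurable_fun [set: Om] T by [].
have -> : [set w | (T w - A) / B <= x] = [set w | T w <= A + B * x].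
  by apply/seteqP; split => w /=; rewrite ler_pdivrMr// lerBlDl mulrC.
have [iS ES] := Ex_S dotE hq n0 pb indY Y0 Yq.
have mTS : measurable_fun [set: Om] (fun w => `|T w - S w|).
  apply: measurableT_comp => //; apply: measurable_funB => //; exact: (intg_measurable iS).
rewrite !prbE; [|exact: measurable_lt_set|exact: measurable_le_set].
set D := prb P (fun w => u < _); rewrite C3 AE.
(* [cx] comes from [|xF - x| <= (1 + 2 |x| / B) del / BF] with [BF >= B / 2], times the Lipschitz
   constant of [Phi]. *)
pose cx := normal_peak 1 * ((1 + 2 * `|x| / B) * 2 / B).
have cx0 : 0 <= cx.
  apply: mulr_ge0 => //; apply: divr_ge0; last exact: ltW.
  apply: mulr_ge0 => //; apply: addr_ge0 => //; apply: divr_ge0; last exact: ltW.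
  exact: mulr_ge0.
(* [del] may depend on [x]: the error made when truncating the spectrum is thus
   absorbed in [rho], which is [C^3 / (8 B^3)], and no limit is needed. *)
have [del [del0 del1 del2 del3 del4]] : exists del, [/\ 0 < del, del <= a / 2, del <= t2 / 2,
    del <= rho * u & del * cx <= rho].
  pose m1 := Num.min (a / 2) (t2 / 2); pose m2 := Num.min (rho * u) (rho / (cx + 1)).
  have c1 : 0 < cx + 1 by rewrite ltr_wpDl.
  have k1 : 0 < a / 2 by rewrite divr_gt0.
  have k2 : 0 < t2 / 2 by rewrite divr_gt0.
  have k3 : 0 < rho * u by exact: mulr_gt0.
  have k4 : 0 < rho / (cx + 1) by exact: divr_gt0.
  exists (Num.min m1 m2); split; try by rewrite !ge_min lexx ?orbT.
    by rewrite !lt_min k1 k2 k3.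
  apply: (@le_trans _ _ (rho / (cx + 1) * cx)).
    by rewrite ler_wpM2r// !ge_min lexx !orbT.
  by rewrite mulrAC ler_pdivrMr// ler_wpM2l ?(ltW rho0)// lerDl.
have [J [e [lam [oe Le lam0 [/andP[s1l s1u] /andP[s2l s2u] /andP[s3l s3u]]]]]] := approx del del0.
set s1 := \sum_j lam j in s1l s1u; set s2 := \sum_j lam j ^+ 2 in s2l s2u.
set s3 := \sum_j lam j ^+ 3 in s3l s3u.
have s10 : 0 < s1 by lra.
pose BF := Num.sqrt (2 * s2).
have s20 : 0 < s2 by lra.
have BF2 : BF ^+ 2 = 2 * s2 by rewrite sqr_sqrtr// mulr_ge0// ltW.
have BF0 : 0 < BF by rewrite sqrtr_gt0 mulr_gt0.
have BFu : BF <= B by rewrite -(@ler_pXn2r _ 2) ?nnegrE ?(ltW B0) ?(ltW BF0)// BF2 B2; lra.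
have BFl : B / 2 <= BF.
  rewrite -(@ler_pXn2r _ 2) ?nnegrE ?divr_ge0 ?(ltW B0) ?(ltW BF0)// expr_div_n BF2 B2; lra.
have lam0' j : 0 <= lam j by exact: ltW.
(* [xF] is the level at which the truncated normalization describes the same event for [T]. *)
pose xF := (a + B * x - s1) / BF.
have xFE : s1 + BF * xF = a + B * x by rewrite /xF mulrC divfK ?gt_eqF//; ring.
(* Half of [2 * u] is left for [|T - S|], the other half for the truncation error of [S]. *)
have u20 : 0 < 2 * u by rewrite mulr_gt0.
have := finite_dimensional_bound hq (measurable_coord dotE Y e) (intg_coordq dotE hq n0 Yq oe)
  (Ex_coord dotE hq Y0 Yq e) lam0' (cov_coord dotE hq Yq oe Le)
  (indep_coord dotE hq indY Yq e) s10 xF mT u20.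
rewrite -/s1 -/s2 -/BF xFE.
set mF := \sum_i Ex P _; pose SF w := nr (Zsum (coord_rv dot Y e) w) ^+ 2.
set rF := \sum_j (lam j / BF) ^+ 3; rewrite -/(SF _).
set DF := prb P (fun w => 2 * u < _) => main.
have [iSF ESF] := Ex_nr_coord dotE hq n0 indY Y0 Yq oe Le.
have DFle : DF <= D + rho.
  have iD : intg P (fun w => S w - SF w) by exact: intgB.
  have D0 w : 0 <= S w - SF w by rewrite subr_ge0; exact: (coord_le_S dotE Y n0 oe).
  (* Markov's inequality: the truncation error is nonnegative by Bessel, and its mean [a - s1] is
     less than [del <= rho * u]. *)
  have mk : prb P (fun w => u < S w - SF w) <= rho.
    apply: (le_trans (prb_markov iD D0 u0)); rewrite ler_pdivrMr// ExB// ES ESF -/a -/s1.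
    by lra.
  apply: le_trans (lerD (lexx D) mk).
  have mTF : measurable_fun [set: Om] (fun w => `|T w - SF w|).
    apply: measurableT_comp => //; apply: measurable_funB => //; exact: (intg_measurable iSF).
  have mu1 := measurable_lt_set (2 * u) mTF; have mu2 := measurable_lt_set u mTS.
  have mu3 := measurable_lt_set u (intg_measurable iD).
  apply: (le_prb2 _ mu1 mu2 mu3).
    move=> w h; apply/orP; have [uT|Tu] := ltP u `|T w - S w|; [by left|right].
    have := ler_normD (T w - S w) (S w - SF w); rewrite addrA subrK [`|S w - _|]ger0_norm//.
    by move=> h2; have := lt_le_trans h h2; lra.
have rFle : rF <= 8 * rho.
  have -> : rF = s3 / BF ^+ 3.
    by rewrite /s3 mulr_suml; apply: eq_bigr => j _; rewrite expr_div_n.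
  have -> : 8 * rho = t3 / (B / 2) ^+ 3 by rewrite /rho; field; rewrite gt_eqF.
  apply: ler_pM => //; rewrite ?invr_ge0 ?exprn_ge0 ?(ltW BF0)//.
    by rewrite sumr_ge0// => j _; rewrite exprn_ge0.
  rewrite lef_pV2 ?posrE ?exprn_gt0 ?divr_gt0// lerXn2r ?nnegrE ?divr_ge0 ?(ltW B0) ?(ltW BF0)//.
have uF : 2 * u / BF <= 4 * (u / B).
  have -> : 4 * (u / B) = 2 * u / (B / 2) by field; rewrite gt_eqF.
  by rewrite ler_wpM2l ?(ltW u20)// lef_pV2 ?posrE ?divr_gt0.
have M0 : 0 <= M.
  by apply: sumr_ge0 => i _; rewrite norm_momentE//=; apply: Ex_ge0 => w; exact: powR_ge0.
have mFle : 0 <= mF <= n%:R `^ (- q / 2) * M.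
  apply/andP; split; first by apply: sumr_ge0 => i _; apply: Ex_ge0 => w; exact: powR_ge0.
  have -> : n%:R `^ (- q / 2) = (Num.sqrt n%:R)^-1 `^ q :> R.
    rewrite -powR12_sqrt ?ler0n// -powRN -powRrM; congr (_ `^ _); by field.
  by rewrite /M mulr_sumr; apply: ler_sum => i _; exact: (Ex_coordq dotE hq n0 Yq oe).
have s1A : a / 2 <= s1 <= a by rewrite s1u andbT; lra.
have Lle := lyapunov_term_le hq a0 B0 s1A BFl (powR_ge0 n%:R (- q / 2)) M0 mFle.
have -> : (a ^+ 3 / B ^+ 3 * \sum_(i < n) fine (norm_moment P q (Y i : Om -> H)) / a `^ (q / 2)) =
    a ^+ 3 / B ^+ 3 * (M / a `^ (q / 2)) by rewrite /M mulr_suml.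
rewrite -powRrM in Lle.
have nE : - q / 2 * (1 / 4) = - q / 8 by field.
rewrite nE in Lle.
set L' := n%:R `^ _ * _ in Lle *.
have xFx : `|Phi xF - Phi x| <= rho.
  apply: le_trans (Phi_lipschitz x xF) _.
  apply: (le_trans _ del4); rewrite /cx mulrCA ler_wpM2l//.
  have -> : xF - x = ((a - s1) + (B - BF) * x) / BF by rewrite /xF; field; rewrite gt_eqF.
  rewrite normrM normfV (gtr0_norm BF0) ler_pdivrMr//.
  have BB : B - BF <= 2 * del / B.
    rewrite ler_pdivlMr//; have : B * B = 2 * t2 by rewrite -expr2.
    have : BF * BF = 2 * s2 by rewrite -expr2.
    have : BF * BF <= BF * B by rewrite ler_wpM2l ?(ltW BF0).
    lra.
  have l1 : `|a - s1 + (B - BF) * x| <= del + 2 * del / B * `|x|.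
    apply: (le_trans (ler_normD _ _)); apply: lerD; first by rewrite ger0_norm; lra.
    by rewrite normrM ger0_norm ?subr_ge0// ler_wpM2r.
  apply: (le_trans l1).
  have -> : del * ((1 + 2 * `|x| / B) * 2 / B) * BF =
      (del + 2 * del / B * `|x|) * (BF / (B / 2)) by field; rewrite gt_eqF.
  rewrite ler_peMr// ?ler_pdivlMr ?mul1r ?divr_gt0//.
  by rewrite addr_ge0 ?(ltW del0)// !mulr_ge0 ?invr_ge0 ?(ltW B0) ?(ltW del0).
have D0 := prb_ge0 P (fun w => u < `|T w - S w|); rewrite -/D in D0.
have uB0 : 0 < u / B by rewrite divr_gt0.
have L'0 : 0 <= L' by rewrite mulr_ge0 ?powR_ge0.
have K0 : 0 <= core_K R by exact: le_trans ler01 K1.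
have -> : prb P (fun w => T w <= a + B * x) - Phi x =
    (prb P (fun w => T w <= a + B * x) - Phi xF) + (Phi xF - Phi x) by ring.
apply: (le_trans (ler_normD _ _)).
(* The multiples of [rho] add up to 10, within the [4 * 8] allowed by [(C / B) ^ 3 = 8 rho]; the
   overall factor 4 is the one carried by [L'] and [u / B]. *)
apply: (@le_trans _ _ (core_K R * (4 * L' + 8 * rho + (D + rho) + 4 * (u / B)) + core_K R * rho)).
  apply: lerD; last by apply: (le_trans xFx); rewrite ler_peMl// ltW.
  by apply: (le_trans main); apply: (ler_wpM2l K0); rewrite !lerD.
rewrite -mulrDr [4 * core_K R]mulrC -mulrA ler_wpM2l//; lra.
Qed.
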